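(* Fix an integer $k\ge 1$. Let $c_1,\dots,c_k$ be distinct points of $\mathbb C$ and let $r_1,\dots,r_k$ be complex numbers. Define $$e_i(z)=\prod_{j\ne i}\frac{z-c_j}{c_i-c_j},\qquad v_i=\sum_{j\ne i}\left[-\frac32\frac{1}{(c_i-c_j)^2}+\frac{r_j}{c_i-c_j}\right].$$ Let $G$ be an entire function and let $$(\ast)\qquad \psi(z)=\sum_{i=1}^k\left[-\frac32\frac{1}{(z-c_i)^2}+\frac{r_i}{z-c_i}+\Bigl(-\frac12r_i^2-v_i\Bigr)e_i(z)\right]+G(z)\prod_{i=1}^k(z-c_i).$$ Then $\psi=S_f$ for a function $f$ which is meromorphic in the entire complex plane and has precisely $k$ critical points, that are simple and located at $c_1,\dots,c_k$. Conversely, any function $f$ which is meromorphic in the entire complex plane and has precisely $k$ critical points, simple and located at $c_1,\dots,c_k$, must have a Schwarzian derivative of the form $(\ast)$ (for some complex numbers $r_1,\dots,r_k$ and some entire function $G$).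
   Context: For a non-constant meromorphic function $f$, $S_f=\frac{f'''}{f'}-\frac32\left(\frac{f''}{f'}\right)^2$ is its Schwarzian derivative (extended by continuity to points where $f=\infty$). Meromorphic functions are regarded as holomorphic maps into $\widehat{\mathbb C}$; a critical point is a point where the local degree is at least $2$ (so a multiple pole of $f$ is a critical point), and it is simple if the local degree is exactly $2$. *)

(* Defs.v *)
From Stdlib Require Import Reals.
From Coquelicot Require Import Coquelicot.
From mathcomp Require Import all_boot.

Set Implicit Arguments.
Unset Strict Implicit.
Unset Printing Implicit Defensive.

Local Open Scope C_scope.

(* Holomorphy is complex differentiability: for maps [C -> C], [ex_derive]
   elaborates to differentiability over the scalars [C_AbsRing]. *)
Definition holomorphic_near (g : C -> C) (z : C) : Prop :=
  locally z (fun w => ex_derive g w).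

Definition entire (g : C -> C) : Prop := forall z : C, ex_derive g z.

Inductive sphere : Type :=
  | Fin (w : C)
  | Infty.

(* The two coordinates w and 1/w of the Riemann sphere. Each is totalized by a
   meaningless value at the one point outside its domain: [coord_fin Infty],
   and [coord_inf (Fin 0)]. *)
Definition coord_fin (p : sphere) : C :=
  match p with Fin w => w | Infty => 0 end.

Definition coord_inf (p : sphere) : C :=
  match p with Fin w => / w | Infty => 0 end.

(* The coordinate used around [p], and its domain. *)
Definition coord (p : sphere) : sphere -> C :=
  match p with Fin _ => coord_fin | Infty => coord_inf end.

Definition coord_dom (p q : sphere) : Prop :=
  match p with Fin _ => q <> Infty | Infty => q <> Fin 0 end.

Definition sphere_holomorphic_at (f : C -> sphere) (z : C) : Prop :=
  locally z (fun w => coord_dom (f z) (f w)) /\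
  holomorphic_near (fun w => coord (f z) (f w)) z.

(* The constant map [Infty] is not a meromorphic function. *)
Definition meromorphic (f : C -> sphere) : Prop :=
  (forall z : C, sphere_holomorphic_at f z) /\ exists z : C, f z <> Infty.

(* In the coordinate around f(z), the difference of the values at w and z is
   (w - z)^d h(w), with h holomorphic and nonzero at z. *)
Definition has_local_degree (f : C -> sphere) (z : C) (d : nat) : Prop :=
  (1 <= d)%N /\
  exists h : C -> C,
    [/\ holomorphic_near h z, h z <> 0 &
        locally z (fun w =>
          coord (f z) (f w) - coord (f z) (f z) = (w - z) ^ d * h w)].

Definition critical_point (f : C -> sphere) (z : C) : Prop :=
  exists2 d : nat, (2 <= d)%N & has_local_degree f z d.

Definition simple_critical_point (f : C -> sphere) (z : C) : Prop :=
  has_local_degree f z 2.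

Definition simple_critical_points_at (k : nat) (f : C -> sphere)
    (c : 'I_k -> C) : Prop :=
  (forall z : C, critical_point f z <-> exists i : 'I_k, z = c i) /\
  (forall i : 'I_k, simple_critical_point f (c i)).

Definition schwarzian_formula (F : C -> C) (z : C) : C :=
  let F1 := C_derive F in
  let F2 := C_derive F1 in
  let F3 := C_derive F2 in
  F3 z / F1 z - 3 / 2 * (F2 z / F1 z) ^ 2.

(* s = S_f(z), for [z] not a critical point of [f]; at a (simple) pole the
   formula is extended by continuity. *)
Definition is_schwarzian_at (f : C -> sphere) (z s : C) : Prop :=
  let F := fun w => coord_fin (f w) in
  match f z with
  | Fin _ => schwarzian_formula F z = s
  | Infty => filterlim (schwarzian_formula F) (locally' z) (locally s)
  end.

(* psi = S_f as meromorphic functions: S_f is holomorphic off the critical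
   points of [f] and has poles there, so values of the total function [psi] at
   the critical points are irrelevant. *)
Definition is_schwarzian (f : C -> sphere) (psi : C -> C) : Prop :=
  forall z : C, ~ critical_point f z -> is_schwarzian_at f z (psi z).

Definition e_fun (k : nat) (c : 'I_k -> C) (i : 'I_k) (z : C) : C :=
  \big[Cmult/RtoC 1]_(j < k | j != i) ((z - c j) / (c i - c j)).

Definition v_coef (k : nat) (c r : 'I_k -> C) (i : 'I_k) : C :=
  \big[Cplus/RtoC 0]_(j < k | j != i)
    (- (3 / 2) * (1 / (c i - c j) ^ 2) + r j / (c i - c j)).

Definition psi_fun (k : nat) (c r : 'I_k -> C) (G : C -> C) (z : C) : C :=
  \big[Cplus/RtoC 0]_(i < k)
    (- (3 / 2) * (1 / (z - c i) ^ 2) + r i / (z - c i)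
     + (- (1 / 2) * (r i) ^ 2 - v_coef c r i) * e_fun c i z)
  + G z * \big[Cmult/RtoC 1]_(i < k) (z - c i).

(* Main.v *)
Require Import Defs.
From HB Require Import structures.
From Stdlib Require Import Reals Lra Lia Classical ClassicalEpsilon FunctionalExtensionality.
From Coquelicot Require Import Coquelicot.
From mathcomp Require Import all_boot.

(** The idea is to trade psi = S_f for a linear system without singularities.
    If L = f''/f', then S_f = L' - L^2/2.  At a simple critical point c the
    map f is c0 + (z-c)^2 h(z) in a coordinate of the sphere, so that
    L = 1/(z-c) + m(z) with m holomorphic, and expanding L' - L^2/2 gives
      -3/2/(z-c)^2 + r/(z-c) - r^2/2 + O(z-c),   r = - m(c)
    ([log_normal]).  The formula for psi is exactly this list of local conditions:
    the poles are prescribed, and the terms in e_i correct the value of the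
    finite part at c_i to -r_i^2/2.  A function with these expansions differs
    from the explicit sum by an entire function vanishing at all the c_i, hence
    by G times the product of the z - c_i ([schwarzian_normal_form]).

    For the converse half it remains to see that S_f is holomorphic off the
    c_i, even at the poles of f: there 1/f has the same Schwarzian
    ([schwarzian_inv]) and is a holomorphic coordinate with nonzero derivative.
    That the derivative is nonzero off the c_i uses that f is nowhere locally
    constant, and this holds because f has a critical point at all (the
    identity principle, [sphere_map_not_locally_constant]).

    For the direct half, let P be the product of the z - c_i, let a be an entire
    function and let L = P'/P - 2a.  If a(c_i) is chosen suitably, L has at c_i
    the form 1/(z-c_i) + m with m(c_i) = -r_i, so L' - L^2/2 has the form
    required of psi, with the given r_i and some G1.  Put b = (G - G1)/2 and
    take two independent solutions (u1,w1), (u2,w2) of the entire system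
      u' = a u + P w,    w' = - b u - a w.
    The trace is zero, so w1 u2 - u1 w2 is constant, and (u1/u2)' = P/u2^2: the
    critical points of f = u1/u2 are the zeros of P, poles included.  A direct
    computation gives S_f = L' - L^2/2 + 2 P b = psi ([schwarzian_realized]).
    That y'' + psi y/2 = 0 has no logarithms at its singular points c_i enters
    only through b being entire.

    Complex differentiability is assumed pointwise only, so the function theory
    is built from Goursat's bisection argument ([goursat]).  Contracting a circle
    to a point gives Cauchy's formula and a Taylor expansion with an explicit
    remainder ([cauchy_expands]).  From it come: derivatives of holomorphic
    functions are holomorphic ([holo_C_derive]), difference quotients extend
    holomorphically ([holo_factor]), and entire functions are everywhere
    convergent power series, which yields entire solutions of linear systems
    with entire coefficients ([entire_linear_system]). *)

Set Implicit Arguments. Unset Strict Implicit. Unset Printing Implicit Defensive.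
(* %R denotes the scope of real numbers below, not ring_scope. *)
#[local] Set Warnings "-overwriting-delimiting-key".
Delimit Scope R_scope with R.
Local Open Scope R_scope.
Local Open Scope C_scope.

(** * Complex differentiation and estimates by the modulus *)

HB.instance Definition _ := Monoid.isComLaw.Build C (RtoC 0) Cplus
  Cplus_assoc Cplus_comm Cplus_0_l.
HB.instance Definition _ := Monoid.isComLaw.Build C (RtoC 1) Cmult
  Cmult_assoc Cmult_comm Cmult_1_l.
HB.instance Definition _ := Monoid.isMulLaw.Build C (RtoC 0) Cmult
  Cmult_0_l Cmult_0_r.
HB.instance Definition _ := Monoid.isAddLaw.Build C Cmult Cplus
  Cmult_plus_distr_r Cmult_plus_distr_l.

Lemma locally_imp2 (T : UniformSpace) (x : T) (P Q S : T -> Prop) :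
  (forall w, P w -> Q w -> S w) -> locally x P -> locally x Q -> locally x S.
Proof.
move=> H HP HQ; apply: filter_imp (filter_and _ _ HP HQ) => w [].
exact: H.
Qed.

Lemma locally_imp (z : C) (P Q : C -> Prop) :
  (forall w, P w -> Q w) -> locally z P -> locally z Q.
Proof. exact: filter_imp. Qed.

(** The neighbourhoods of C are those of the product R * R; every estimate
    below is in terms of the modulus. *)
Lemma locally_Cmod (z : C) (P : C -> Prop) :
  locally z P <->
  exists2 d : R, (0 < d)%R & forall w, (Cmod (w - z) < d)%R -> P w.
Proof.
split.
  move=> /(@locally_norm_le_locally _ C_R_NormedModule z P) [d Hd].
  exists d; first exact: cond_pos.
  move=> w Hw; apply: Hd; rewrite /ball_norm -Cmod_norm; exact: Hw.
move=> [d d0 Hd].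
apply: (@locally_le_locally_norm _ C_R_NormedModule).
exists (mkposreal d d0) => w; rewrite /ball_norm -Cmod_norm; exact: Hd.
Qed.

Lemma is_derive_Cmod (f : C -> C) (z l : C) :
  is_derive f z l <->
  forall e : R, (0 < e)%R ->
    locally z (fun w => Cmod (f w - f z - l * (w - z)) <= e * Cmod (w - z))%R.
Proof.
split.
  move=> [_ H] e e0.
  have := H z (fun P h => h) (mkposreal e e0).
  move/locally_C; apply: locally_imp => w /=; rewrite /norm /= /scal /= /minus /plus /opp /mult /=.
  by rewrite (Cmult_comm l).
move=> H; split.
  exact: is_linear_scal_l.
move=> x /(@is_filter_lim_locally_unique C_AbsRing (AbsRing_NormedModule C_AbsRing)) <- e.
apply/locally_C; apply: locally_imp (H e (cond_pos e)) => w /=.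
by rewrite /norm /= /scal /= /minus /plus /opp /mult /= (Cmult_comm l).
Qed.

Lemma rderive_Cmod (f : R -> C) (t : R) (l : C) :
  is_derive (K := R_AbsRing) (V := C_R_NormedModule) f t l <->
  forall e : R, (0 < e)%R ->
    locally t (fun s => Cmod (f s - f t - l * RtoC (s - t)) <= e * Rabs (s - t))%R.
Proof.
have E s : scal (s - t)%R (l : C_R_NormedModule) = l * RtoC (s - t).
  by rewrite /scal /= /prod_scal /scal /= /mult /=; case: l => a b;
     apply: injective_projections => /=; ring.
split.
  move=> [_ H] e e0.
  have := H t (fun P h => h) (mkposreal e e0).
  apply: filter_imp => s /=; rewrite /minus -!Cmod_norm.
  by rewrite -E.
move=> H; split; first exact: is_linear_scal_l.
move=> x /is_filter_lim_locally_unique <- e.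
apply: filter_imp (H e (cond_pos e)) => s /=.
by rewrite -E /minus -!Cmod_norm.
Qed.

Lemma derive_continuous (f : C -> C) (z l : C) :
  is_derive f z l -> continuous f z.
Proof.
move=> H P /locally_Cmod [d d0 Hd].
have /is_derive_Cmod/(_ 1%R Rlt_0_1) H1 := H.
have K0 : (0 < 1 + Cmod l)%R by have := Cmod_ge_0 l; lra.
apply/locally_Cmod.
case/locally_Cmod: H1 => d1 d10 Hd1.
exists (Rmin d1 (d / (1 + Cmod l))).
  by apply: Rmin_pos => //; apply: Rdiv_lt_0_compat.
move=> w Hw; apply: Hd.
have /Hd1 H2 := Rlt_le_trans _ _ _ Hw (Rmin_l _ _).
have H3 := Rlt_le_trans _ _ _ Hw (Rmin_r _ _).
have -> : f w - f z = (f w - f z - l * (w - z)) + l * (w - z) by ring.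
apply: Rle_lt_trans (Cmod_triangle _ _) _; rewrite Cmod_mult.
apply: (@Rle_lt_trans _ ((1 + Cmod l) * Cmod (w - z))); first lra.
have -> : d = ((1 + Cmod l) * (d / (1 + Cmod l)))%R by field; lra.
exact: Rmult_lt_compat_l.
Qed.

(** C is a normed module over itself in two non-convertible ways. The general
    product and chain rules are stated for one, the derivatives of the theorem
    for the other. *)
Lemma derive_AbsRing (f : C -> C) (z l : C) :
  @is_derive C_AbsRing (AbsRing_NormedModule C_AbsRing) f z l <-> is_derive f z l.
Proof.
by split=> -[_ H]; split=> //; exact: is_linear_scal_l.
Qed.

Lemma derive_const (a z : C) : is_derive (fun _ : C => a) z (RtoC 0).
Proof. exact: (@is_derive_const C_AbsRing C_NormedModule). Qed.

Lemma derive_id (z : C) : is_derive (fun w : C => w) z (RtoC 1).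
Proof. exact/derive_AbsRing/(@is_derive_id C_AbsRing). Qed.

Lemma derive_plus (f g : C -> C) (z a b : C) :
  is_derive f z a -> is_derive g z b -> is_derive (fun w => f w + g w) z (a + b).
Proof. exact: (@is_derive_plus C_AbsRing C_NormedModule). Qed.

Lemma derive_opp (f : C -> C) (z a : C) :
  is_derive f z a -> is_derive (fun w => - f w) z (- a).
Proof. exact: (@is_derive_opp C_AbsRing C_NormedModule). Qed.

Lemma derive_minus (f g : C -> C) (z a b : C) :
  is_derive f z a -> is_derive g z b -> is_derive (fun w => f w - g w) z (a - b).
Proof. exact: (@is_derive_minus C_AbsRing C_NormedModule). Qed.

Lemma derive_mult (f g : C -> C) (z a b : C) :
  is_derive f z a -> is_derive g z b ->
  is_derive (fun w => f w * g w) z (a * g z + f z * b).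
Proof.
move=> /derive_AbsRing Hf /derive_AbsRing Hg; apply/derive_AbsRing.
exact: (@is_derive_mult C_AbsRing f g z a b Hf Hg Cmult_comm).
Qed.

Lemma derive_comp (f g : C -> C) (z a b : C) :
  is_derive f (g z) a -> is_derive g z b ->
  is_derive (fun w => f (g w)) z (b * a).
Proof.
move=> Hf /derive_AbsRing Hg.
exact: (@is_derive_comp C_AbsRing C_NormedModule f g z a b Hf Hg).
Qed.

Lemma derive_ext_loc (f g : C -> C) (z a : C) :
  locally z (fun w => f w = g w) -> is_derive f z a -> is_derive g z a.
Proof.
by move=> /locally_C H; apply: (@is_derive_ext_loc C_AbsRing C_NormedModule).
Qed.

Lemma Cmod_sub_ge (z w : C) : (Cmod z - Cmod w <= Cmod (z - w))%R.
Proof.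
have := Cmod_triangle (z - w) w.
have -> : z - w + w = z by ring.
lra.
Qed.

Lemma Cmod_sub_sym (z w : C) : Cmod (z - w) = Cmod (w - z).
Proof. by rewrite -Cmod_opp; congr Cmod; ring. Qed.

(** The error is exactly (w - z)^2 / (z^2 w), and |w| >= |z|/2 near z. *)
Lemma Cinv_derive (z : C) :
  z <> 0 -> is_derive Cinv z (- (/ z * / z)).
Proof.
move=> z0; apply/is_derive_Cmod => e e0; apply/locally_Cmod.
have m0 : (0 < Cmod z)%R by apply/Cmod_gt_0.
have m2 : (0 < Cmod z * Cmod z * Cmod z)%R by do 2 apply: Rmult_lt_0_compat => //.
exists (Rmin (Cmod z / 2) (e * (Cmod z * Cmod z * Cmod z) / 2)).
  by apply: Rmin_pos; [lra | apply: Rdiv_lt_0_compat; [apply: Rmult_lt_0_compat | lra]].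
move=> w Hw.
have H1 := Rlt_le_trans _ _ _ Hw (Rmin_l _ _).
have H2 := Rlt_le_trans _ _ _ Hw (Rmin_r _ _).
have Hm : (Cmod z / 2 < Cmod w)%R.
  by have := Cmod_sub_ge z w; rewrite Cmod_sub_sym; lra.
have w0 : w <> 0 by apply/Cmod_gt_0; lra.
have -> : / w - / z - - (/ z * / z) * (w - z) = (w - z) * (w - z) * (/ z * / z * / w).
  by field.
rewrite !Cmod_mult !Cmod_inv //.
have hw : (/ Cmod w <= 2 / Cmod z)%R.
  have -> : (2 / Cmod z = / (Cmod z / 2))%R by field; lra.
  apply: Rinv_le_contravar; lra.
rewrite Rmult_assoc Rmult_comm; apply: Rmult_le_compat_r; first exact: Cmod_ge_0.
apply: (@Rle_trans _ (Cmod (w - z) * (/ Cmod z * / Cmod z * (2 / Cmod z)))).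
  apply: Rmult_le_compat_l; first exact: Cmod_ge_0.
  apply: Rmult_le_compat_l => //.
  by apply: Rmult_le_pos; apply: Rlt_le; apply: Rinv_0_lt_compat.
apply: (@Rle_trans _ (e * (Cmod z * Cmod z * Cmod z) / 2 * (/ Cmod z * / Cmod z * (2 / Cmod z)))).
  apply: Rmult_le_compat_r; last lra.
  apply: Rmult_le_pos; last by apply: Rlt_le; apply: Rdiv_lt_0_compat; lra.
  by apply: Rmult_le_pos; apply: Rlt_le; apply: Rinv_0_lt_compat.
by apply: Req_le; field; lra.
Qed.

Lemma derive_inv (f : C -> C) (z a : C) :
  f z <> 0 -> is_derive f z a -> is_derive (fun w => / f w) z (- a / (f z * f z)).
Proof.
move=> f0 Hf.
have -> : - a / (f z * f z) = a * (- (/ f z * / f z)) by field.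
by apply: derive_comp => //; apply: Cinv_derive.
Qed.

Lemma derive_div (f g : C -> C) (z a b : C) :
  g z <> 0 -> is_derive f z a -> is_derive g z b ->
  is_derive (fun w => f w / g w) z ((a * g z - f z * b) / (g z * g z)).
Proof.
move=> g0 Hf Hg.
have -> : (a * g z - f z * b) / (g z * g z) = a * / g z + f z * (- b / (g z * g z)).
  by field.
by apply: derive_mult => //; apply: derive_inv.
Qed.

Lemma derive_unique (f : C -> C) (z a b : C) :
  is_derive f z a -> is_derive f z b -> a = b.
Proof. by move=> /is_C_derive_unique <- /is_C_derive_unique. Qed.

Lemma derive_C_derive (f : C -> C) (z : C) :
  ex_derive f z -> is_derive f z (C_derive f z).
Proof. exact: (@C_derive_correct f z 0). Qed.

Lemma C_derive_ext_loc (f g : C -> C) (z a : C) :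
  locally z (fun w => f w = g w) -> is_derive g z a -> C_derive f z = a.
Proof.
move=> H Hg; apply: is_C_derive_unique; apply: derive_ext_loc Hg.
by apply: locally_imp H => w ->.
Qed.

Lemma is_derive_eq (f : C -> C) (z a b : C) :
  is_derive f z a -> a = b -> is_derive f z b.
Proof. by move=> H <-. Qed.

(** Mixes the two kinds of derivative: f is differentiated over C, the path g
    over R. *)
Lemma rderive_comp (f : C -> C) (g : R -> C) (t : R) (a b : C) :
  is_derive f (g t) a ->
  is_derive (K := R_AbsRing) (V := C_R_NormedModule) g t b ->
  is_derive (K := R_AbsRing) (V := C_R_NormedModule) (fun s => f (g s)) t (a * b).
Proof.
move=> Hf Hg; apply/rderive_Cmod => e e0.
have gc : continuous (U := C_UniformSpace) g t.
  by apply: (@ex_derive_continuous _ C_R_NormedModule); exists b.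
have B0 := Cmod_ge_0 b; have A0 := Cmod_ge_0 a.
have e1 : (0 < e / (2 * (1 + Cmod b)))%R by apply: Rdiv_lt_0_compat; lra.
have e2 : (0 < Rmin 1 (e / (2 * (1 + Cmod a))))%R.
  by apply: Rmin_pos; [lra | apply: Rdiv_lt_0_compat; lra].
move/is_derive_Cmod: Hf => /(_ _ e1) H1'.
have H1 := gc _ H1'.
move/rderive_Cmod: Hg => /(_ _ e2) H2.
rewrite /filtermap in H1; apply: locally_imp2 H1 H2 => s /= H1 H2.
have -> : f (g s) - f (g t) - a * b * RtoC (s - t) =
  (f (g s) - f (g t) - a * (g s - g t)) + a * (g s - g t - b * RtoC (s - t)) by ring.
apply: Rle_trans (Cmod_triangle _ _) _; rewrite Cmod_mult.
have r0 := Rabs_pos (s - t).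
have H3 : (Cmod (g s - g t) <= (1 + Cmod b) * Rabs (s - t))%R.
  have -> : g s - g t = (g s - g t - b * RtoC (s - t)) + b * RtoC (s - t) by ring.
  apply: Rle_trans (Cmod_triangle _ _) _; rewrite Cmod_mult Cmod_R.
  have := Rmult_le_compat_r _ _ _ r0 (Rmin_l 1 (e / (2 * (1 + Cmod a)))); lra.
have H4 : (Cmod (f (g s) - f (g t) - a * (g s - g t)) <= e / 2 * Rabs (s - t))%R.
  apply: Rle_trans H1 _.
  apply: (@Rle_trans _ (e / (2 * (1 + Cmod b)) * ((1 + Cmod b) * Rabs (s - t)))).
    by apply: Rmult_le_compat_l => //; lra.
  by apply: Req_le; field; lra.
have H5 : (Cmod a * Cmod (g s - g t - b * RtoC (s - t)) <= e / 2 * Rabs (s - t))%R.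
  apply: (@Rle_trans _ ((1 + Cmod a) * (e / (2 * (1 + Cmod a)) * Rabs (s - t)))).
    apply: Rmult_le_compat => //; try exact: Cmod_ge_0; try lra.
    apply: Rle_trans H2 _; apply: Rmult_le_compat_r => //; exact: Rmin_r.
  by apply: Req_le; field; lra.
lra.
Qed.

(** * Complex-valued functions of a real variable *)

Notation rder := (is_derive (K := R_AbsRing) (V := C_R_NormedModule)).

Lemma rder_ext (f g : R -> C) (t : R) (a b : C) :
  (forall s, f s = g s) -> a = b -> rder f t a -> rder g t b.
Proof. by move=> H <-; apply: is_derive_ext. Qed.

Lemma rder_plus (f g : R -> C) (t : R) (a b : C) :
  rder f t a -> rder g t b -> rder (fun s => f s + g s) t (a + b).
Proof. exact: (@is_derive_plus _ C_R_NormedModule). Qed.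

Lemma rder_const (a : C) (t : R) : rder (fun _ => a) t (RtoC 0).
Proof. exact: (@is_derive_const _ C_R_NormedModule). Qed.

Lemma rder_scal (f : R -> C) (t : R) (k a : C) :
  rder f t a -> rder (fun s => k * f s) t (k * a).
Proof.
move=> H; apply: (rderive_comp (f := fun z => k * z)) => //.
apply: is_derive_eq (derive_mult (derive_const k _) (derive_id _)) _; ring.
Qed.

(** Polarization, f g = ((f+g)^2 - (f-g)^2) / 4, reduces the product to the
    square of one path, which is a case of the chain rule. *)
Lemma rder_mult (f g : R -> C) (t : R) (a b : C) :
  rder f t a -> rder g t b -> rder (fun s => f s * g s) t (a * g t + f t * b).
Proof.
move=> Hf Hg.
have sq h c : rder h t c -> rder (fun s => h s * h s) t (2 * h t * c).
  move=> H; apply: (rderive_comp (f := fun z => z * z)) => //.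
  apply: is_derive_eq (derive_mult (derive_id _) (derive_id _)) _; ring.
have H1 := sq _ _ (rder_plus Hf Hg).
have H2 := sq _ _ (rder_plus Hf (rder_scal (RtoC (-1)) Hg)).
have H3 := rder_scal (RtoC (/4)) (rder_plus H1 (rder_scal (RtoC (-1)) H2)).
have n4 : RtoC 4 <> 0 by move=> /RtoC_inj; lra.
have H4 : RtoC (/4) = / RtoC 4 by rewrite RtoC_inv.
apply: rder_ext H3 => [s|]; rewrite H4; field => //.
Qed.

Lemma rder_pair (x y : R -> R) (t a b : R) :
  is_derive x t a -> is_derive y t b -> rder (fun s => (x s, y s)) t (a, b).
Proof.
move=> [_ Hx] [_ Hy]; apply/rderive_Cmod => e e0.
have e2 : (0 < e / 2)%R by lra.
have h1 := Hx t (fun P h => h) (mkposreal _ e2).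
have h2 := Hy t (fun P h => h) (mkposreal _ e2).
apply: locally_imp2 h1 h2 => s /=.
rewrite /norm /= /abs /= /scal /= /mult /= /minus /plus /opp /= => h1 h2.
have -> : (x s, y s) - (x t, y t) - (a, b) * RtoC (s - t) =
  RtoC (x s + - x t + - ((s + - t) * a)) + Ci * RtoC (y s + - y t + - ((s + - t) * b)).
  apply: injective_projections => /=; ring.
apply: Rle_trans (Cmod_triangle _ _) _; rewrite Cmod_mult Cmod_Ci !Cmod_R.
rewrite /Rminus; lra.
Qed.

Lemma rder_continuous (f : R -> C) (t : R) (a : C) :
  rder f t a -> continuous (U := C_UniformSpace) f t.
Proof. by move=> H; apply: (@ex_derive_continuous _ C_R_NormedModule); exists a. Qed.

Definition cint (f : R -> C) (a b : R) : C :=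
  RInt (V := C_R_CompleteNormedModule) f a b.

Definition ccont (f : R -> C) (a b : R) : Prop :=
  forall t, a <= t <= b -> continuous (U := C_UniformSpace) f t.

Notation isint := (is_RInt (V := C_R_NormedModule)).

Lemma cint_correct (f : R -> C) (a b : R) :
  a <= b -> ccont f a b -> isint f a b (cint f a b).
Proof.
move=> ab H; apply: (@RInt_correct C_R_CompleteNormedModule).
apply: (@ex_RInt_continuous C_R_CompleteNormedModule) => t.
by rewrite Rmin_left // Rmax_right //; apply: H.
Qed.

Lemma cint_unique (f : R -> C) (a b : R) (l : C) : isint f a b l -> cint f a b = l.
Proof. exact: (@is_RInt_unique C_R_CompleteNormedModule). Qed.

Lemma isint_ftc (f g : R -> C) (a b : R) :
  a <= b -> (forall t, a <= t <= b -> rder f t (g t)) -> ccont g a b ->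
  isint g a b (f b - f a).
Proof.
move=> ab H1 H2; apply: (@is_RInt_derive C_R_CompleteNormedModule) => t;
  by rewrite Rmin_left // Rmax_right //; first [exact: H1 | exact: H2].
Qed.

Lemma isint_norm (f : R -> C) (a b M : R) (l : C) :
  a <= b -> (forall t, a <= t <= b -> Cmod (f t) <= M) -> isint f a b l ->
  Cmod l <= (b - a) * M.
Proof.
move=> ab H1 H2; rewrite Cmod_norm; apply: norm_RInt_le_const ab _ H2 => t /H1.
by rewrite Cmod_norm.
Qed.

Lemma isint_scal (f : R -> C) (a b : R) (k l : C) :
  isint f a b l -> isint (fun t => k * f t) a b (k * l).
Proof.
move=> H.
have H1 := is_RInt_fct_extend_fst _ _ _ _ H.
have H2 := is_RInt_fct_extend_snd _ _ _ _ H.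
apply: is_RInt_fct_extend_pair => /=.
  apply: (is_RInt_minus (V := R_NormedModule)); exact: (is_RInt_scal (V := R_NormedModule)).
apply: (is_RInt_plus (V := R_NormedModule)); exact: (is_RInt_scal (V := R_NormedModule)).
Qed.

Lemma isint_plus (f g : R -> C) (a b : R) (l m : C) :
  isint f a b l -> isint g a b m -> isint (fun t => f t + g t) a b (l + m).
Proof. exact: (@is_RInt_plus C_R_NormedModule). Qed.

Lemma isint_ext (f g : R -> C) (a b : R) (l : C) :
  a <= b -> (forall t, a <= t <= b -> f t = g t) -> isint f a b l -> isint g a b l.
Proof.
move=> ab H; apply: (@is_RInt_ext C_R_NormedModule) => t.
rewrite Rmin_left // Rmax_right // => h; apply: H; lra.
Qed.

Lemma isint_chasles (f : R -> C) (a b c : R) (l m : C) :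
  isint f a b l -> isint f b c m -> isint f a c (l + m).
Proof. exact: (@is_RInt_Chasles C_R_NormedModule). Qed.

(** * Additive functions of squares *)

Section Bisection.
Variable E : R -> R -> R -> C.
Hypothesis Eadd : forall x y h, 0 <= x -> 0 <= y -> 0 < h ->
  x + 2 * h <= 1 -> y + 2 * h <= 1 ->
  E x y (2 * h) = E x y h + E (x + h) y h + E x (y + h) h + E (x + h) (y + h) h.
Hypothesis Eloc : forall p q, 0 <= p <= 1 -> 0 <= q <= 1 -> forall e, 0 < e ->
  exists2 d, 0 < d & forall x y h, 0 <= x <= p -> p <= x + h <= 1 ->
    0 <= y <= q -> q <= y + h <= 1 -> 0 < h < d -> Cmod (E x y h) <= e * h ^ 2.

Let eta := Cmod (E 0 0 1).

Let bad x y h := eta * h ^ 2 <= Cmod (E x y h).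

Let inside x y h := 0 <= x /\ x + h <= 1 /\ 0 <= y /\ y + h <= 1.

Lemma bisection_step x y h : 0 < h -> inside x y h -> bad x y h ->
  exists p : R * R, [/\ inside p.1 p.2 (h / 2), bad p.1 p.2 (h / 2),
    x <= p.1, p.1 + h / 2 <= x + h & y <= p.2 /\ p.2 + h / 2 <= y + h].
Proof.
move=> h0 [i1 [i2 [i3 i4]]] b.
have h2 : h = (2 * (h / 2))%R by field.
(* Otherwise the four quarters would add up to less than eta h^2. *)
have Hs : bad x y (h / 2) \/ bad (x + h / 2) y (h / 2) \/ bad x (y + h / 2) (h / 2)
  \/ bad (x + h / 2) (y + h / 2) (h / 2).
  apply: NNPP => N.
  have n4 : forall u v, ~ bad u v (h / 2) -> Cmod (E u v (h / 2)) < eta * (h / 2) ^ 2.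
    by move=> u v; rewrite /bad => /Rnot_le_lt.
  have N1 : ~ bad x y (h / 2) by tauto.
  have N2 : ~ bad (x + h / 2) y (h / 2) by tauto.
  have N3 : ~ bad x (y + h / 2) (h / 2) by tauto.
  have N4 : ~ bad (x + h / 2) (y + h / 2) (h / 2) by tauto.
  have : eta * h ^ 2 <= Cmod (E x y (2 * (h / 2))) by rewrite -h2.
  rewrite Eadd; try lra.
  move: (n4 _ _ N1) (n4 _ _ N2) (n4 _ _ N3) (n4 _ _ N4).
  set A := E x y _; set B := E (_ + _) y _; set C1 := E x _ _; set D := E _ _ _.
  have := Cmod_triangle (A + B + C1) D.
  have := Cmod_triangle (A + B) C1.
  have := Cmod_triangle A B.
  have e4 : (eta * h ^ 2 = 4 * (eta * (h / 2) ^ 2))%R by field.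
  rewrite e4; lra.
case: Hs => [|[|[|]]] Hb.
- exists (x, y); rewrite /inside; split=> //=; lra.
- exists ((x + h / 2)%R, y); rewrite /inside; split=> //=; lra.
- exists (x, (y + h / 2)%R); rewrite /inside; split=> //=; lra.
- exists ((x + h / 2)%R, (y + h / 2)%R); rewrite /inside; split=> //=; lra.
Qed.

Lemma nested_point (X : nat -> R) (h : nat -> R) :
  (forall n, 0 < h n) ->
  (forall n, X n <= X (S n)) -> (forall n, X (S n) + h (S n) <= X n + h n) ->
  exists p, forall n, X n <= p <= X n + h n.
Proof.
move=> h0 H1 H2.
have m1 n k : X n <= X (n + k)%coq_nat.
  elim: k => [|k IH]; first by rewrite -plus_n_O; lra.
  by rewrite -plus_n_Sm; have := H1 (n + k)%coq_nat; lra.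
have m2 n k : X (n + k)%coq_nat + h (n + k)%coq_nat <= X n + h n.
  elim: k => [|k IH]; first by rewrite -plus_n_O; lra.
  by rewrite -plus_n_Sm; have := H2 (n + k)%coq_nat; lra.
have m3 n k : X n <= X k + h k.
  have := m1 n k; have := m2 k n; rewrite (Nat.add_comm k n).
  have := h0 (n + k)%coq_nat; lra.
have B1 : bound (fun x => exists n, x = X n).
  by exists (X 0%nat + h 0%nat)%R => x [n ->]; apply: m3.
have B2 : exists x, exists n, x = X n by exists (X 0%nat); exists 0%nat.
have [p [p1 p2]] := completeness _ B1 B2.
exists p => n; split; first by apply: p1; exists n.
by apply: p2 => x [k ->]; apply: m3.
Qed.

(** Goursat's argument without contours. If |E| >= eta h^2 on a square, then
    the same holds on one of its quarters; the nested squares obtained in this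
    way shrink to a point, where E is o(h^2). With E additive this forces eta
    = 0. *)
Lemma bisection : E 0 0 1 = 0.
Proof.
apply: Cmod_eq_0; apply: Rle_antisym; last exact: Cmod_ge_0.
apply: Rnot_lt_le => eta0.
pose st (n : nat) (p : R * R) := inside p.1 p.2 ((/2) ^ n) /\ bad p.1 p.2 ((/2) ^ n).
have pw n : 0 < (/2) ^ n by apply: pow_lt; lra.
have step (n : nat) (p : {p | st n p}) : exists p' : {p' | st (S n) p'},
   (sval p).1 <= (sval p').1 /\ (sval p').1 + (/2) ^ (S n) <= (sval p).1 + (/2)^n /\
   (sval p).2 <= (sval p').2 /\ (sval p').2 + (/2) ^ (S n) <= (sval p).2 + (/2)^n.
  case: p => -[x y] /= [i b].
  have [p' [a1 a2 a3 a4 [a5 a6]]] := bisection_step (pw n) i b.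
  have e2 : ((/2) ^ n / 2 = / 2 * (/2) ^ n)%R by field.
  rewrite e2 in a1 a2 a4 a6.
  by exists (exist _ p' (conj a1 a2)).
have i0 : st 0%nat (0, 0).
  by rewrite /st /inside /bad /eta /=; split; [lra | rewrite !Rmult_1_r; lra].
pose next n p := proj1_sig (constructive_indefinite_description _ (@step n p)).
pose sq := fix sq n : {p | st n p} :=
  match n with O => exist _ _ i0 | S m => next m (sq m) end.
have nx n := proj2_sig (constructive_indefinite_description _ (@step n (sq n))).
have [p Hp] : exists p, forall n, (sval (sq n)).1 <= p <= (sval (sq n)).1 + (/2)^n.
  by apply: nested_point => // n; case: (nx n) => [a1 [a2 [a3 a4]]].
have [q Hq] : exists q, forall n, (sval (sq n)).2 <= q <= (sval (sq n)).2 + (/2)^n.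
  by apply: nested_point => // n; case: (nx n) => [a1 [a2 [a3 a4]]].
have p01 : 0 <= p <= 1 by have := Hp 0%nat => /=; lra.
have q01 : 0 <= q <= 1 by have := Hq 0%nat => /=; lra.
have e0 : 0 < eta / 2 by rewrite /eta; lra.
have [d d0 Hd] := Eloc p01 q01 e0.
have [N HN] := pow_lt_1_zero (/2) ltac:(rewrite Rabs_pos_eq; lra) d d0.
have {}HN := HN N (Nat.le_refl _).
rewrite Rabs_pos_eq in HN; last by have := pw N; lra.
case: (proj2_sig (sq N)) => [[i1 [i2 [i3 i4]]] b].
have := Hd (sval (sq N)).1 (sval (sq N)).2 ((/2)^N)%R.
have := Hp N; have := Hq N; have p2 := pw N; move=> hq hp.
move/(_ (conj i1 hp.1) (conj hp.2 i2) (conj i3 hq.1) (conj hq.2 i4) (conj p2 HN)).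
move: b; rewrite /bad.
have : 0 < eta * ((/2)^N)^2.
  by apply: Rmult_lt_0_compat; [rewrite /eta; lra | apply: pow_lt].
lra.
Qed.
End Bisection.

(** * Goursat's theorem *)

Lemma cint_chasles (f : R -> C) (a b c : R) :
  a <= b -> b <= c -> ccont f a c -> cint f a c = cint f a b + cint f b c.
Proof.
move=> ab bc H; apply: cint_unique; apply: isint_chasles; apply: cint_correct => // t ht;
apply: H; lra.
Qed.

Lemma path_lipschitz (f g : R -> C) (a b L : R) :
  a <= b -> (forall t, a <= t <= b -> rder f t (g t)) -> ccont g a b ->
  (forall t, a <= t <= b -> Cmod (g t) <= L) ->
  Cmod (f b - f a) <= (b - a) * L.
Proof.
by move=> ab H1 H2 H3; apply: (isint_norm ab H3); apply: (@isint_ftc f g).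
Qed.

Lemma path_lipschitz_abs (f g : R -> C) (a b L : R) :
  (forall t, Rmin a b <= t <= Rmax a b -> rder f t (g t)) ->
  (forall t, Rmin a b <= t <= Rmax a b -> exists l, rder g t l) ->
  (forall t, Rmin a b <= t <= Rmax a b -> Cmod (g t) <= L) ->
  Cmod (f b - f a) <= Rabs (b - a) * L.
Proof.
wlog ab : a b / a <= b => [H|].
  case: (Rle_dec a b) => ab; first exact: H.
  rewrite Cmod_sub_sym Rabs_minus_sym Rmin_comm Rmax_comm; apply: H; lra.
rewrite Rmin_left // Rmax_right // Rabs_pos_eq; last lra.
move=> hf hg; apply: path_lipschitz => // t ht.
have [l hl] := hg t ht; exact: rder_continuous hl.
Qed.

(** The affine approximation of q at z0 has the primitive G and so contributes
    a difference of end values, which will cancel around a closed contour.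
    Only the error K of the approximation is left. *)
Lemma path_approx (q : C -> C) (f g : R -> C) (a b K L : R) (z0 q0 q1 : C) :
  a <= b -> (forall t, a <= t <= b -> rder f t (g t)) ->
  (forall t, a <= t <= b -> exists l, rder g t l) ->
  (forall t, a <= t <= b -> ex_derive q (f t)) ->
  (forall t, a <= t <= b -> Cmod (g t) <= L) ->
  (forall t, a <= t <= b -> Cmod (q (f t) - q0 - q1 * (f t - z0)) <= K) ->
  let G := fun z => q0 * z + q1 * (z - z0) * (z - z0) / 2 in
  ccont (fun t => q (f t) * g t) a b /\
  Cmod (cint (fun t => q (f t) * g t) a b - (G (f b) - G (f a))) <= (b - a) * (K * L).
Proof.
move=> ab hf hg hq hL hK G.
have two0 : RtoC 2 <> 0 by move=> /RtoC_inj; lra.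
have c1 : ccont (fun t => q (f t) * g t) a b.
  move=> t ht; have [l hl] := hg t ht; have [m hm] := hq t ht.
  exact: rder_continuous (rder_mult (rderive_comp hm (hf t ht)) hl).
have dG z : is_derive G z (q0 + q1 * (z - z0)).
  rewrite /G.
  have d1 : is_derive (fun w => w - z0) z (RtoC 1).
    by apply: is_derive_eq (derive_minus (derive_id _) (derive_const _ _)) _; ring.
  have d2 := derive_mult (derive_const q1 z) d1.
  have d3 := derive_mult d2 d1.
  have d4 := derive_mult d3 (derive_const (/ RtoC 2) z).
  have d5 := derive_mult (derive_const q0 z) (derive_id z).
  apply: is_derive_eq (derive_plus d5 d4) _; field => //.
have c2 : ccont (fun t => (q0 + q1 * (f t - z0)) * g t) a b.
  move=> t ht; have [l hl] := hg t ht.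
  apply: rder_continuous (rder_mult _ hl).
  apply: (rderive_comp (f := fun z => q0 + q1 * (z - z0)) _ (hf t ht)).
  exact: derive_plus (derive_const _ _) (derive_mult (derive_const _ _) (derive_minus (derive_id _) (derive_const _ _))).
split=> //.
have I1 := cint_correct ab c1.
have I2 : isint (fun t => (q0 + q1 * (f t - z0)) * g t) a b (G (f b) - G (f a)).
  by apply: (@isint_ftc (fun t => G (f t))) => // t ht; apply: rderive_comp; [apply: dG | apply: hf].
have I3 := isint_plus I1 (isint_scal (k := RtoC (-1)) I2).
have -> : cint (fun t => q (f t) * g t) a b - (G (f b) - G (f a)) =
  cint (fun t => q (f t) * g t) a b + RtoC (-1) * (G (f b) - G (f a)) by ring.
apply: isint_norm ab _ I3 => t ht.
have -> : q (f t) * g t + RtoC (-1) * ((q0 + q1 * (f t - z0)) * g t) =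
  (q (f t) - q0 - q1 * (f t - z0)) * g t by ring.
rewrite Cmod_mult; apply: Rmult_le_compat; auto; exact: Cmod_ge_0.
Qed.

Section Goursat.
Variables (q : C -> C) (P Ps Pt : R -> R -> C) (L : R).
Let I01 x := 0 <= x <= 1.
Hypothesis L0 : 0 < L.
Hypothesis Hs : forall x y, I01 x -> I01 y -> rder (fun s => P s y) x (Ps x y).
Hypothesis Ht : forall x y, I01 x -> I01 y -> rder (fun t => P x t) y (Pt x y).
Hypothesis Hs2 : forall x y, I01 x -> I01 y -> exists l, rder (fun s => Ps s y) x l.
Hypothesis Ht2 : forall x y, I01 x -> I01 y -> exists l, rder (fun t => Pt x t) y l.
Hypothesis Bs : forall x y, I01 x -> I01 y -> Cmod (Ps x y) <= L.
Hypothesis Bt : forall x y, I01 x -> I01 y -> Cmod (Pt x y) <= L.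
Hypothesis Hq : forall x y, I01 x -> I01 y -> ex_derive q (P x y).

Let hor y a b := cint (fun s => q (P s y) * Ps s y) a b.
Let ver x a b := cint (fun t => q (P x t) * Pt x t) a b.

Let E x y h := hor y x (x + h) + ver (x + h) y (y + h) - hor (y + h) x (x + h) - ver x y (y + h).

Lemma hor_split y a b c : I01 y -> 0 <= a -> a <= b -> b <= c -> c <= 1 ->
  hor y a c = hor y a b + hor y b c.
Proof.
move=> hy a0 ab bc c1; apply: cint_chasles => // s hs.
have hs' : I01 s by rewrite /I01; lra.
have [l hl] := Hs2 hs' hy; have [m hm] := Hq hs' hy.
exact: rder_continuous (rder_mult (rderive_comp hm (Hs hs' hy)) hl).
Qed.

Lemma ver_split x a b c : I01 x -> 0 <= a -> a <= b -> b <= c -> c <= 1 ->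
  ver x a c = ver x a b + ver x b c.
Proof.
move=> hx a0 ab bc c1; apply: cint_chasles => // t ht.
have ht' : I01 t by rewrite /I01; lra.
have [l hl] := Ht2 hx ht'; have [m hm] := Hq hx ht'.
exact: rder_continuous (rder_mult (rderive_comp hm (Ht hx ht')) hl).
Qed.

Lemma square_lipschitz x y p r h : I01 x -> I01 y -> I01 p -> I01 r ->
  Rabs (x - p) <= h -> Rabs (y - r) <= h -> Cmod (P x y - P p r) <= 2 * L * h.
Proof.
move=> hx hy hp hr xp yr.
have between u v s : I01 u -> I01 v -> Rmin u v <= s <= Rmax u v -> I01 s.
  by rewrite /I01 /Rmin /Rmax; case: Rle_dec; lra.
have H1 u v w : I01 u -> I01 v -> I01 w -> Cmod (P v w - P u w) <= Rabs (v - u) * L.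
  move=> hu hv hw; apply: (@path_lipschitz_abs (fun s => P s w) (fun s => Ps s w)) => s /between hs.
  - exact: Hs (hs hu hv) hw.
  - exact: Hs2 (hs hu hv) hw.
  - exact: Bs (hs hu hv) hw.
have H2 u v w : I01 u -> I01 v -> I01 w -> Cmod (P w v - P w u) <= Rabs (v - u) * L.
  move=> hu hv hw; apply: (@path_lipschitz_abs (fun s => P w s) (fun s => Pt w s)) => s /between hs.
  - exact: Ht hw (hs hu hv).
  - exact: Ht2 hw (hs hu hv).
  - exact: Bt hw (hs hu hv).
have -> : P x y - P p r = (P x y - P p y) + (P p y - P p r) by ring.
apply: Rle_trans (Cmod_triangle _ _) _.
have := H1 p x y hp hx hy; have := H2 r y p hr hy hp.
have : Rabs (x - p) * L <= h * L by apply: Rmult_le_compat_r; lra.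
have : Rabs (y - r) * L <= h * L by apply: Rmult_le_compat_r; lra.
lra.
Qed.

(** The integral of q dz around the image of a square of side h is o(h^2): the
    affine part of q contributes nothing, and its error is at most e |z - z0|
    = O(e h) on a contour of length O(h). The conclusion follows by
    [bisection]. Working with the image of a square under P, rather than with
    a square in the plane, is what allows a circle to be contracted. *)
Lemma goursat : hor 0 0 1 + ver 1 0 1 = hor 1 0 1 + ver 0 0 1.
Proof.
have : E 0 0 1 = 0.
  apply: bisection => [x y h x0 y0 h0 x1 y1|p r hp hr e e0].
    rewrite /E.
    have exx u : (u + 2 * h = u + h + h)%R by ring.
    rewrite !exx.
    rewrite (@hor_split y x (x + h) (x + h + h)); try (rewrite /I01; lra).
    rewrite (@hor_split (y + h + h) x (x + h) (x + h + h)); try (rewrite /I01; lra).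
    rewrite (@ver_split x y (y + h) (y + h + h)); try (rewrite /I01; lra).
    rewrite (@ver_split (x + h + h) y (y + h) (y + h + h)); try (rewrite /I01; lra).
    ring.
  have [q1 Hq1] := Hq hp hr.
  have LL : 0 < 8 * (L * L) by have := Rmult_lt_0_compat _ _ L0 L0; lra.
  have e1 : 0 < e / (8 * (L * L)) by apply: Rdiv_lt_0_compat.
  move/is_derive_Cmod: Hq1 => /(_ _ e1) /locally_Cmod [d d0 Hd].
  exists (d / (2 * L))%R; first by apply: Rdiv_lt_0_compat; lra.
  move=> x y h hx hxh hy hyh [h0 hd].
  have Lh : 2 * L * h < d.
    have -> : (d = 2 * L * (d / (2 * L)))%R by field; lra.
    by apply: Rmult_lt_compat_l; lra.
  have near u v : x <= u <= x + h -> y <= v <= y + h ->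
     [/\ I01 u, I01 v & Cmod (q (P u v) - q (P p r) - q1 * (P u v - P p r)) <=
       e / (8 * (L * L)) * (2 * L * h)].
    move=> hu hv.
    have iu : I01 u by rewrite /I01; lra.
    have iv : I01 v by rewrite /I01; lra.
    have lip : Cmod (P u v - P p r) <= 2 * L * h.
      by apply: square_lipschitz => //; apply: Rabs_le; lra.
    split=> //; apply: Rle_trans (Hd _ _) _; first lra.
    by apply: Rmult_le_compat_l => //; lra.
  pose K := (e / (8 * (L * L)) * (2 * L * h))%R.
  have horb v : y <= v <= y + h -> _ :=
    fun hv => proj2 (@path_approx q (fun s => P s v) (fun s => Ps s v) x (x + h) K L (P p r) (q (P p r)) q1
     ltac:(lra) (fun t ht => let: And3 a b _ := near _ _ ht hv in Hs a b)
     (fun t ht => let: And3 a b _ := near _ _ ht hv in Hs2 a b)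
     (fun t ht => let: And3 a b _ := near _ _ ht hv in Hq a b)
     (fun t ht => let: And3 a b _ := near _ _ ht hv in Bs a b)
     (fun t ht => let: And3 a b c := near _ _ ht hv in c)).
  have verb u : x <= u <= x + h -> _ :=
    fun hu => proj2 (@path_approx q (fun s => P u s) (fun s => Pt u s) y (y + h) K L (P p r) (q (P p r)) q1
     ltac:(lra) (fun t ht => let: And3 a b _ := near _ _ hu ht in Ht a b)
     (fun t ht => let: And3 a b _ := near _ _ hu ht in Ht2 a b)
     (fun t ht => let: And3 a b _ := near _ _ hu ht in Hq a b)
     (fun t ht => let: And3 a b _ := near _ _ hu ht in Bt a b)
     (fun t ht => let: And3 a b c := near _ _ hu ht in c)).
  have b1 := horb y ltac:(lra); have b2 := horb (y + h)%R ltac:(lra).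
  have b3 := verb x ltac:(lra); have b4 := verb (x + h)%R ltac:(lra).
  clear horb verb near.
  rewrite /= in b1 b2 b3 b4.
  move: b1 b2 b3 b4; rewrite -/(hor _ _ _) -/(hor _ _ _) -/(ver _ _ _) -/(ver _ _ _).
  set G := fun z : C => q (P p r) * z + q1 * (z - P p r) * (z - P p r) / 2.
  rewrite -!/(G _).
  set A1 := hor y _ _ - _; set A2 := hor _ _ _ - _; set A3 := ver x _ _ - _; set A4 := ver _ _ _ - _.
  move=> b1 b2 b3 b4.
  have -> : E x y h = A1 + A4 - A2 - A3.
    by rewrite /E /A1 /A2 /A3 /A4; ring.
  have := Cmod_triangle (A1 + A4 - A2) (- A3).
  have := Cmod_triangle (A1 + A4) (- A2).
  have := Cmod_triangle A1 A4.
  rewrite !Cmod_opp.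
  have eK : (4 * (h * (K * L)) = e * h ^ 2)%R by rewrite /K; field; lra.
  have ex : (x + h - x = h)%R by ring.
  have ey : (y + h - y = h)%R by ring.
  rewrite ex in b1 b2; rewrite ey in b3 b4.
  rewrite /Cminus; lra.
rewrite /E !Rplus_0_l => H.
have -> : hor 0 0 1 + ver 1 0 1 = (hor 0 0 1 + ver 1 0 1 - hor 1 0 1 - ver 0 0 1) + hor 1 0 1 + ver 0 0 1 by ring.
by rewrite H; ring.
Qed.
End Goursat.

(** * Cauchy's formula on a circle *)

Lemma geometric_squeeze (x K r : R) :
  0 <= r < 1 -> (forall N : nat, x <= K * r ^ N) -> x <= 0.
Proof.
move=> hr H; apply: Rnot_lt_le => x0.
have K0 : 0 < K by have := H 0%nat => /=; lra.
have [N HN] := pow_lt_1_zero r ltac:(rewrite Rabs_pos_eq; lra) (x / K)%R (Rdiv_lt_0_compat _ _ x0 K0).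
have {}HN := HN N (Nat.le_refl _).
rewrite Rabs_pos_eq in HN; last by apply: pow_le; lra.
have := Rmult_lt_compat_l _ _ _ K0 HN.
have -> : (K * (x / K) = x)%R by field; lra.
have := H N; lra.
Qed.

Lemma Cmod_ratio_lt1 (w : C) (r : R) : 0 < r -> Cmod w < r -> 0 <= Cmod w / r < 1.
Proof.
move=> r0 wr; split.
  by apply: Rmult_le_pos; [exact: Cmod_ge_0 | apply: Rlt_le; apply: Rinv_0_lt_compat].
by apply: (Rmult_lt_reg_r r) => //; rewrite /Rdiv Rmult_assoc Rinv_l; lra.
Qed.

Definition rdable (f : R -> C) (t : R) := exists l, rder f t l.

Lemma rdable_mult f g t : rdable f t -> rdable g t -> rdable (fun s => f s * g s) t.
Proof. by move=> [a Ha] [b Hb]; exists (a * g t + f t * b); apply: rder_mult. Qed.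

Lemma rdable_comp (f : C -> C) g t :
  ex_derive f (g t) -> rdable g t -> rdable (fun s => f (g s)) t.
Proof. by move=> [a Ha] [b Hb]; exists (a * b); apply: rderive_comp. Qed.

Lemma rdable_ccont f a b : (forall t, a <= t <= b -> rdable f t) -> ccont f a b.
Proof. by move=> H t /H [l]; apply: rder_continuous. Qed.

Lemma derive_pow (n : nat) (z : C) :
  is_derive (fun w : C => w ^ S n) z (RtoC (INR (S n)) * z ^ n).
Proof.
elim: n => [|n IH].
  apply: is_derive_eq (derive_mult (derive_id z) (derive_const 1 z)) _ => /=; ring.
apply: is_derive_eq (derive_mult (derive_id z) IH) _.
rewrite [INR n.+2]S_INR RtoC_plus /=; ring.
Qed.

Lemma ex_derive_pow (n : nat) (z : C) : ex_derive (fun w : C => w ^ n) z.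
Proof. by case: n => [|n]; eexists; [apply: (derive_const 1) | apply: derive_pow]. Qed.

Definition unit_circle (t : R) : C := (cos (2 * PI * t), sin (2 * PI * t)).

Lemma unit_circle_rder t : rder unit_circle t (RtoC (2 * PI) * Ci * unit_circle t).
Proof.
have -> : RtoC (2 * PI) * Ci * unit_circle t =
   ((2 * PI * - sin (2 * PI * t))%R, (2 * PI * cos (2 * PI * t))%R).
  by apply: injective_projections => /=; ring.
by apply: rder_pair; auto_derive => //; ring.
Qed.

Lemma unit_circle_mod t : Cmod (unit_circle t) = 1%R.
Proof.
rewrite /Cmod /unit_circle /= -[RHS]sqrt_1; congr sqrt.
have := sin2_cos2 (2 * PI * t); rewrite /Rsqr; lra.
Qed.

Lemma unit_circle_closed : unit_circle 0 = unit_circle 1.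
Proof. by rewrite /unit_circle Rmult_0_r Rmult_1_r cos_0 sin_0 cos_2PI sin_2PI. Qed.

Section Cauchy.
Variables (r r' : R) (w : C).
Hypotheses (r0 : 0 < r) (rr' : r < r') (wr : Cmod w < r).

Let g t : C := RtoC r * unit_circle t.
Let gap : 0 < r - Cmod w. Proof. lra. Qed.

Lemma circle_mod t : Cmod (g t) = r.
Proof. by rewrite /g Cmod_mult Cmod_R unit_circle_mod Rabs_pos_eq; lra. Qed.

Lemma circle_neq0 t : g t <> 0.
Proof. by apply/Cmod_gt_0; rewrite circle_mod. Qed.

Lemma circle_dist t : r - Cmod w <= Cmod (g t - w).
Proof. by have := Cmod_sub_ge (g t) w; rewrite circle_mod. Qed.

Lemma circle_avoids t : g t - w <> 0.
Proof. by apply/Cmod_gt_0; have := circle_dist t; lra. Qed.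

Lemma circle_rder t : rder g t (RtoC (2 * PI) * Ci * g t).
Proof.
apply: rder_ext (rder_scal (RtoC r) (unit_circle_rder t)) => //.
by rewrite /g; ring.
Qed.

Let k t := g t / (g t - w).

Lemma kernel_rdable t : rdable k t.
Proof.
apply: (rdable_comp (f := fun z => z / (z - w))); last by eexists; apply: circle_rder.
eexists; apply: (@derive_div (fun z => z) (fun z => z - w)); first exact: circle_avoids.
  exact: derive_id.
exact: (derive_minus (derive_id _) (derive_const _ _)).
Qed.

Lemma kernel_mod t : Cmod (k t) <= r / (r - Cmod w).
Proof.
rewrite /k Cmod_div; last exact: circle_avoids.
rewrite circle_mod; apply: Rmult_le_compat_l; first lra.
by apply: Rinv_le_contravar => //; apply: circle_dist.
Qed.

Section Formula.
Variable f : C -> C.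
Hypothesis Hf : forall z, Cmod z < r' -> ex_derive f z.

(** The map (s,t) -> w + (e + (1-e)s)(g t - w) contracts the circle towards w.
    For q = f z / (z - w), the sides t = 0 and t = 1 have the same image and
    cancel in [goursat], so the integrals over the sides s = 0 and s = 1
    agree. In these, dz / (z - w) is 2 i pi k(t) dt for both values of s. The
    contraction stops at ratio e > 0 because of the pole at w. *)
Lemma cauchy_homotopy e : 0 < e < 1 ->
  cint (fun t => f (g t) * k t) 0 1 = cint (fun t => f (w + RtoC e * (g t - w)) * k t) 0 1.
Proof.
move=> e01.
pose sc (s : R) : C := RtoC (e + (1 - e) * s).
pose P s t := w + sc s * (g t - w).
pose Ps (s t : R) := RtoC (1 - e) * (g t - w).
pose Pt s t := sc s * (RtoC (2 * PI) * Ci * g t).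
have PIp := PI_RGT_0.
have scd s : rder sc s (RtoC (1 - e)).
  apply: (@rder_pair (fun s => e + (1 - e) * s)%R (fun _ => 0)%R).
    by auto_derive => //; ring.
  by auto_derive.
have scm s : 0 <= s <= 1 -> e <= e + (1 - e) * s <= 1 by nra.
have Pd s t : rder (fun s => P s t) s (Ps s t).
  apply: rder_ext (rder_plus (rder_const w s) (rder_mult (scd s) (rder_const (g t - w) s))) => //.
  by rewrite /Ps; ring.
have gwd t : rder (fun t => g t - w) t (RtoC (2 * PI) * Ci * g t).
  by apply: rder_ext (rder_plus (circle_rder t) (rder_const (- w) t)) => //; ring.
have Pd2 s t : rder (fun t => P s t) t (Pt s t).
  apply: rder_ext (rder_plus (rder_const w t) (rder_scal (sc s) (gwd t))) => //.
  by rewrite /Pt; ring.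
have Psd s t : exists l, rder (fun s => Ps s t) s l by eexists; apply: rder_const.
have Ptd s t : exists l, rder (fun t => Pt s t) t l.
  by eexists; apply: rder_scal; apply: rder_scal; apply: circle_rder.
have Pw s t : 0 <= s <= 1 -> P s t - w <> 0.
  move=> hs; apply/Cmod_gt_0.
  have -> : P s t - w = sc s * (g t - w) by rewrite /P; ring.
  have := scm s hs; have := circle_dist t.
  rewrite Cmod_mult Cmod_R Rabs_pos_eq; last by have := scm s hs; lra.
  by move=> h1 h2; apply: Rmult_lt_0_compat; lra.
have Pm s t : 0 <= s <= 1 -> Cmod (P s t) < r'.
  move=> /scm hs.
  have -> : P s t = RtoC (1 - (e + (1 - e) * s)) * w + sc s * g t.
    by rewrite /P /sc RtoC_minus; ring.
  apply: Rle_lt_trans (Cmod_triangle _ _) _; rewrite (Cmod_mult _ w) (Cmod_mult _ (g t)) !Cmod_R circle_mod.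
  rewrite !Rabs_pos_eq; try lra; nra.
have L0 : 0 < 2 * r * (1 + PI) by apply: Rmult_lt_0_compat; lra.
pose q z := f z / (z - w).
have Hq s t : 0 <= s <= 1 -> 0 <= t <= 1 -> ex_derive q (P s t).
  move=> hs ht; have [a Ha] := Hf (Pm s t hs).
  eexists; apply: (@derive_div f (fun z => z - w)); [exact: Pw | exact: Ha |].
  exact: (derive_minus (derive_id _) (derive_const _ _)).
have B1 s t : 0 <= s <= 1 -> 0 <= t <= 1 -> Cmod (Ps s t) <= 2 * r * (1 + PI).
  move=> hs ht; rewrite /Ps Cmod_mult Cmod_R Rabs_pos_eq; last lra.
  have := Cmod_triangle (g t) (- w); rewrite Cmod_opp. rewrite circle_mod.
  rewrite -/(Cminus _ _); have := Cmod_ge_0 (g t - w).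
  have := Rmult_lt_0_compat _ _ r0 PIp; nra.
have B2 s t : 0 <= s <= 1 -> 0 <= t <= 1 -> Cmod (Pt s t) <= 2 * r * (1 + PI).
  move=> /scm hs ht; rewrite /Pt (Cmod_mult (sc s)) (Cmod_mult _ (g t)) (Cmod_mult _ Ci) Cmod_Ci !Cmod_R circle_mod !Rabs_pos_eq; try lra.
  have := Rmult_lt_0_compat _ _ r0 PIp; nra.
have := @goursat q P Ps Pt _ L0 (fun s t _ _ => Pd s t) (fun s t _ _ => Pd2 s t)
  (fun s t _ _ => Psd s t) (fun s t _ _ => Ptd s t) B1 B2 Hq.
have -> : cint (fun s => q (P s 0) * Ps s 0) 0 1 = cint (fun s => q (P s 1) * Ps s 1) 0 1.
  by rewrite /P /Ps /g unit_circle_closed.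
set A := cint _ 0 1; set B := cint _ 0 1; set D := cint _ 0 1 => H.
have {}H : B = D.
  have -> : B = (A + B) - A by ring.
  by rewrite H; ring.
have pi0 : RtoC (2 * PI) * Ci <> 0.
  apply/Cmod_gt_0; rewrite Cmod_mult Cmod_R Cmod_Ci Rabs_pos_eq; lra.
have key s h : 0 <= s <= 1 -> (forall t, h t = P s t) ->
  cint (fun t => q (P s t) * Pt s t) 0 1 =
  RtoC (2 * PI) * Ci * cint (fun t => f (h t) * k t) 0 1.
  move=> hs hh; apply: cint_unique.
  have sn0 : sc s <> 0.
    by apply/Cmod_gt_0; rewrite Cmod_R Rabs_pos_eq; have := scm s hs; lra.
  have := Rle_0_1 => le01.
  have I : isint (fun t => f (h t) * k t) 0 1 (cint (fun t => f (h t) * k t) 0 1).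
    apply: cint_correct => //; apply: rdable_ccont => t ht.
    apply: rdable_mult; last exact: kernel_rdable.
    have [a Ha] := Hf (Pm s t hs).
    exists (a * Pt s t); apply: rder_ext (rderive_comp Ha (Pd2 s t)) => // u.
    by rewrite hh.
  apply: isint_ext (isint_scal (k := RtoC (2 * PI) * Ci) I) => // t ht.
  rewrite hh /q /Pt /k.
  have -> : P s t - w = sc s * (g t - w) by rewrite /P; ring.
  by field; split=> //; apply: circle_avoids.
have b1 : B = RtoC (2 * PI) * Ci * cint (fun t => f (g t) * k t) 0 1.
  apply: key => [|t]; first lra.
  rewrite /P /sc.
  have -> : (e + (1 - e) * 1 = 1)%R by ring.
  ring.
have b2 : D = RtoC (2 * PI) * Ci * cint (fun t => f (w + RtoC e * (g t - w)) * k t) 0 1.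
  apply: key => [|t]; first lra.
  rewrite /P /sc.
  by have -> : (e + (1 - e) * 0 = e)%R by ring.
move: H; rewrite b1 b2 => H.
have cancel x : x = / (RtoC (2 * PI) * Ci) * (RtoC (2 * PI) * Ci * x).
  by rewrite Cmult_assoc Cinv_l // Cmult_1_l.
by rewrite (cancel (cint _ 0 1)) H -cancel.
Qed.

(** Letting e tend to 0 in [cauchy_homotopy], by continuity of f at w. *)
Lemma cauchy_circle :
  cint (fun t => f (g t) * k t) 0 1 = f w * cint k 0 1.
Proof.
have le01 := Rle_0_1.
set A := cint _ 0 1; set B := _ * _.
suff : Cmod (A - B) <= 0.
  move=> h; have h' : A - B = 0 by apply: Cmod_eq_0; have := Cmod_ge_0 (A - B); lra.
  have -> : A = (A - B) + B by ring.
  by rewrite h'; ring.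
apply: Rnot_lt_le => d0.
pose K := (r / (r - Cmod w))%R.
have K0 : 0 < K by apply: Rdiv_lt_0_compat.
have e0 : 0 < Cmod (A - B) / 2 / K by apply: Rdiv_lt_0_compat; lra.
have [a Ha] := Hf (Rlt_trans _ _ _ wr rr').
have fc := derive_continuous Ha.
have := fc (fun z => Cmod (z - f w) < Cmod (A - B) / 2 / K).
case/(_ _)/locally_Cmod.
  by apply/locally_Cmod; exists (Cmod (A - B) / 2 / K)%R.
move=> d dd Hd.
pose e := Rmin (/2) (d / (4 * r)).
have e01 : 0 < e < 1.
  split; first by apply: Rmin_pos; [lra | apply: Rdiv_lt_0_compat; lra].
  by apply: Rle_lt_trans (Rmin_l _ _) _; lra.
have ed : e * (2 * r) < d.
  apply: (@Rle_lt_trans _ (d / (4 * r) * (2 * r))).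
    by apply: Rmult_le_compat_r; [lra | exact: Rmin_r].
  have -> : (d / (4 * r) * (2 * r) = d / 2)%R by field; lra.
  lra.
have Ik : isint k 0 1 (cint k 0 1).
  by apply: cint_correct => //; apply: rdable_ccont => t ht; apply: kernel_rdable.
have nr t : Cmod (w + RtoC e * (g t - w) - w) < d.
  have -> : w + RtoC e * (g t - w) - w = RtoC e * (g t - w) by ring.
  rewrite Cmod_mult Cmod_R Rabs_pos_eq; last lra.
  apply: Rle_lt_trans ed; apply: Rmult_le_compat_l; first lra.
  have := Cmod_triangle (g t) (- w); rewrite Cmod_opp circle_mod -/(Cminus _ _); lra.
have Ie : isint (fun t => f (w + RtoC e * (g t - w)) * k t) 0 1 A.
  rewrite /A (cauchy_homotopy e01); apply: cint_correct => //; apply: rdable_ccont => t ht.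
  apply: rdable_mult; last exact: kernel_rdable.
  apply: rdable_comp.
    apply: Hf.
    have -> : w + RtoC e * (g t - w) = RtoC (1 - e) * w + RtoC e * g t by rewrite RtoC_minus; ring.
    apply: Rle_lt_trans (Cmod_triangle _ _) _; rewrite (Cmod_mult _ w) (Cmod_mult _ (g t)) !Cmod_R circle_mod.
    rewrite !Rabs_pos_eq; try lra; nra.
  eexists; apply: rder_plus (rder_const w t) (rder_scal _ _).
  exact: rder_plus (circle_rder t) (rder_const (- w) t).
have := isint_plus Ie (isint_scal (k := - f w) Ik).
have -> : A + - f w * cint k 0 1 = A - B by rewrite /B; ring.
move=> I.
have : Cmod (A - B) <= (1 - 0) * (Cmod (A - B) / 2 / K * K).
  apply: isint_norm le01 _ I => t ht.
  have -> : f (w + RtoC e * (g t - w)) * k t + - f w * k t =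
    (f (w + RtoC e * (g t - w)) - f w) * k t by ring.
  rewrite Cmod_mult; apply: Rmult_le_compat; try exact: Cmod_ge_0.
    by apply: Rlt_le; apply: Hd; apply: nr.
  exact: kernel_mod.
have -> : ((1 - 0) * (Cmod (A - B) / 2 / K * K) = Cmod (A - B) / 2)%R by field; lra.
lra.
Qed.

Definition circ_coef (n : nat) : C := cint (fun t => f (g t) * (/ g t) ^ n) 0 1.

Let rem (n : nat) : C := cint (fun t => f (g t) * (/ g t) ^ n * k t) 0 1.

Lemma circ_coef_rdable n t : rdable (fun t => f (g t) * (/ g t) ^ n) t.
Proof.
have dg : rdable g t by eexists; apply: circle_rder.
apply: rdable_mult.
  by apply: rdable_comp => //; apply: Hf; rewrite circle_mod.
apply: (rdable_comp (f := fun z => z ^ n)); first exact: ex_derive_pow.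
apply: (rdable_comp (f := Cinv)) => //.
by eexists; apply: Cinv_derive; apply: circle_neq0.
Qed.

Lemma circ_coef_correct n : isint (fun t => f (g t) * (/ g t) ^ n) 0 1 (circ_coef n).
Proof.
apply: cint_correct; first exact: Rle_0_1.
by apply: rdable_ccont => t _; apply: circ_coef_rdable.
Qed.

Lemma circ_rem_correct n : isint (fun t => f (g t) * (/ g t) ^ n * k t) 0 1 (rem n).
Proof.
apply: cint_correct; first exact: Rle_0_1.
by apply: rdable_ccont => t _; apply: rdable_mult; [apply: circ_coef_rdable | apply: kernel_rdable].
Qed.

Lemma circ_rem_step n : rem n = circ_coef n + w * rem (S n).
Proof.
apply: cint_unique.
apply: (isint_ext Rle_0_1 _ (isint_plus (@circ_coef_correct n) (isint_scal (k := w) (@circ_rem_correct (S n))))).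
move=> t _; rewrite /= /k; field.
by split; [apply: circle_avoids | apply: circle_neq0].
Qed.

Variable M : R.
Hypothesis HM : forall t, 0 <= t <= 1 -> Cmod (f (g t)) <= M.

Lemma circ_fmod n t : 0 <= t <= 1 -> Cmod (f (g t) * (/ g t) ^ n) <= M / r ^ n.
Proof.
move=> ht; rewrite Cmod_mult Cmod_pow Cmod_inv; last exact: circle_neq0.
rewrite circle_mod pow_inv.
apply: Rmult_le_compat_r; last exact: HM.
by apply: Rlt_le; apply: Rinv_0_lt_compat; apply: pow_lt.
Qed.

Lemma circ_coef_bound n : Cmod (circ_coef n) <= M / r ^ n.
Proof.
have := isint_norm Rle_0_1 (circ_fmod n) (@circ_coef_correct n).
lra.
Qed.

Lemma circ_rem_bound n : Cmod (rem n) <= M / r ^ n * (r / (r - Cmod w)).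
Proof.
have := isint_norm Rle_0_1 _ (@circ_rem_correct n).
move=> /(_ (M / r ^ n * (r / (r - Cmod w)))%R) H.
have : Cmod (rem n) <= (1 - 0) * (M / r ^ n * (r / (r - Cmod w))).
  apply: H => t ht; rewrite Cmod_mult.
  apply: Rmult_le_compat; try exact: Cmod_ge_0; first exact: circ_fmod.
  exact: kernel_mod.
lra.
Qed.

(** The kernel satisfies k = 1 + (w / g) k; this is the geometric series
    stopped after N terms. *)
Lemma circ_sum N :
  cint (fun t => f (g t) * k t) 0 1 =
  \big[Cplus/RtoC 0]_(n < N) (circ_coef n * w ^ n) + w ^ N * rem N.
Proof.
elim: N => [|N IH].
  rewrite big_ord0 /= Cplus_0_l Cmult_1_l; apply: cint_unique.
  by apply: (isint_ext Rle_0_1 _ (@circ_rem_correct 0)) => t _; rewrite /=; ring.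
rewrite IH circ_rem_step big_ord_recr /=; ring.
Qed.
End Formula.

End Cauchy.

(** * Taylor expansions with remainder *)

(** For n > 0 the function g^(-n) has a primitive along the circle, and the
    circle is closed. *)
Lemma circ_coef_one r n : 0 < r ->
  circ_coef r (fun _ => RtoC 1) n = if n is 0%N then RtoC 1 else RtoC 0.
Proof.
move=> r0; apply: cint_unique.
have PIp := PI_RGT_0.
case: n => [|n].
  have := is_RInt_const (V := C_R_NormedModule) 0 1 (RtoC 1).
  have -> : scal (1 - 0)%R (RtoC 1 : C_R_NormedModule) = RtoC 1.
    by rewrite /scal /= /prod_scal /scal /= /mult /=; apply: injective_projections => /=; ring.
  by apply: (isint_ext Rle_0_1) => t _ /=; ring.
pose h t := RtoC r * unit_circle t.
have c0 : RtoC (2 * PI) * Ci <> 0.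
  apply/Cmod_gt_0; rewrite Cmod_mult Cmod_R Cmod_Ci Rabs_pos_eq; lra.
have n0 : RtoC (INR (S n)) <> 0 by move=> /RtoC_inj; apply: not_0_INR.
have h0 t : h t <> 0.
  by apply/Cmod_gt_0; rewrite /h Cmod_mult Cmod_R unit_circle_mod Rabs_pos_eq; lra.
have hd t : rder h t (RtoC (2 * PI) * Ci * h t).
  apply: rder_ext (rder_scal (RtoC r) (unit_circle_rder t)) => //.
  by rewrite /h; ring.
pose F t := - / (RtoC (2 * PI) * Ci * RtoC (INR (S n))) * (/ h t) ^ S n.
have -> : RtoC 0 = F 1 - F 0.
  by rewrite /F /h unit_circle_closed; ring.
have Fd t : rder F t (1 * (/ h t) ^ S n).
  have d1 := rderive_comp (Cinv_derive (h0 t)) (hd t).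
  have d2 := rder_scal (- / (RtoC (2 * PI) * Ci * RtoC (INR (S n)))) (rderive_comp (derive_pow n (/ h t)) d1).
  apply: rder_ext d2 => //.
  rewrite [X in 1 * X](_ : _ = / h t * (/ h t) ^ n) //.
  set X := (/ h t) ^ n; field; split; first exact: h0.
  split=> //.
  split; move=> E; apply: c0; rewrite E; ring.
apply: (@isint_ftc F).
- exact: Rle_0_1.
- move=> t _; exact: (Fd t).
apply: rdable_ccont => t _.
apply: rdable_mult; first by eexists; apply: rder_const.
apply: (rdable_comp (f := fun z => z ^ S n)); first exact: ex_derive_pow.
apply: (rdable_comp (f := Cinv)); last by eexists; apply: hd.
by eexists; apply: Cinv_derive (h0 t).
Qed.

Lemma csum_single (a : nat -> C) N : (forall n, a (S n) = 0) ->
  \big[Cplus/RtoC 0]_(n < S N) a n = a 0%N.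
Proof.
move=> H; rewrite big_ord_recl big1; first by rewrite /=; ring.
by move=> i _; apply: H.
Qed.

(** The expansion [circ_sum] of the constant 1 has only its first term, and
    its remainder tends to 0. *)
Lemma cauchy_kernel_int r w : 0 < r -> Cmod w < r ->
  cint (fun t => RtoC r * unit_circle t / (RtoC r * unit_circle t - w)) 0 1 = 1.
Proof.
move=> r0 wr.
set A := cint _ 0 1.
have r1 : r < r + 1 by lra.
have Hd z : Cmod z < r + 1 -> ex_derive (fun _ : C => RtoC 1) z.
  by move=> _; eexists; apply: derive_const.
have HM t : 0 <= t <= 1 -> Cmod ((fun _ => RtoC 1) (RtoC r * unit_circle t)) <= 1.
  by move=> _; rewrite Cmod_1; lra.
suff : Cmod (A - 1) <= 0.
  move=> h; have h' : A - 1 = 0 by apply: Cmod_eq_0; have := Cmod_ge_0 (A - 1); lra.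
  have -> : A = (A - 1) + 1 by ring.
  by rewrite h'; ring.
have w0 := Cmod_ge_0 w.
have q01 := Cmod_ratio_lt1 r0 wr.
apply: (@geometric_squeeze _ (Cmod w / r * (r / (r - Cmod w))) _ q01) => N.
have := circ_sum r0 r1 wr Hd (S N).
have := circ_rem_bound r0 r1 wr Hd HM (S N).
set rem := cint (fun t => _) 0 1 => Hr.
have -> : cint (fun t => RtoC 1 * (RtoC r * unit_circle t / (RtoC r * unit_circle t - w))) 0 1 = A.
  by congr cint; apply: functional_extensionality => t; ring.
rewrite (@csum_single (fun n => circ_coef r (fun _ => RtoC 1) n * w ^ n)); last by move=> n; rewrite circ_coef_one //; ring.
rewrite circ_coef_one // => ->.
have -> : 1 * w ^ 0 + w ^ S N * rem - 1 = w ^ S N * rem by rewrite /=; ring.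
rewrite Cmod_mult Cmod_pow.
apply: Rle_trans (Rmult_le_compat_l _ _ _ _ Hr) _; first exact: pow_le.
apply: Req_le; rewrite Rpow_mult_distr /= pow_inv; field.
by repeat split; try apply: pow_nonzero; lra.
Qed.

(** Taylor expansion at 0 in the disc of radius r. The explicit remainder is
    the one of Cauchy's formula; with it, the arguments below work with finite
    sums. *)
Definition expands (f : C -> C) (r M : R) (a : nat -> C) : Prop :=
  (forall n, Cmod (a n) <= M / r ^ n) /\
  forall w N, Cmod w < r ->
    Cmod (f w - \big[Cplus/RtoC 0]_(n < N) (a n * w ^ n)) <=
    M * (Cmod w / r) ^ N * (r / (r - Cmod w)).

Lemma cauchy_expands (f : C -> C) (r r' M : R) :
  0 < r -> r < r' -> (forall z, Cmod z < r' -> ex_derive f z) ->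
  (forall t, 0 <= t <= 1 -> Cmod (f (RtoC r * unit_circle t)) <= M) ->
  expands f r M (circ_coef r f).
Proof.
move=> r0 rr' Hf HM.
have z0 : Cmod 0 < r by rewrite Cmod_0.
split=> [n|w N wr].
  exact: (circ_coef_bound r0 rr' Hf HM n).
have E1 := circ_sum r0 rr' wr Hf N.
have := circ_rem_bound r0 rr' wr Hf HM N.
move: E1; set rem := cint (fun t => _ * _ * _) 0 1.
rewrite (cauchy_circle r0 rr' wr Hf) cauchy_kernel_int // Cmult_1_r => E1 Hr.
rewrite {1}E1.
set S := \big[_/_]_(_ < N) _.
have -> : S + w ^ N * rem - S = w ^ N * rem by ring.
have w0 := Cmod_ge_0 w.
rewrite Cmod_mult Cmod_pow.
apply: Rle_trans (Rmult_le_compat_l _ _ _ _ Hr) _; first exact: pow_le.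
apply: Req_le; rewrite Rpow_mult_distr pow_inv; field.
by repeat split; try apply: pow_nonzero; lra.
Qed.

Lemma cauchy_taylor (f : C -> C) (r r' : R) :
  0 < r -> r < r' -> (forall z, Cmod z < r' -> ex_derive f z) ->
  exists M a, 0 <= M /\ expands f r M a.
Proof.
move=> r0 rr' Hf.
have gd t : rdable (fun t => f (RtoC r * unit_circle t)) t.
  apply: rdable_comp; last by eexists; apply: rder_scal (unit_circle_rder t).
  by apply: Hf; rewrite Cmod_mult Cmod_R unit_circle_mod Rabs_pos_eq; lra.
have cc t : 0 <= t <= 1 -> continuity_pt (fun t => Cmod (f (RtoC r * unit_circle t))) t.
  move=> _; apply/continuity_pt_filterlim.
  have [l /rder_continuous H] := gd t.
  apply: (filterlim_ext (fun t => norm (f (RtoC r * unit_circle t) : C_R_NormedModule))).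
    by move=> s; rewrite Cmod_norm.
  rewrite Cmod_norm; apply: filterlim_comp H _.
  exact: (filterlim_norm (V := C_R_NormedModule)).
have [tM [HM _]] := continuity_ab_maj _ 0 1 Rle_0_1 cc.
exists (Cmod (f (RtoC r * unit_circle tM))), (circ_coef r f); split; first exact: Cmod_ge_0.
exact: cauchy_expands r0 rr' Hf HM.
Qed.

(** * Holomorphic functions near a point *)

Lemma Cmod_le_0_eq (z : C) : Cmod z <= 0 -> z = 0.
Proof. by move=> h; apply: Cmod_eq_0; have := Cmod_ge_0 z; lra. Qed.

Lemma coef_bound_ge0 (A : nat -> C) (M r : R) :
  (forall n, Cmod (A n) <= M / r ^ n) -> 0 <= M.
Proof.
by move=> /(_ 0%N); rewrite /= Rdiv_1_r; have := Cmod_ge_0 (A 0%N); lra.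
Qed.

Section Expansion.
Variables (f : C -> C) (r M : R) (a : nat -> C).
Hypotheses (r0 : 0 < r) (Hf : expands f r M a).

Lemma expands_bound_ge0 : 0 <= M.
Proof. exact: coef_bound_ge0 Hf.1. Qed.

Lemma expands_at0 : f 0 = a 0%N.
Proof.
have := Hf.2 0 1%N; rewrite Cmod_0 big_ord1 => /(_ r0).
have -> : (M * (0 / r) ^ 1 * (r / (r - 0)) = 0)%R by field; lra.
move/Cmod_le_0_eq => H.
have -> : f 0 = (f 0 - a 0%N * (RtoC 0) ^ 0) + a 0%N by rewrite /=; ring.
by rewrite H; ring.
Qed.

Lemma expands_derive : is_derive f (RtoC 0) (a 1%N).
Proof.
have M0 := expands_bound_ge0.
apply/is_derive_Cmod => e e0; apply/locally_Cmod.
have K0 : 0 < 2 * (M + 1) / (r * r).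
  by apply: Rdiv_lt_0_compat; [lra | apply: Rmult_lt_0_compat].
exists (Rmin (r / 2) (e / (2 * (M + 1) / (r * r)))).
  by apply: Rmin_pos; [lra | apply: Rdiv_lt_0_compat].
move=> w Hw.
have h1 := Rlt_le_trans _ _ _ Hw (Rmin_l _ _).
have h2 := Rlt_le_trans _ _ _ Hw (Rmin_r _ _).
have ew : w - 0 = w by ring.
rewrite ew in h1 h2 *; rewrite expands_at0.
have := Hf.2 w 2%N ltac:(lra).
rewrite !big_ord_recl big_ord0 /=.
have -> : f w - (a 0%N * 1 + (a 1%N * (w * 1) + 0)) = f w - a 0%N - a 1%N * w by ring.
move=> H; apply: Rle_trans H _.
have w0 := Cmod_ge_0 w.
have h3 : r / (r - Cmod w) <= 2.
  apply: (Rmult_le_reg_r (r - Cmod w)); first lra.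
  rewrite /Rdiv Rmult_assoc Rinv_l; lra.
apply: (@Rle_trans _ ((M + 1) * (Cmod w / r * (Cmod w / r * 1)) * 2)).
  have h4 : 0 <= Cmod w / r * (Cmod w / r * 1).
    by rewrite Rmult_1_r; apply: Rle_0_sqr.
  apply: Rmult_le_compat => //.
  - exact: Rmult_le_pos.
  - by apply: Rlt_le; apply: Rdiv_lt_0_compat; lra.
  - by apply: Rmult_le_compat_r => //; lra.
have -> : ((M + 1) * (Cmod w / r * (Cmod w / r * 1)) * 2 = (2 * (M + 1) / (r * r)) * Cmod w * Cmod w)%R.
  by field; lra.
apply: Rmult_le_compat_r => //.
have -> : (e = (2 * (M + 1) / (r * r)) * (e / (2 * (M + 1) / (r * r))))%R by field; split; lra.
by apply: Rmult_le_compat_l; lra.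
Qed.

Lemma expands_shift (g : C -> C) :
  (forall w, Cmod w < r -> f w = a 0%N + w * g w) -> g 0 = a 1%N ->
  expands g r (M / r) (fun n => a (S n)).
Proof.
move=> Hg g0; split=> [n|w N wr].
  apply: Rle_trans (Hf.1 (S n)) _; apply: Req_le => /=; field.
  by repeat split; try apply: pow_nonzero; lra.
have [->|w0] := classic (w = 0).
  rewrite Cmod_0 g0; case: N => [|N].
    rewrite big_ord0; have -> : a 1%N - 0 = a 1%N by ring.
    apply: Rle_trans (Hf.1 1%nat) _; apply: Req_le => /=; field; lra.
  rewrite big_ord_recl big1 => [|i _]; last by rewrite /=; ring.
  have -> : a 1%N - (a (S (ord0 : 'I_N.+1)) * RtoC 0 ^ (ord0 : 'I_N.+1) + 0) = 0 by rewrite /=; ring.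
  rewrite Cmod_0 /=; apply: Req_le; field; lra.
have m0 : 0 < Cmod w by apply/Cmod_gt_0.
apply: (Rmult_le_reg_l (Cmod w)) => //.
rewrite -Cmod_mult.
have := Hf.2 w (S N) wr.
rewrite big_ord_recl Hg //.
have -> : \big[Cplus/RtoC 0]_(i < N) (a (bump 0 i) * w ^ (bump 0 i)) =
    w * \big[Cplus/RtoC 0]_(i < N) (a (S i) * w ^ i).
  by rewrite big_distrr; apply: eq_bigr => i _; rewrite /bump leq0n add1n /=; ring.
set S1 := \big[_/_]_(i < N) _.
have -> : a 0%N + w * g w - (a (ord0 : 'I_N.+1) * w ^ (ord0 : 'I_N.+1) + w * S1) =
  w * (g w - S1) by rewrite /=; ring.
move=> H; apply: Rle_trans H _; apply: Req_le => /=; field; lra.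
Qed.
End Expansion.

(** The value l at the centre is left free; taking the derivative of f there
    makes the quotient continuous. *)
Definition quot (f : C -> C) (l z w : C) : C :=
  if excluded_middle_informative (w = z) then l else (f w - f z) / (w - z).

Lemma Csub_neq0 (w z : C) : w <> z -> w - z <> 0.
Proof.
move=> n H; apply: n.
have -> : w = (w - z) + z by ring.
by rewrite H Cplus_0_l.
Qed.

Lemma quot_eq f l z w : f w = f z + (w - z) * quot f l z w.
Proof.
rewrite /quot; case: excluded_middle_informative => [e|n] /=; first by rewrite e; ring.
by field; apply: Csub_neq0.
Qed.

Lemma quot_at f l z : quot f l z z = l.
Proof. by rewrite /quot; case: excluded_middle_informative. Qed.

Lemma locally_neq (w z : C) : w <> z -> locally w (fun u => u <> z).
Proof.
move=> /Csub_neq0/Cmod_gt_0 m0; apply/locally_Cmod; exists (Cmod (w - z)) => // u Hu uz.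
by move: Hu; rewrite uz Cmod_sub_sym; lra.
Qed.

Lemma ex_derive_ext_near (f g : C -> C) (z : C) :
  locally z (fun w => f w = g w) -> ex_derive f z -> ex_derive g z.
Proof. by move=> H [l Hl]; exists l; apply: derive_ext_loc Hl. Qed.

Lemma quot_derive f l z w : w <> z -> ex_derive f w -> ex_derive (quot f l z) w.
Proof.
move=> wz [a Ha].
apply: (@ex_derive_ext_near (fun u => (f u - f z) / (u - z))).
  apply: locally_imp (locally_neq wz) => u uz.
  by rewrite /quot; case: excluded_middle_informative.
eexists; apply: (@derive_div (fun u => f u - f z) (fun u => u - z)).
- exact: Csub_neq0.
- exact: derive_minus Ha (derive_const _ _).
- exact: derive_minus (derive_id _) (derive_const _ _).
Qed.

(** The constant coefficient is the value at 0 and the next one the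
    derivative; the others are reached by dividing f - f(0) by w
    repeatedly. *)
Lemma expands_unique n f r M a r' M' b : 0 < r -> 0 < r' ->
  expands f r M a -> expands f r' M' b -> a n = b n.
Proof.
move=> r0 r0'; elim: n f M a M' b => [|n IH] f M a M' b Ha Hb.
  by rewrite -(expands_at0 r0 Ha) (expands_at0 r0' Hb).
have a0 := expands_at0 r0 Ha; have b0 := expands_at0 r0' Hb.
have a1 := expands_derive r0 Ha; have b1 := expands_derive r0' Hb.
have ab : a 1%N = b 1%N := derive_unique a1 b1.
apply: (IH (quot f (a 1%N) 0) (M / r)%R (fun n => a (S n)) (M' / r')%R (fun n => b (S n))).
    apply: (expands_shift r0 Ha) => [w _|]; last exact: quot_at.
  by rewrite {1}(quot_eq f (a 1%N) 0) a0; ring.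
apply: (expands_shift r0' Hb) => [w _|]; last by rewrite quot_at.
by rewrite {1}(quot_eq f (a 1%N) 0) b0; ring.
Qed.

(** Cauchy's formula gives one expansion for each radius; they share their
    coefficients by [expands_unique]. *)
Lemma entire_series (f : C -> C) : entire f ->
  exists a, forall r, 0 < r -> exists M, expands f r M a.
Proof.
move=> Hf.
have H r : 0 < r -> exists M a, expands f r M a.
  move=> r0; have [M [a [_ Ha]]] := @cauchy_taylor f r (r + 1) r0 ltac:(lra) (fun z _ => Hf z).
  by exists M, a.
have [M1 [a Ha]] := H 1 Rlt_0_1.
exists a => r r0; have [M [b Hb]] := H r r0.
exists M; have -> // : a = b.
by apply: functional_extensionality => n;
  apply: expands_unique Ha Hb => //; lra.
Qed.

Lemma derive_translate (f : C -> C) (z u l : C) :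
  is_derive f (z + u) l -> is_derive (fun v => f (z + v)) u l.
Proof.
move=> H; apply: (@is_derive_eq _ _ (1 * l)); last by ring.
apply: derive_comp => //.
by apply: is_derive_eq (derive_plus (derive_const z u) (derive_id u)) _; ring.
Qed.

Lemma derive_untranslate (f : C -> C) (z l : C) :
  is_derive (fun v => f (z + v)) (RtoC 0) l -> is_derive f z l.
Proof.
move=> H; apply: (@derive_ext_loc (fun w => f (z + (w - z)))).
  by apply: filter_forall => w; congr f; ring.
apply: (@is_derive_eq _ _ (1 * l)); last by ring.
apply: (@derive_comp (fun v => f (z + v)) (fun w => w - z)).
  by have -> : z - z = 0 by ring.
by apply: is_derive_eq (derive_minus (derive_id _) (derive_const z z)) _; ring.
Qed.

Lemma holo_ball (f : C -> C) (z : C) : holomorphic_near f z ->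
  exists2 d, 0 < d & forall u, Cmod u < d -> ex_derive f (z + u).
Proof.
move=> /locally_Cmod [d d0 Hd]; exists d => // u Hu; apply: Hd.
by have -> : z + u - z = u by ring.
Qed.

Lemma holo_expands (f : C -> C) (z : C) : holomorphic_near f z ->
  exists r M a, 0 < r /\ expands (fun u => f (z + u)) r M a.
Proof.
move=> /holo_ball [d d0 Hd].
have hd u : Cmod u < d -> ex_derive (fun u => f (z + u)) u.
  by move=> /Hd [l Hl]; exists l; apply: derive_translate.
have [M [a [_ Ha]]] := @cauchy_taylor _ (d / 2) d ltac:(lra) ltac:(lra) hd.
by exists (d / 2)%R, M, a; split; [lra | ].
Qed.

(** The removable singularity of the difference quotient: it is expanded by
    the shifted coefficients of f, so its derivative at z is the coefficient
    of index 2. *)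
Lemma holo_quot (f : C -> C) (z : C) : holomorphic_near f z ->
  ex_derive (quot f (C_derive f z) z) z.
Proof.
move=> /holo_expands [r [M [a [r0 Ha]]]].
have a0 := expands_at0 r0 Ha; have a1 := expands_derive r0 Ha.
have E : C_derive f z = a 1%N.
  by apply: is_C_derive_unique; apply: derive_untranslate.
exists (a 2%N); apply: derive_untranslate.
have ez : z + 0 = z by ring.
apply: (@expands_derive _ r (M / r) (fun n => a (S n))) => //.
apply: (expands_shift r0 Ha) => [w _|]; last by rewrite ez quot_at.
by rewrite (quot_eq f (C_derive f z) z) -a0 ez; ring.
Qed.

(** Removes singularities: when f vanishes at z, division by w - z yields a
    function that is differentiable wherever f is, z included. *)
Lemma holo_factor (f : C -> C) (z : C) : holomorphic_near f z ->
  exists g : C -> C, [/\ forall w, f w = f z + (w - z) * g w, is_derive f z (g z),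
    holomorphic_near g z & forall w, ex_derive f w -> ex_derive g w].
Proof.
move=> Hf; have Hq := holo_quot Hf.
exists (quot f (C_derive f z) z).
have H w : ex_derive f w -> ex_derive (quot f (C_derive f z) z) w.
  have [->|wz] := classic (w = z); first by move=> _.
  exact: quot_derive.
split=> //.
- by move=> w; apply: quot_eq.
- by rewrite quot_at; apply: derive_C_derive; apply: locally_singleton Hf.
- exact: locally_imp Hf.
Qed.

(** Cauchy's estimate on circles of one fixed radius s, centred at the points
    near z. *)
Lemma holo_derive_bounded (f : C -> C) (z : C) : holomorphic_near f z ->
  exists K, locally z (fun w => Cmod (C_derive f w) <= K).
Proof.
move=> Hf; have [d d0 Hd] := holo_ball Hf.
have [r [M [a [r0 Ha]]]] := holo_expands Hf.
have M0 := expands_bound_ge0 Ha.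
(* With s = min(d,r)/4, circles of radius s about the points w with
   |w - z| < s stay in the disc of radius r/2, where the remainder of the
   expansion with no term bounds f by 2 M. *)
pose s := (Rmin d r / 4)%R.
have s0 : 0 < s by rewrite /s; have := Rmin_pos _ _ d0 r0; lra.
have sd : 4 * s <= d by rewrite /s; have := Rmin_l d r; lra.
have sr : 4 * s <= r by rewrite /s; have := Rmin_r d r; lra.
exists (2 * M / s)%R; apply/locally_Cmod; exists s => // w Hw.
have hd u : Cmod u < 2 * s -> ex_derive (fun v => f (w + v)) u.
  move=> Hu.
  have Hb : Cmod (w - z + u) < d by apply: Rle_lt_trans (Cmod_triangle _ _) _; lra.
  have [l Hl] := Hd _ Hb.
  by exists l; apply: derive_translate; have -> : w + u = z + (w - z + u) by ring.
have bd t : 0 <= t <= 1 -> Cmod (f (w + RtoC s * unit_circle t)) <= 2 * M.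
  move=> _.
  have -> : w + RtoC s * unit_circle t = z + (w - z + RtoC s * unit_circle t) by ring.
  set u := (w - z + _).
  have Hu : Cmod u < 2 * s.
    apply: Rle_lt_trans (Cmod_triangle _ _) _.
    by rewrite Cmod_mult Cmod_R unit_circle_mod Rabs_pos_eq; lra.
  have := Ha.2 u 0%N ltac:(lra); rewrite big_ord0 /=.
  have -> : f (z + u) - 0 = f (z + u) by ring.
  move=> H; apply: Rle_trans H _.
  have u0 := Cmod_ge_0 u.
  rewrite Rmult_1_r Rmult_comm; apply: Rmult_le_compat_r => //.
  apply: (Rmult_le_reg_r (r - Cmod u)); first lra.
  rewrite /Rdiv Rmult_assoc Rinv_l; lra.
have e1 := @cauchy_expands (fun v => f (w + v)) s (2 * s) _ s0 ltac:(lra) hd bd.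
have := e1.1 1%N.
rewrite (is_C_derive_unique _ _ _ (derive_untranslate (expands_derive s0 e1))) /=.
by rewrite Rmult_1_r.
Qed.

Lemma derive_second_order (h : C -> C) (z : C) (K : R) :
  locally z (fun w => Cmod (h w) <= K) ->
  is_derive (fun w => (w - z) * (w - z) * h w) z (RtoC 0).
Proof.
move=> /locally_Cmod [d d0 Hd]; apply/is_derive_Cmod => e e0; apply/locally_Cmod.
have K0 : 0 <= K.
  apply: Rle_trans (Cmod_ge_0 (h z)) _; apply: Hd; have -> : z - z = 0 by ring.
  by rewrite Cmod_0.
exists (Rmin d (e / (K + 1))); first by apply: Rmin_pos => //; apply: Rdiv_lt_0_compat; lra.
move=> w Hw.
have h1 := Rlt_le_trans _ _ _ Hw (Rmin_l _ _).
have h2 := Rlt_le_trans _ _ _ Hw (Rmin_r _ _).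
have -> : (w - z) * (w - z) * h w - (z - z) * (z - z) * h z - 0 * (w - z) =
  (w - z) * h w * (w - z) by ring.
rewrite !Cmod_mult; apply: Rmult_le_compat_r; first exact: Cmod_ge_0.
apply: (@Rle_trans _ (e / (K + 1) * (K + 1))).
  apply: Rmult_le_compat; try exact: Cmod_ge_0; first lra.
  by have := Hd w h1; lra.
by apply: Req_le; field; lra.
Qed.

(** Write f(w) = f(z) + (w-z) (g(z) + (w-z) g2(w)), dividing twice.
    Differentiating, the only term of f' that is not visibly differentiable at
    z is (w-z)^2 g2'(w), and it has derivative 0 there because g2' is
    bounded. *)
Lemma holo_C_derive_at (f : C -> C) (z : C) :
  holomorphic_near f z -> ex_derive (C_derive f) z.
Proof.
move=> Hf.
have [g [Eg _ Hg _]] := holo_factor Hf.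
have [g2 [Eg2 _ Hg2 _]] := holo_factor Hg.
have [K HK] := holo_derive_bounded Hg2.
have [l Hl] := locally_singleton _ _ Hg.
have [m Hm] := locally_singleton _ _ Hg2.
have d0 := derive_second_order HK.
have d1 w : is_derive (fun u => u - z) w (RtoC 1).
  by apply: is_derive_eq (derive_minus (derive_id _) (derive_const z w)) _; ring.
have d2 := derive_plus (derive_plus Hl (derive_mult (d1 z) Hm)) d0.
eexists; apply: derive_ext_loc d2.
apply: locally_imp2 Hg Hg2 => w Hgw [b Hb].
symmetry; apply: is_C_derive_unique.
have d3 := derive_mult (d1 w) (derive_C_derive (ex_intro _ b Hb)).
have d4 := derive_plus (derive_const (g z) w) d3.
have d5 := derive_mult (d1 w) d4.
have d6 := derive_plus (derive_const (f z) w) d5.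
apply: (@derive_ext_loc (fun w => f z + (w - z) * (g z + (w - z) * g2 w))).
  by apply: filter_forall => u; rewrite [RHS]Eg [in RHS]Eg2.
by apply: is_derive_eq d6 _; rewrite [in RHS](Eg2 w); ring.
Qed.

Lemma holo_C_derive (f : C -> C) (z : C) :
  holomorphic_near f z -> holomorphic_near (C_derive f) z.
Proof.
by move=> /locally_locally; apply: locally_imp => w; apply: holo_C_derive_at.
Qed.

(** * Everywhere convergent power series *)

Definition rapidly_decreasing (A : nat -> C) : Prop :=
  forall r, 0 < r -> exists M, forall n, Cmod (A n) <= M / r ^ n.

(** The expansion holds in every disc, with the same coefficients: f is the
    sum of an everywhere convergent power series. *)
Definition series_of (f : C -> C) (A : nat -> C) : Prop :=
  forall r, 0 < r -> exists M, expands f r M A.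

Notation psum A w N := (\big[Cplus/RtoC 0]_(n < N) (A n * w ^ n)).

Lemma series_coef_rapidly_decreasing f A : series_of f A -> rapidly_decreasing A.
Proof. by move=> H r /H [M [H1 _]]; exists M. Qed.

Lemma series_coef_unique f A B n : series_of f A -> series_of f B -> A n = B n.
Proof.
move=> /(_ 1 Rlt_0_1) [M HA] /(_ 1 Rlt_0_1) [M' HB].
by apply: expands_unique HA HB; lra.
Qed.

Lemma series_partial_sums f A w : series_of f A ->
  exists K, forall N, Cmod (f w - psum A w N) <= K * (/2) ^ N.
Proof.
move=> H.
(* At this radius the remainder at w is geometric of ratio at most 1/2. *)
pose r := (2 * (Cmod w + 1))%R; have w0 := Cmod_ge_0 w.
have r0 : 0 < r by rewrite /r; lra.
have [M HM] := H r r0; have M0 := expands_bound_ge0 HM.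
exists (M * 2)%R => N.
apply: Rle_trans (HM.2 w N _) _; first by rewrite /r; lra.
rewrite Rmult_assoc (Rmult_comm ((_ / _) ^ N)) -Rmult_assoc.
apply: Rmult_le_compat.
- by apply: Rmult_le_pos => //; apply: Rlt_le; apply: Rdiv_lt_0_compat; rewrite /r; lra.
- by apply: pow_le; apply: Rmult_le_pos => //; apply: Rlt_le; apply: Rinv_0_lt_compat.
- apply: Rmult_le_compat_l => //.
  by apply: (Rmult_le_reg_r (r - Cmod w)); rewrite /Rdiv ?Rmult_assoc ?Rinv_l /r; lra.
- apply: pow_incr; split.
    by apply: Rmult_le_pos => //; apply: Rlt_le; apply: Rinv_0_lt_compat.
  by apply: (Rmult_le_reg_r r) => //; rewrite /Rdiv ?Rmult_assoc ?Rinv_l /r; lra.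
Qed.

Lemma expands_plus f g r M L A B : 0 < r -> expands f r M A -> expands g r L B ->
  expands (fun z => f z + g z) r (M + L) (fun n => A n + B n).
Proof.
move=> r0 [a1 a2] [b1 b2]; split=> [n|w N wr].
  apply: Rle_trans (Cmod_triangle _ _) _.
  by have := a1 n; have := b1 n; rewrite /Rdiv; lra.
have -> : \big[Cplus/RtoC 0]_(n < N) ((A n + B n) * w ^ n) = psum A w N + psum B w N.
  by rewrite -big_split; apply: eq_bigr => i _ /=; ring.
have -> : f w + g w - (psum A w N + psum B w N) = (f w - psum A w N) + (g w - psum B w N) by ring.
apply: Rle_trans (Cmod_triangle _ _) _.
by have := a2 w N wr; have := b2 w N wr; lra.
Qed.

Lemma series_plus f g A B : series_of f A -> series_of g B ->
  series_of (fun z => f z + g z) (fun n => A n + B n).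
Proof.
move=> HA HB r r0; have [M HM] := HA r r0; have [L HL] := HB r r0.
by exists (M + L)%R; apply: expands_plus.
Qed.

Lemma series_scal f A k : series_of f A -> series_of (fun z => k * f z) (fun n => k * A n).
Proof.
move=> HA r r0; have [M [a1 a2]] := HA r r0; exists (Cmod k * M)%R.
split=> [n|w N wr].
  rewrite Cmod_mult /Rdiv Rmult_assoc; apply: Rmult_le_compat_l; [exact: Cmod_ge_0 | exact: a1].
have -> : \big[Cplus/RtoC 0]_(n < N) (k * A n * w ^ n) = k * psum A w N.
  by rewrite big_distrr; apply: eq_bigr => i _ /=; ring.
have -> : k * f w - k * psum A w N = k * (f w - psum A w N) by ring.
rewrite Cmod_mult 2!Rmult_assoc; apply: Rmult_le_compat_l; first exact: Cmod_ge_0.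
by rewrite -Rmult_assoc; apply: a2.
Qed.

Lemma series_ext f g A B : (forall z, f z = g z) -> (forall n, A n = B n) -> series_of f A -> series_of g B.
Proof.
move=> H1 H2.
have -> : f = g by apply: functional_extensionality.
by have -> : A = B by apply: functional_extensionality.
Qed.

Lemma psum_tail A w M q N k : 0 <= q < 1 -> 
  (forall n, Cmod (A n * w ^ n) <= M * q ^ n) ->
  Cmod (psum A w (N + k) - psum A w N) <= M * q ^ N * ((1 - q ^ k) / (1 - q)).
Proof.
move=> q01 H; elim: k => [|k IH].
  rewrite addn0 /=; have -> : psum A w N - psum A w N = 0 by ring.
  rewrite Cmod_0; apply: Req_le; field; lra.
rewrite addnS big_ord_recr /=.
have -> : psum A w (N + k) + A (N + k)%N * w ^ (N + k) - psum A w N =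
  (psum A w (N + k) - psum A w N) + A (N + k)%N * w ^ (N + k) by ring.
apply: Rle_trans (Cmod_triangle _ _) _.
apply: Rle_trans (Rplus_le_compat _ _ _ _ IH (H (N + k)%N)) _.
rewrite -plusE pow_add; apply: Req_le; field; lra.
Qed.

Lemma psum_sum_n A w N :
  sum_n (G := C_R_NormedModule) (fun n => A n * w ^ n) N = psum A w (S N).
Proof.
elim: N => [|N IH]; first by rewrite sum_O big_ord1.
by rewrite sum_Sn IH [in RHS]big_ord_recr.
Qed.

Lemma series_exists A : rapidly_decreasing A -> exists f, series_of f A.
Proof.
move=> HA.
have ex w : exists l : C, is_series (V := C_R_NormedModule) (fun n => A n * w ^ n) l.
  have w0 := Cmod_ge_0 w; pose r := (2 * (Cmod w + 1))%R.
  have r0 : 0 < r by rewrite /r; lra.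
  have [M HM] := HA r r0.
  apply: (@ex_series_le _ C_R_CompleteNormedModule _ (fun n => M * (/2) ^ n)%R).
    move=> n; rewrite -Cmod_norm Cmod_mult Cmod_pow.
    have M0 := coef_bound_ge0 HM.
    apply: (@Rle_trans _ (M / r ^ n * (r / 2) ^ n)).
      apply: Rmult_le_compat => //; [exact: Cmod_ge_0 | exact: pow_le |].
      by apply: pow_incr; rewrite /r; lra.
    apply: Req_le; rewrite /Rdiv Rpow_mult_distr.
    by field; apply: pow_nonzero; lra.
  apply: (@ex_series_scal _ R_NormedModule); apply: ex_series_geom; rewrite Rabs_pos_eq; lra.
exists (fun w => sval (constructive_indefinite_description _ (ex w))) => r r0.
have [M HM] := HA r r0; exists M; split=> // w N wr.
case: constructive_indefinite_description => l Hl /=.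
have w0 := Cmod_ge_0 w.
have q01 := Cmod_ratio_lt1 r0 wr.
have M0 := coef_bound_ge0 HM.
apply: le_epsilon => e e0.
have Hloc : locally l (fun z => Cmod (z - l) < e) by apply/locally_Cmod; exists e.
have [n0 Hn0] := Hl _ Hloc.
pose k := S n0.
have {}Hn0 : Cmod (psum A w (N + k) - l) < e.
  rewrite /k addnS -(@psum_sum_n A w); apply: Hn0; rewrite -plusE; lia.
have -> : l - psum A w N = (psum A w (N + k) - psum A w N) - (psum A w (N + k) - l) by ring.
apply: Rle_trans (Cmod_triangle _ _) _; rewrite Cmod_opp.
have H n : Cmod (A n * w ^ n) <= M * (Cmod w / r) ^ n.
  rewrite Cmod_mult Cmod_pow.
  apply: Rle_trans (Rmult_le_compat_r _ _ _ _ (HM n)) _; first exact: pow_le.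
  apply: Req_le; rewrite /Rdiv Rpow_mult_distr pow_inv; ring.
have := psum_tail N k q01 H.
have : M * (Cmod w / r) ^ N * ((1 - (Cmod w / r) ^ k) / (1 - Cmod w / r)) <=
  M * (Cmod w / r) ^ N * (r / (r - Cmod w)).
  apply: Rmult_le_compat_l; first by apply: Rmult_le_pos => //; apply: pow_le; lra.
  have -> : (r / (r - Cmod w) = 1 / (1 - Cmod w / r))%R by field; lra.
  apply: Rmult_le_compat_r; first by apply: Rlt_le; apply: Rinv_0_lt_compat; lra.
  by have := pow_le _ k q01.1; lra.
lra.
Qed.

Lemma INR_le_pow2 n : INR (S n) <= 2 ^ S n.
Proof.
elim: n => [|n IH]; first by rewrite /=; lra.
rewrite S_INR -[(2 ^ n.+2)%R]/(2 * 2 ^ S n)%R.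
have : 1 <= 2 ^ S n by apply: pow_R1_Rle; lra.
lra.
Qed.

Lemma rapidly_decreasing_derive A : rapidly_decreasing A -> rapidly_decreasing (fun n => RtoC (INR (S n)) * A (S n)).
Proof.
move=> HA r r0; have [M HM] := HA (2 * r)%R ltac:(lra).
exists (M / r)%R => n.
have M0 := coef_bound_ge0 HM.
rewrite Cmod_mult Cmod_R Rabs_pos_eq; last exact: pos_INR.
have p2 : 0 < 2 ^ S n by apply: pow_lt; lra.
have pr : 0 < r ^ n by apply: pow_lt.
have n2 := INR_le_pow2 n.
apply: (@Rle_trans _ (2 ^ S n * (M / (2 * r) ^ S n))).
  apply: Rmult_le_compat => //; [exact: pos_INR | exact: Cmod_ge_0].
apply: Req_le; rewrite Rpow_mult_distr -[(r ^ S n)%R]/(r * r ^ n)%R.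
by field; repeat split; lra.
Qed.

(** The factor 2^(n+1) is a crude bound for the quadratic growth in n; any
    geometric factor is harmless for coefficients decreasing faster than every
    geometric sequence. *)
Lemma pow_second_order (n : nat) (w z : C) (p : R) : 1 <= p ->
  Cmod w <= p -> Cmod z <= p ->
  Cmod (w ^ S n - z ^ S n - RtoC (INR (S n)) * z ^ n * (w - z)) <=
  (2 * p) ^ S n * (Cmod (w - z) * Cmod (w - z)).
Proof.
move=> p1 wp zp; have d0 := Cmod_ge_0 (w - z).
have s0 : 0 <= Cmod (w - z) * Cmod (w - z) by apply: Rmult_le_pos.
elim: n => [|n IH].
  have -> : w ^ 1 - z ^ 1 - RtoC (INR 1) * z ^ 0 * (w - z) = 0 by rewrite /=; ring.
  by rewrite Cmod_0; apply: Rmult_le_pos => //; apply: pow_le; lra.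
have -> : w ^ n.+2 - z ^ n.+2 - RtoC (INR n.+2) * z ^ S n * (w - z) =
  w * (w ^ S n - z ^ S n - RtoC (INR (S n)) * z ^ n * (w - z)) +
  RtoC (INR (S n)) * z ^ n * ((w - z) * (w - z)).
  rewrite [INR n.+2]S_INR RtoC_plus -[w ^ n.+2]/(w * w ^ S n) -[z ^ n.+2]/(z * (z * z ^ n)) -[z ^ S n]/(z * z ^ n); ring.
apply: Rle_trans (Cmod_triangle _ _) _; rewrite Cmod_mult.
rewrite (Cmod_mult _ ((w - z) * _)) (Cmod_mult (w - z)) (Cmod_mult _ (z ^ n)) Cmod_R Cmod_pow.
rewrite Rabs_pos_eq; last exact: pos_INR.
have h1 : Cmod w * Cmod (w ^ S n - z ^ S n - RtoC (INR (S n)) * z ^ n * (w - z)) <=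
   p * ((2 * p) ^ S n * (Cmod (w - z) * Cmod (w - z))).
  by apply: Rmult_le_compat => //; exact: Cmod_ge_0.
have n2 := INR_le_pow2 n.
have h2 : INR (S n) * Cmod z ^ n <= p * (2 * p) ^ S n.
  rewrite Rpow_mult_distr.
  apply: (@Rle_trans _ (2 ^ S n * p ^ n)).
    apply: Rmult_le_compat => //; [exact: pos_INR | apply: pow_le; exact: Cmod_ge_0 |].
    by apply: pow_incr; split => //; apply: Cmod_ge_0.
  have pn : 0 <= p ^ n by apply: pow_le; lra.
  have t2 : 0 <= 2 ^ S n by apply: pow_le; lra.
  have h3 : p ^ n <= p * p ^ S n.
    have hx x : 0 <= x -> x <= p * x by move=> ?; nra.
    by rewrite -[(p ^ S n)%R]/(p * p ^ n)%R; have := hx _ pn; have := hx (p * p ^ n)%R; lra.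
  rewrite [(p * _)%R](_ : _ = 2 ^ S n * (p * p ^ S n))%R; last by ring.
  exact: Rmult_le_compat_l.
have h4 := Rmult_le_compat_r _ _ _ s0 h2.
rewrite -[((2 * p) ^ n.+2)%R]/(2 * p * (2 * p) ^ S n)%R.
lra.
Qed.

(** Termwise differentiation: the difference quotients of the partial sums
    differ from the expected derivative by O(|w-z|) uniformly in N, by
    [pow_second_order]. *)
Lemma series_derive f g A : series_of f A -> series_of g (fun n => RtoC (INR (S n)) * A (S n)) ->
  forall z, is_derive f z (g z).
Proof.
move=> Hf Hg z; have z0 := Cmod_ge_0 z.
pose p := (Cmod z + 1)%R; have p0 : 0 < p by rewrite /p; lra.
have [M HM] := series_coef_rapidly_decreasing Hf (r := (4 * p)%R) ltac:(lra).
have M0 := coef_bound_ge0 HM.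
have key w : Cmod (w - z) < 1 ->
   Cmod (f w - f z - g z * (w - z)) <= 2 * M * (Cmod (w - z) * Cmod (w - z)).
  move=> wz1.
  have s0 : 0 <= Cmod (w - z) * Cmod (w - z) by apply: Rmult_le_pos; apply: Cmod_ge_0.
  have wp : Cmod w <= p.
    have -> : w = (w - z) + z by ring.
    by apply: Rle_trans (Cmod_triangle _ _) _; rewrite /p; lra.
  have zp : Cmod z <= p by rewrite /p; lra.
  have p1 : 1 <= p by rewrite /p; lra.
  (* T N is the N-th partial sum of the error f w - f z - g z (w - z); the
     series of g has one term fewer because the constant of f drops out. *)
  pose T N := psum A w (S N) - psum A z (S N) -
      psum (fun n => RtoC (INR (S n)) * A (S n)) z N * (w - z).
  have HT N : Cmod (T N) <= M * (2 - 2 * (/2) ^ S N) * (Cmod (w - z) * Cmod (w - z)).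
    elim: N => [|N IH].
      rewrite /T !big_ord_recr !big_ord0 /=.
      have -> : 0 + A 0%N * 1 - (0 + A 0%N * 1) - 0 * (w - z) = 0 by ring.
      by rewrite Cmod_0; apply: Rmult_le_pos => //; apply: Rmult_le_pos => //; lra.
    have -> : T (S N) = T N +
      A (S N) * (w ^ S N - z ^ S N - RtoC (INR (S N)) * z ^ N * (w - z)).
      by rewrite /T (big_ord_recr N) !(big_ord_recr N.+1) /=; ring.
    apply: Rle_trans (Cmod_triangle _ _) _; rewrite Cmod_mult.
    have h1 := pow_second_order N p1 wp zp.
    have h2 := Rmult_le_compat _ _ _ _ (Cmod_ge_0 _) (Cmod_ge_0 _) (HM (S N)) h1.
    have e1 : (M / (4 * p) ^ S N * ((2 * p) ^ S N * (Cmod (w - z) * Cmod (w - z))) =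
      M * (/2) ^ S N * (Cmod (w - z) * Cmod (w - z)))%R.
      have -> : ((4 * p) = 2 * (2 * p))%R by ring.
      rewrite (Rpow_mult_distr 2 (2 * p)) pow_inv; field.
      by split; apply: pow_nonzero; lra.
    rewrite e1 in h2.
    have e2 : (2 - 2 * (/ 2) ^ N.+2 = (2 - 2 * (/ 2) ^ N.+1) + (/2) ^ N.+1)%R.
      by rewrite -[((/2) ^ N.+2)%R]/(/2 * (/2) ^ N.+1)%R; field.
    rewrite e2; lra.
  have [K1 L1] := series_partial_sums w Hf; have [K2 L2] := series_partial_sums z Hf; have [K3 L3] := series_partial_sums z Hg.
  have K10 : 0 <= K1 by have := L1 0%N; have := Cmod_ge_0 (f w - psum A w 0); rewrite /=; lra.
  have K20 : 0 <= K2 by have := L2 0%N; have := Cmod_ge_0 (f z - psum A z 0); rewrite /=; lra.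
  suff : Cmod (f w - f z - g z * (w - z)) - 2 * M * (Cmod (w - z) * Cmod (w - z)) <= 0 by lra.
  apply: (@geometric_squeeze _ (K1 + K2 + K3) (/2)); first lra.
  move=> N.
  have -> : f w - f z - g z * (w - z) = T N + (f w - psum A w (S N)) - (f z - psum A z (S N))
     - (g z - psum (fun n => RtoC (INR (S n)) * A (S n)) z N) * (w - z).
    by rewrite /T; ring.
  set a := f w - _; set b := f z - _; set c := g z - _.
  have := Cmod_triangle (T N + a - b) (- (c * (w - z))).
  have := Cmod_triangle (T N + a) (- b).
  have := Cmod_triangle (T N) a.
  rewrite !Cmod_opp (Cmod_mult c) -!/(Cminus _ _).
  have := HT N; have := L1 (S N); have := L2 (S N); have := L3 N; rewrite -/a -/b -/c.
  have hN : 0 < (/2) ^ N by apply: pow_lt; lra.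
  rewrite -[((/2) ^ N.+1)%R]/(/2 * (/2) ^ N)%R.
  move=> h3 h2 h1 hT.
  have hc : Cmod c * Cmod (w - z) <= K3 * (/2)^N.
    apply: Rle_trans h3; rewrite -[X in _ <= X]Rmult_1_r.
    by apply: Rmult_le_compat_l; [exact: Cmod_ge_0 | lra].
  have hK1 : K1 * (/2 * (/2)^N) <= K1 * (/2)^N by apply: Rmult_le_compat_l; lra.
  have hK2 : K2 * (/2 * (/2)^N) <= K2 * (/2)^N by apply: Rmult_le_compat_l; lra.
  have hM : M * (2 - 2 * (/ 2 * (/ 2) ^ N)) * (Cmod (w - z) * Cmod (w - z)) <=
    2 * M * (Cmod (w - z) * Cmod (w - z)).
    apply: Rmult_le_compat_r => //; rewrite (Rmult_comm 2 M); apply: Rmult_le_compat_l; lra.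
  lra.
apply/is_derive_Cmod => e e0; apply/locally_Cmod.
exists (Rmin 1 (e / (2 * M + 1))).
  by apply: Rmin_pos; [lra | apply: Rdiv_lt_0_compat; lra].
move=> w Hw.
have h1 := Rlt_le_trans _ _ _ Hw (Rmin_l _ _).
have h2 := Rlt_le_trans _ _ _ Hw (Rmin_r _ _).
apply: Rle_trans (key w h1) _; rewrite -Rmult_assoc; apply: Rmult_le_compat_r.
  exact: Cmod_ge_0.
have -> : (e = (2 * M + 1) * (e / (2 * M + 1)))%R by field; lra.
apply: Rmult_le_compat; try lra; exact: Cmod_ge_0.
Qed.

Lemma series_entire f A : series_of f A -> entire f.
Proof.
move=> Hf z; have [g Hg] := series_exists (rapidly_decreasing_derive (series_coef_rapidly_decreasing Hf)).
by exists (g z); apply: series_derive Hf Hg z.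
Qed.

Lemma series_at0 f A : series_of f A -> f 0 = A 0%N.
Proof. by move=> /(_ 1 Rlt_0_1) [M HM]; apply: expands_at0 HM; lra. Qed.

Lemma series_quot f A : series_of f A ->
  exists g, series_of g (fun n => A (S n)) /\ forall z, f z = A 0%N + z * g z.
Proof.
move=> Hf; have f0 := series_at0 Hf.
exists (quot f (A 1%N) 0); split=> [r r0|z].
  have [M HM] := Hf r r0; exists (M / r)%R.
  apply: (expands_shift r0 HM) => [w _|]; last exact: quot_at.
  by rewrite {1}(quot_eq f (A 1%N) 0) f0; ring.
by rewrite {1}(quot_eq f (A 1%N) 0) f0; ring.
Qed.

Definition cauchy_product (A B : nat -> C) (n : nat) : C :=
  \big[Cplus/RtoC 0]_(j < S n) (A j * B (n - j)%N).

Lemma entire_mult f g : entire f -> entire g -> entire (fun z => f z * g z).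
Proof. by move=> Hf Hg z; have [a Ha] := Hf z; have [b Hb] := Hg z; eexists; apply: derive_mult Ha Hb. Qed.

(** Cauchy products without double series. Splitting off the constant terms, f
    = A0 + z f1 and g = B0 + z g1 give f g = A0 B0 + z (f g1 + B0 f1); so the
    coefficient of index n+1 of f g is the one of index n of f g1 plus B0
    times the one of f1, and the induction applies to f g1. *)
Lemma series_mult_coef n f g A B D : series_of f A -> series_of g B ->
  series_of (fun z => f z * g z) D -> D n = cauchy_product A B n.
Proof.
elim: n f g A B D => [|n IH] f g A B D Hf Hg Hfg.
  rewrite -(series_at0 Hfg) (series_at0 Hf) (series_at0 Hg) /cauchy_product big_ord1 //.
have [f1 [Hf1 Ef]] := series_quot Hf; have [g1 [Hg1 Eg]] := series_quot Hg.
have [E HE] := entire_series (entire_mult (series_entire Hf) (series_entire Hg1)).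
have [k1 [Hk1 Ek]] := series_quot Hfg.
have HkE : series_of (fun z => f z * g1 z + B 0%N * f1 z) (fun n => E n + B 0%N * A (S n)).
  exact: (series_plus HE (series_scal (B 0%N) Hf1)).
have D0 : D 0%N = A 0%N * B 0%N by rewrite -(series_at0 Hfg) (series_at0 Hf) (series_at0 Hg).
have HkD : series_of (fun z => f z * g1 z + B 0%N * f1 z) (fun n => D (S n)).
  move=> r r0; have [M HM] := Hfg r r0; exists (M / r)%R.
  apply: (expands_shift r0 HM) => [w _|].
    by rewrite Eg D0 [in RHS]Ef [in LHS]Ef; ring.
  have [L HL] := HE 1 Rlt_0_1.
  have [M1 HM1] := Hfg 1 Rlt_0_1.
  apply: derive_unique (expands_derive Rlt_0_1 HM1).
  have [a Ha] := series_entire Hf1 0; have [b Hb] := series_entire Hg1 0.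
  have da := derive_plus (derive_const (A 0%N) 0) (derive_mult (derive_id 0) Ha).
  have db := derive_plus (derive_const (B 0%N) 0) (derive_mult (derive_id 0) Hb).
  have dd := derive_mult da db.
  apply: (@derive_ext_loc (fun z => (A 0%N + z * f1 z) * (B 0%N + z * g1 z))).
    by apply: filter_forall => z; rewrite -Ef -Eg.
  apply: is_derive_eq dd _; rewrite Ef; ring.
have := series_coef_unique n HkD HkE => /= ->.
rewrite (IH _ _ _ _ _ Hf Hg1 HE) /cauchy_product [in RHS]big_ord_recr /= subnn.
rewrite (Cmult_comm (B 0%N)); congr (_ + _); apply: eq_bigr => i _.
by rewrite subSn // -ltnS.
Qed.

Lemma series_mult f g A B : series_of f A -> series_of g B -> series_of (fun z => f z * g z) (cauchy_product A B).
Proof.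
move=> Hf Hg; have [D HD] := entire_series (entire_mult (series_entire Hf) (series_entire Hg)).
by apply: (series_ext _ _ HD) => // n; apply: series_mult_coef Hf Hg HD.
Qed.

(** * Linear systems with entire coefficients *)

Section LinearSystem.
Variables (a b c d : C -> C) (A B D E : nat -> C).
Hypotheses (Ha : series_of a A) (Hb : series_of b B) (Hc : series_of c D) (Hd : series_of d E).
Variables (y0 : C * C).

Let step (n : nat) (Y : nat -> C * C) : C * C :=
  let U := fun k => (Y k).1 in let W := fun k => (Y k).2 in
  (/ RtoC (INR (S n)) * (cauchy_product A U n + cauchy_product B W n),
   / RtoC (INR (S n)) * (cauchy_product D U n + cauchy_product E W n)).

(** The recurrence uses all the earlier coefficients, so the recursion builds
    the table of the coefficients of index at most n. *)
Fixpoint sys_tab (n : nat) : nat -> C * C :=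
  match n with
  | O => fun _ => y0
  | S m => fun k => if (k <= m)%N then sys_tab m k else step m (sys_tab m)
  end.

Definition sys_coef (n : nat) : C * C := sys_tab n n.

Lemma sys_tab_le n k : (k <= n)%N -> sys_tab n k = sys_coef k.
Proof.
elim: n => [|n IH]; first by rewrite leqn0 => /eqP ->.
rewrite leq_eqVlt => /orP [/eqP -> //|]; rewrite ltnS => kn.
by rewrite /= kn IH.
Qed.

Lemma sys_coefS n : sys_coef (S n) = step n sys_coef.
Proof.
rewrite /sys_coef /= ltnn /step /cauchy_product.
have E1 (j : 'I_n.+1) : sys_tab n (n - j) = sys_coef (n - j).
  by apply: sys_tab_le; apply: leq_subr.
by congr (_, _); congr (_ * (_ + _)); apply: eq_bigr => j _; rewrite E1.
Qed.

Let U n := (sys_coef n).1.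
Let W n := (sys_coef n).2.

Lemma csum_geometric (x : nat -> C) (K : R) n : 0 <= K ->
  (forall j, (j < n)%N -> Cmod (x j) <= K * (/2) ^ j) ->
  Cmod (\big[Cplus/RtoC 0]_(j < n) x j) <= K * (2 - 2 * (/2) ^ n).
Proof.
move=> K0; elim: n => [|n IH] H.
  by rewrite big_ord0 Cmod_0 /=; lra.
rewrite big_ord_recr /=; apply: Rle_trans (Cmod_triangle _ _) _.
have h1 := IH (fun j h => H j (ltn_trans h (ltnSn n))).
apply: Rle_trans (Rplus_le_compat _ _ _ _ h1 (H n (ltnSn n))) _.
by apply: Req_le => /=; field.
Qed.

Lemma cauchy_product_bound (X Y : nat -> C) (M K r : R) n : 0 < r -> 0 <= M -> 0 <= K ->
  (forall j, Cmod (X j) <= M / (2 * r) ^ j) ->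
  (forall j, (j <= n)%N -> Cmod (Y j) <= K / r ^ j) ->
  Cmod (cauchy_product X Y n) <= 2 * (M * K / r ^ n).
Proof.
move=> r0 M0 K0 HX HY.
have pr : 0 < r ^ n by apply: pow_lt.
have MK : 0 <= M * K / r ^ n.
  by apply: Rmult_le_pos; [apply: Rmult_le_pos | apply: Rlt_le; apply: Rinv_0_lt_compat].
apply: Rle_trans (@csum_geometric (fun j => X j * Y (n - j)%N) (M * K / r ^ n) _ MK _) _.
  move=> j jn; rewrite Cmod_mult.
  apply: Rle_trans (Rmult_le_compat _ _ _ _ (Cmod_ge_0 _) (Cmod_ge_0 _) (HX j) (HY (n - j)%N (leq_subr _ _))) _.
  have -> : (r ^ n = r ^ j * r ^ (n - j)%N)%R.
    by rewrite -pow_add plusE subnKC // -ltnS.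
  apply: Req_le; rewrite Rpow_mult_distr pow_inv; field.
  by repeat split; try apply: pow_nonzero; lra.
have t0 : 0 <= (/2) ^ S n by apply: pow_le; lra.
by have := Rmult_le_pos _ _ MK t0; lra.
Qed.

Lemma initial_bound (s : nat -> R) N : exists K, 0 <= K /\ forall n, (n <= N)%N -> s n <= K.
Proof.
elim: N => [|N [K [K0 HK]]].
  exists (Rmax 0 (s 0%N)); split; first exact: Rmax_l.
  by move=> n; rewrite leqn0 => /eqP ->; apply: Rmax_r.
exists (Rmax K (s (S N))); split; first by apply: Rle_trans K0 (Rmax_l _ _).
move=> n; rewrite leq_eqVlt => /orP [/eqP ->|]; first exact: Rmax_r.
by rewrite ltnS => /HK h; apply: Rle_trans h (Rmax_l _ _).
Qed.

(** The coefficients of the system are O((2r)^(-n)), so their Cauchy product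
    with a sequence bounded by K / r^n is at most 2 M K / r^n. The recurrence
    divides by n + 1; as soon as n + 1 >= 4 M r the bound K / r^n propagates,
    and K is chosen to cover the finitely many indices before. *)
Lemma sys_coef_bound r : 0 < r ->
  exists K, forall n, Cmod (U n) <= K / r ^ n /\ Cmod (W n) <= K / r ^ n.
Proof.
move=> r0; have r2 : 0 < 2 * r by lra.
have [M1 H1] := series_coef_rapidly_decreasing Ha r2; have [M2 H2] := series_coef_rapidly_decreasing Hb r2.
have [M3 H3] := series_coef_rapidly_decreasing Hc r2; have [M4 H4] := series_coef_rapidly_decreasing Hd r2.
have N1 := coef_bound_ge0 H1; have N2 := coef_bound_ge0 H2.
have N3 := coef_bound_ge0 H3; have N4 := coef_bound_ge0 H4.
pose M := (M1 + M2 + M3 + M4)%R; have M0 : 0 <= M by rewrite /M; lra.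
have up M' X : M' <= M -> (forall n, Cmod (X n) <= M' / (2 * r) ^ n) ->
   forall n, Cmod (X n) <= M / (2 * r) ^ n.
  move=> h1 h2 n; apply: Rle_trans (h2 n) _; apply: Rmult_le_compat_r => //.
  by apply: Rlt_le; apply: Rinv_0_lt_compat; apply: pow_lt.
have {}H1 := up M1 A ltac:(rewrite /M; lra) H1; have {}H2 := up M2 B ltac:(rewrite /M; lra) H2.
have {}H3 := up M3 D ltac:(rewrite /M; lra) H3; have {}H4 := up M4 E ltac:(rewrite /M; lra) H4.
have [N HN] := INR_archimed 1 (4 * M * r)%R Rlt_0_1.
have [K [K0 HK]] := initial_bound (fun n => (Cmod (U n) + Cmod (W n)) * r ^ n)%R N.
exists K.
have H : forall m n, (n <= m)%N -> Cmod (U n) <= K / r ^ n /\ Cmod (W n) <= K / r ^ n.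
  have small n : (n <= N)%N -> Cmod (U n) <= K / r ^ n /\ Cmod (W n) <= K / r ^ n.
    move=> /HK h; have pr : 0 < r ^ n by apply: pow_lt.
    have u0 := Cmod_ge_0 (U n); have w0 := Cmod_ge_0 (W n).
    have up0 := Rmult_le_pos _ _ u0 (Rlt_le _ _ pr); have wp0 := Rmult_le_pos _ _ w0 (Rlt_le _ _ pr).
    by split; apply: (Rmult_le_reg_r (r ^ n)) => //; rewrite /Rdiv Rmult_assoc Rinv_l; lra.
  elim=> [|m IH] n nm; first by apply: small; move: nm; rewrite leqn0 => /eqP ->.
  case: (leqP n N) => [|Nn]; first exact: small.
  move: nm; rewrite leq_eqVlt => /orP [/eqP en|]; last by rewrite ltnS; apply: IH.
  subst n; have pr : 0 < r ^ m by apply: pow_lt.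
  have m0 : 0 < INR (S m) by apply: lt_0_INR; lia.
  have mN : 4 * M * r <= INR (S m).
    have := le_INR N (S m) ltac:(move/ltP: Nn; lia); lra.
  have HU n : (n <= m)%N -> Cmod (U n) <= K / r ^ n by move=> /IH [].
  have HW n : (n <= m)%N -> Cmod (W n) <= K / r ^ n by move=> /IH [].
  have fin (x y : C) : Cmod x <= 2 * (M * K / r ^ m) -> Cmod y <= 2 * (M * K / r ^ m) ->
     Cmod (/ RtoC (INR (S m)) * (x + y)) <= K / r ^ S m.
    move=> hx hy; rewrite Cmod_mult Cmod_inv; last by move=> /RtoC_inj; lra.
    rewrite Cmod_R Rabs_pos_eq; last lra.
    apply: (@Rle_trans _ (/ INR (S m) * (4 * M * r * (K / r ^ S m)))).
      apply: Rmult_le_compat_l; first by apply: Rlt_le; apply: Rinv_0_lt_compat.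
      apply: Rle_trans (Cmod_triangle _ _) _.
      have -> : (4 * M * r * (K / r ^ S m) = 4 * (M * K / r ^ m))%R.
        by rewrite -[(r ^ S m)%R]/(r * r ^ m)%R; field; lra.
      lra.
    have q0 : 0 <= K / r ^ S m.
      by apply: Rmult_le_pos => //; apply: Rlt_le; apply: Rinv_0_lt_compat; apply: pow_lt.
    apply: (Rmult_le_reg_l (INR (S m))) => //; rewrite -Rmult_assoc Rinv_r; last lra.
    by rewrite Rmult_1_l; apply: Rmult_le_compat_r.
  rewrite /U /W sys_coefS /step /=.
  split; apply: fin; apply: (@cauchy_product_bound _ _ M K r) => //.
by move=> n; exact: (H n n (leqnn n)).
Qed.

Lemma linear_system : exists u w : C -> C,
  [/\ forall z, is_derive u z (a z * u z + b z * w z),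
      forall z, is_derive w z (c z * u z + d z * w z), u 0 = y0.1 & w 0 = y0.2].
Proof.
have fU : rapidly_decreasing U by move=> r /sys_coef_bound [K HK]; exists K => n; apply: (HK n).1.
have fW : rapidly_decreasing W by move=> r /sys_coef_bound [K HK]; exists K => n; apply: (HK n).2.
have [u Hu] := series_exists fU; have [w Hw] := series_exists fW.
exists u, w.
have nz n : RtoC (INR (S n)) <> 0 by move=> /RtoC_inj; apply: not_0_INR.
have cancel n x : RtoC (INR (S n)) * (/ RtoC (INR (S n)) * x) = x.
  by rewrite Cmult_assoc Cinv_r // Cmult_1_l.
split.
- move=> z.
  apply: (@series_derive u (fun z => a z * u z + b z * w z) U) => //.
  apply: (series_ext _ _ (series_plus (series_mult Ha Hu) (series_mult Hb Hw))) => // n.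
  by rewrite /U sys_coefS; symmetry; exact: cancel.
- move=> z.
  apply: (@series_derive w (fun z => c z * u z + d z * w z) W) => //.
  apply: (series_ext _ _ (series_plus (series_mult Hc Hu) (series_mult Hd Hw))) => // n.
  by rewrite /W sys_coefS; symmetry; exact: cancel.
- exact: series_at0 Hu.
- exact: series_at0 Hw.
Qed.
End LinearSystem.

Theorem entire_linear_system (a b c d : C -> C) (u0 w0 : C) :
  entire a -> entire b -> entire c -> entire d ->
  exists u w : C -> C,
  [/\ forall z, is_derive u z (a z * u z + b z * w z),
      forall z, is_derive w z (c z * u z + d z * w z), u 0 = u0 & w 0 = w0].
Proof.
move=> /entire_series [A HA] /entire_series [B HB] /entire_series [D HD] /entire_series [E HE].
exact: (linear_system HA HB HD HE (u0, w0)).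
Qed.

(** Along the segment from 0 to z the function is a path with zero
    derivative. *)
Lemma entire_derive0_const (f : C -> C) :
  (forall z, is_derive f z (RtoC 0)) -> forall z, f z = f 0.
Proof.
move=> H z.
have d1 t : rder (fun t => f (RtoC t * z)) t (RtoC 0).
  have d2 : rder (fun t => RtoC t * z) t (1 * z).
    have r1 : rder RtoC t (RtoC 1).
      by apply: (@rder_pair (fun t => t) (fun _ => 0%R)); auto_derive.
    by apply: (rder_ext _ _ (rder_mult r1 (rder_const z t))) => //; ring.
  by apply: (rder_ext _ _ (rderive_comp (H _) d2)) => //; ring.
have h := isint_ftc Rle_0_1 (fun t _ => d1 t).
have /h I : ccont (fun _ => RtoC 0) 0 1 by move=> t _; apply: continuous_const.
have J := @is_RInt_const C_R_NormedModule 0 1 (RtoC 0).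
have := cint_unique I; rewrite (cint_unique J).
rewrite Cmult_0_l Cmult_1_l => e.
have e0 : f z - f 0 = 0.
  by rewrite -e /scal /= /prod_scal /scal /= /mult /=; apply: injective_projections => /=; ring.
have -> : f z = (f z - f 0) + f 0 by ring.
by rewrite e0; ring.
Qed.

(** * Holomorphic germs and the Schwarzian derivative *)

Lemma holo_const (a z : C) : holomorphic_near (fun _ => a) z.
Proof. by apply: filter_forall => w; eexists; apply: derive_const. Qed.

Lemma holo_id (z : C) : holomorphic_near (fun w => w) z.
Proof. by apply: filter_forall => w; eexists; apply: derive_id. Qed.

Lemma holo_plus (f g : C -> C) (z : C) : holomorphic_near f z ->
  holomorphic_near g z -> holomorphic_near (fun w => f w + g w) z.
Proof. by apply: locally_imp2 => w [a Ha] [b Hb]; eexists; apply: derive_plus Ha Hb. Qed.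

Lemma holo_minus (f g : C -> C) (z : C) : holomorphic_near f z ->
  holomorphic_near g z -> holomorphic_near (fun w => f w - g w) z.
Proof. by apply: locally_imp2 => w [a Ha] [b Hb]; eexists; apply: derive_minus Ha Hb. Qed.

Lemma holo_mult (f g : C -> C) (z : C) : holomorphic_near f z ->
  holomorphic_near g z -> holomorphic_near (fun w => f w * g w) z.
Proof. by apply: locally_imp2 => w [a Ha] [b Hb]; eexists; apply: derive_mult Ha Hb. Qed.

Lemma holo_ex_derive (f : C -> C) (z : C) : holomorphic_near f z -> ex_derive f z.
Proof. exact: locally_singleton. Qed.

Lemma holo_continuous (f : C -> C) (z : C) : holomorphic_near f z -> continuous f z.
Proof. by move=> /holo_ex_derive [l]; apply: derive_continuous. Qed.

Lemma continuous_neq0 (f : C -> C) (z : C) :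
  continuous f z -> f z <> 0 -> locally z (fun w => f w <> 0).
Proof. by move=> Hf /locally_neq; apply: Hf. Qed.

Lemma holo_neq0 (f : C -> C) (z : C) :
  holomorphic_near f z -> f z <> 0 -> locally z (fun w => f w <> 0).
Proof. by move=> /holo_continuous; apply: continuous_neq0. Qed.

Lemma holo_div (f g : C -> C) (z : C) : holomorphic_near f z ->
  holomorphic_near g z -> g z <> 0 -> holomorphic_near (fun w => f w / g w) z.
Proof.
move=> Hf Hg g0; apply: locally_imp2 (holo_neq0 Hg g0) (filter_and _ _ Hf Hg) => w gw [[a Ha] [b Hb]].
by eexists; apply: derive_div gw Ha Hb.
Qed.

Lemma holo_ext (f g : C -> C) (z : C) : locally z (fun w => f w = g w) ->
  holomorphic_near f z -> holomorphic_near g z.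
Proof.
move=> /locally_locally; apply: locally_imp2 => w Hw.
exact: ex_derive_ext_near.
Qed.

Lemma holo_shift (a z : C) : holomorphic_near (fun w => w - a) z.
Proof. exact: holo_minus (holo_id z) (holo_const a z). Qed.

Lemma holo_sum (I : Type) (s : seq I) (Q : pred I) (F : I -> C -> C) (z : C) :
  (forall i, Q i -> holomorphic_near (F i) z) ->
  holomorphic_near (fun w => \big[Cplus/RtoC 0]_(i <- s | Q i) F i w) z.
Proof.
move=> H; elim: s => [|i s IH].
  apply: holo_ext (holo_const 0 z).
  by apply: filter_forall => w; rewrite big_nil.
case Qi : (Q i).
  apply: holo_ext (holo_plus (H i Qi) IH).
  by apply: filter_forall => w; rewrite big_cons Qi.
apply: holo_ext IH.
by apply: filter_forall => w; rewrite big_cons Qi.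
Qed.

Lemma holo_prod (I : Type) (s : seq I) (Q : pred I) (F : I -> C -> C) (z : C) :
  (forall i, Q i -> holomorphic_near (F i) z) ->
  holomorphic_near (fun w => \big[Cmult/RtoC 1]_(i <- s | Q i) F i w) z.
Proof.
move=> H; elim: s => [|i s IH].
  apply: holo_ext (holo_const 1 z).
  by apply: filter_forall => w; rewrite big_nil.
case Qi : (Q i).
  apply: holo_ext (holo_mult (H i Qi) IH).
  by apply: filter_forall => w; rewrite big_cons Qi.
apply: holo_ext IH.
by apply: filter_forall => w; rewrite big_cons Qi.
Qed.

Lemma cprod_neq0 (I : Type) (s : seq I) (Q : pred I) (F : I -> C) :
  (forall i, Q i -> F i <> 0) -> \big[Cmult/RtoC 1]_(i <- s | Q i) F i <> 0.
Proof.
move=> H; apply: (big_ind (fun x : C => x <> RtoC 0)) => //; first by move=> /RtoC_inj; lra.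
exact: Cmult_neq_0.
Qed.

Lemma punctured_point (z : C) (P : C -> Prop) :
  locally z (fun w => w <> z -> P w) -> exists2 w, w <> z & P w.
Proof.
move=> /locally_Cmod [d d0 Hd].
have e : z + RtoC (d / 2) - z = RtoC (d / 2) by ring.
have m : Cmod (z + RtoC (d / 2) - z) = (d / 2)%R by rewrite e Cmod_R Rabs_pos_eq; lra.
have n : z + RtoC (d / 2) <> z.
  move=> h; have : Cmod (z + RtoC (d / 2) - z) = 0%R.
    rewrite h; have -> : z - z = 0 by ring.
    exact: Cmod_0.
  by rewrite m; lra.
exists (z + RtoC (d / 2)) => //; apply: Hd => //; rewrite m; lra.
Qed.

Lemma punctured_eq (f g : C -> C) (z : C) :
  holomorphic_near f z -> holomorphic_near g z ->
  locally z (fun w => w <> z -> f w = g w) -> f z = g z.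
Proof.
move=> Hf Hg H; apply: NNPP => n.
have := holo_neq0 (holo_minus Hf Hg) (Csub_neq0 n).
move=> H2; have H3 : locally z (fun w => w <> z -> False).
  apply: locally_imp2 H H2 => w h1 h2 wz; apply: h2; rewrite h1 //; ring.
by have [] := punctured_point H3.
Qed.

(** At each point z, S agrees off z with a holomorphic germ; the value of that
    germ at z is forced by continuity, and the germs at neighbouring points
    have the same values, so these values form an entire function. The last
    clause recovers S itself wherever S is already holomorphic. *)
Lemma holo_patch (S : C -> C) :
  (forall z, exists H, holomorphic_near H z /\ locally z (fun w => w <> z -> S w = H w)) ->
  exists G, entire G /\ forall z H, holomorphic_near H z ->
    locally z (fun w => w <> z -> S w = H w) -> G z = H z.
Proof.
move=> Hyp.
pose Hz z := proj1_sig (constructive_indefinite_description _ (Hyp z)).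
have HzP z : holomorphic_near (Hz z) z /\ locally z (fun w => w <> z -> S w = Hz z w).
  by rewrite /Hz; case: constructive_indefinite_description.
have uniq z H : holomorphic_near H z ->
    locally z (fun w => w <> z -> S w = H w) -> Hz z z = H z.
  move=> hH hS; have [h1 h2] := HzP z; apply: punctured_eq => //.
  by apply: locally_imp2 h2 hS => w e1 e2 wz; rewrite -e1 // e2.
exists (fun z => Hz z z); split=> // z.
have [h1 h2] := HzP z.
apply: (@ex_derive_ext_near (Hz z)); last exact: holo_ex_derive.
apply: locally_imp2 (locally_locally _ _ h1) (locally_locally _ _ h2) => w hw hSw.
symmetry; have [->|wz] := classic (w = z); first by [].
apply: uniq => //.
by apply: locally_imp2 (locally_neq wz) hSw => u uz hu _; apply: hu.
Qed.

Lemma RtoC_neq0 (x : R) : x <> 0%R -> RtoC x <> 0.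
Proof. by move=> n /RtoC_inj. Qed.

Lemma C2_neq0 : RtoC 2 <> 0.
Proof. by apply: RtoC_neq0; lra. Qed.

Ltac cfield := field; repeat split; try assumption; try exact: C2_neq0.

(** With L = F''/F' one has F''' / F' = L' + L^2; the quotients of higher
    derivatives never need to be expanded. *)
Lemma schwarzian_log (F F1 L : C -> C) (L1 z : C) :
  locally z (fun w => is_derive F w (F1 w)) ->
  locally z (fun w => is_derive F1 w (L w * F1 w)) ->
  is_derive L z L1 -> F1 z <> 0 ->
  schwarzian_formula F z = L1 - L z * L z / 2.
Proof.
move=> H1 H2 H3 n.
have E1 : locally z (fun w => C_derive F w = F1 w).
  by apply: locally_imp H1 => w; apply: is_C_derive_unique.
have E2 : locally z (fun w => C_derive (C_derive F) w = L w * F1 w).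
  apply: locally_imp2 H2 (locally_locally _ _ E1) => w h1 h2.
  exact: C_derive_ext_loc h2 h1.
have E3 : C_derive (C_derive (C_derive F)) z = L1 * F1 z + L z * (L z * F1 z).
  apply: C_derive_ext_loc E2 _; apply: derive_mult H3 _.
  exact: (locally_singleton _ _ H2).
rewrite /schwarzian_formula E3 (locally_singleton _ _ E2) (locally_singleton _ _ E1) /=.
by cfield.
Qed.

Definition dlog (f : C -> C) (z : C) : C := C_derive f z / f z.

Lemma schwarzian_dlog (F : C -> C) (z : C) :
  holomorphic_near F z -> C_derive F z <> 0 ->
  schwarzian_formula F z =
  C_derive (dlog (C_derive F)) z - dlog (C_derive F) z * dlog (C_derive F) z / 2.
Proof.
move=> HF n; have H1 := holo_C_derive HF; have H2 := holo_C_derive H1.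
apply: (@schwarzian_log _ (C_derive F)) => //.
- by apply: locally_imp HF => w; apply: derive_C_derive.
- apply: locally_imp2 H1 (holo_neq0 H1 n) => w h1 nw.
  by apply: is_derive_eq (derive_C_derive h1) _; rewrite /dlog; field.
- by apply: derive_C_derive; apply: holo_ex_derive; apply: holo_div.
Qed.

Lemma holo_dlog (f : C -> C) (z : C) :
  holomorphic_near f z -> f z <> 0 -> holomorphic_near (dlog f) z.
Proof. by move=> Hf n; apply: holo_div => //; apply: holo_C_derive. Qed.

Lemma holo_schwarzian (F : C -> C) (z : C) :
  holomorphic_near F z -> C_derive F z <> 0 ->
  holomorphic_near (schwarzian_formula F) z.
Proof.
move=> HF n; have H1 := holo_C_derive HF.
have HL := holo_dlog H1 n.
apply: (@holo_ext (fun w => C_derive (dlog (C_derive F)) w -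
   dlog (C_derive F) w * dlog (C_derive F) w / 2)).
  apply: locally_imp2 (locally_locally _ _ HF) (holo_neq0 H1 n) => w h1 h2.
  by rewrite schwarzian_dlog.
apply: holo_minus; first exact: holo_C_derive.
by apply: holo_div; [apply: holo_mult | apply: holo_const | apply: C2_neq0].
Qed.

Lemma schwarzian_ext (f g : C -> C) (z : C) : holomorphic_near g z ->
  C_derive g z <> 0 ->
  locally z (fun w => f w = g w) -> schwarzian_formula f z = schwarzian_formula g z.
Proof.
move=> Hg n E; rewrite (schwarzian_dlog Hg n).
have H1 := holo_C_derive Hg; have HL := holo_dlog H1 n.
apply: (@schwarzian_log _ (C_derive g)) => //.
- apply: locally_imp2 Hg (locally_locally _ _ E) => w h1 h2.
  apply: derive_ext_loc (derive_C_derive h1).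
  by apply: locally_imp h2.
- apply: locally_imp2 H1 (holo_neq0 H1 n) => w h1 nw.
  by apply: is_derive_eq (derive_C_derive h1) _; rewrite /dlog; field.
- by apply: derive_C_derive; apply: holo_ex_derive.
Qed.

(** Passing from F to 1/F changes L = F''/F' into L - 2 F'/F, and L' - L^2/2
    is unchanged since F'' = L F'. Hence the Schwarzian of a map to the sphere
    may be computed in either coordinate. *)
Lemma schwarzian_inv (f : C -> C) (z : C) : holomorphic_near f z ->
  f z <> 0 -> C_derive f z <> 0 ->
  schwarzian_formula (fun w => / f w) z = schwarzian_formula f z.
Proof.
move=> Hf f0 n; rewrite (schwarzian_dlog Hf n).
have H1 := holo_C_derive Hf; have HL := holo_dlog H1 n.
set L := dlog (C_derive f) in HL *.
have n0 := holo_neq0 Hf f0; have n1 := holo_neq0 H1 n.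
pose F1 w := - C_derive f w / (f w * f w).
pose L2 w := L w - 2 * (C_derive f w / f w).
have d1 := derive_C_derive (holo_ex_derive Hf).
have d2 := derive_C_derive (holo_ex_derive H1).
have d3 := derive_C_derive (holo_ex_derive HL).
have d4 := derive_minus d3 (derive_mult (derive_const 2 z) (derive_div f0 d2 d1)).
rewrite (@schwarzian_log _ F1 L2 _ z _ _ d4) /=.
- have E : C_derive (C_derive f) z = L z * C_derive f z by rewrite /L /dlog; field.
  rewrite E /L2; cfield.
- by apply: locally_imp2 Hf n0 => w h1 h2; apply: derive_inv => //; apply: derive_C_derive.
- apply: locally_imp2 (filter_and _ _ Hf H1) (filter_and _ _ n0 n1) => w [h1 h2] [m0 m1].
  have e1 := derive_C_derive h1; have e2 := derive_C_derive h2.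
  have mm : f w * f w <> 0 by apply: Cmult_neq_0.
  apply: is_derive_eq (@derive_div (fun u => - C_derive f u) (fun u => f u * f u) w _ _ mm (derive_opp e2) (derive_mult e1 e1)) _.
  by rewrite /L2 /F1 /L /dlog; field.
- rewrite /F1 => E; apply: n.
  have -> : C_derive f z = - (- C_derive f z / (f z * f z)) * (f z * f z) by field.
  by rewrite E; ring.
Qed.

(** The left-hand side is L' - L^2/2 for L = 1/(w-c) + m. The finite part of
    the right-hand side at c is determined by the residue: -m' from the cross
    term m/(w-c) cancels the derivative m', and only -m(c)^2/2 is left. This
    is the condition for the absence of logarithms at c. *)
Lemma log_normal (m : C -> C) (c : C) : holomorphic_near m c ->
  exists H, holomorphic_near H c /\ forall w, w <> c ->
    (- / ((w - c) * (w - c)) + C_derive m w) - (/ (w - c) + m w) * (/ (w - c) + m w) / 2 =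
    - (3 / 2) * (1 / (w - c) ^ 2) + (- m c) / (w - c) - (m c) ^ 2 / 2 + (w - c) * H w.
Proof.
move=> Hm; have [n [En dn Hn _]] := holo_factor Hm.
have Hm' := holo_C_derive Hm.
pose K w := C_derive m w - m w * m w / 2 - n w.
have HK : holomorphic_near K c.
  apply: holo_minus => //; apply: holo_minus => //.
  by apply: holo_div; [apply: holo_mult | apply: holo_const | apply: C2_neq0].
have [H [EH _ HH _]] := holo_factor HK.
exists H; split=> // w /Csub_neq0 wc.
have Kc : K c = - (m c * m c / 2).
  by rewrite /K (is_C_derive_unique _ _ _ dn); cfield.
have -> : (w - c) * H w = K w - K c by rewrite (EH w); ring.
rewrite Kc /K; have -> : n w = (m w - m c) / (w - c) by rewrite (En w); field.
by rewrite /=; cfield.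
Qed.

(** * Functions with the local expansions of a Schwarzian *)

Section NormalForm.
Variables (k : nat) (c : 'I_k -> C) (r : 'I_k -> C).
Hypothesis hc : injective c.

Definition off_points (z : C) : Prop := forall i, z <> c i.

Lemma near_off_points (z : C) : off_points z -> locally z off_points.
Proof.
move=> hz.
have H (s : seq 'I_k) : locally z (fun w => forall i, i \in s -> w <> c i).
  elim: s => [|i s IH]; first by apply: filter_forall.
  apply: locally_imp2 IH (locally_neq (hz i)) => w h1 h2 j.
  by rewrite in_cons => /orP [/eqP -> //|]; apply: h1.
by apply: locally_imp (H (index_enum 'I_k)) => w h i; apply: h; rewrite mem_index_enum.
Qed.

Lemma near_point_off (i : 'I_k) : locally (c i) (fun w => w <> c i -> off_points w).
Proof.
have H (s : seq 'I_k) : locally (c i) (fun w => forall j, j \in s -> j != i -> w <> c j).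
  elim: s => [|j s IH]; first by apply: filter_forall.
  have [->|ji] := eqVneq j i.
    apply: locally_imp IH => w h1 j'; rewrite in_cons => /orP [/eqP -> |]; first by rewrite eqxx.
    exact: h1.
  have n : c i <> c j by move=> /hc e; rewrite e eqxx in ji.
  apply: locally_imp2 IH (locally_neq n) => w h1 h2 j'.
  by rewrite in_cons => /orP [/eqP -> //|]; apply: h1.
apply: locally_imp (H (index_enum 'I_k)) => w h wi j.
have [->//|ji] := eqVneq j i.
by apply: h => //; rewrite mem_index_enum.
Qed.

Lemma entire_e_fun i : entire (e_fun c i).
Proof.
move=> z; apply: holo_ex_derive; apply: (holo_prod _ (F := fun j w => (w - c j) / (c i - c j))) => j ji.
apply: holo_div; [exact: holo_shift | exact: holo_const |].
by apply: Csub_neq0 => /hc e; rewrite e eqxx in ji.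
Qed.

Lemma e_fun_diag i : e_fun c i (c i) = 1.
Proof.
rewrite /e_fun big1 // => j ji; field.
by apply: Csub_neq0 => /hc e; rewrite e eqxx in ji.
Qed.

Lemma e_fun_other i j : j != i -> e_fun c j (c i) = 0.
Proof.
move=> ji; rewrite /e_fun (bigD1 i) /=; last by rewrite eq_sym.
have -> : (c i - c i) / (c j - c i) = 0 by rewrite /Cdiv /Cminus Cplus_opp_r Cmult_0_l.
exact: Cmult_0_l.
Qed.

Lemma holo_entire (f : C -> C) z : entire f -> holomorphic_near f z.
Proof. by move=> H; apply: filter_forall. Qed.

Let term (i : 'I_k) (z : C) : C :=
  - (3 / 2) * (1 / (z - c i) ^ 2) + r i / (z - c i)
     + (- (1 / 2) * (r i) ^ 2 - v_coef c r i) * e_fun c i z.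

Lemma holo_pole_terms i z : z <> c i ->
  holomorphic_near (fun w => - (3 / 2) * (1 / (w - c i) ^ 2) + r i / (w - c i)) z.
Proof.
move=> /Csub_neq0 zi; have Hs := holo_shift (c i) z.
apply: holo_plus.
  apply: holo_mult; first exact: holo_const.
  apply: holo_div; first exact: holo_const.
    exact: (holo_mult Hs (holo_mult Hs (holo_const _ z))).
  by rewrite /=; apply: Cmult_neq_0 => //; apply: Cmult_neq_0 => //; apply: RtoC_neq0; lra.
by apply: holo_div => //; apply: holo_const.
Qed.

Lemma holo_term i z : z <> c i -> holomorphic_near (term i) z.
Proof.
move=> zi; apply: holo_plus; first exact: holo_pole_terms.
by apply: holo_mult; [exact: holo_const | apply: holo_entire; apply: entire_e_fun].
Qed.

(** At c i the terms of index j <> i contribute v_coef c r i to the finite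
    part, and e_fun is 1 at its own point and 0 at the others. Hence the
    coefficients of the e_fun are those that give the sum the finite part
    -(r_i)^2/2 at each c i. The difference with S then vanishes at each c i
    and is divisible by the product of the z - c i. *)
Theorem schwarzian_normal_form (S : C -> C) :
  (forall z, off_points z -> holomorphic_near S z) ->
  (forall i, exists H, holomorphic_near H (c i) /\
     locally (c i) (fun w => w <> c i -> S w =
       - (3 / 2) * (1 / (w - c i) ^ 2) + r i / (w - c i) - (r i) ^ 2 / 2
        + (w - c i) * H w)) ->
  exists G, entire G /\ forall z, off_points z -> S z = psi_fun c r G z.
Proof.
move=> H1 H2.
pose Pr w := \big[Cmult/RtoC 1]_(i < k) (w - c i).
pose T w := \big[Cplus/RtoC 0]_(i < k) term i w.
pose G0 w := (S w - T w) / Pr w.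
have Prn w : off_points w -> Pr w <> 0.
  by move=> hw; apply: cprod_neq0 => i _; apply: Csub_neq0.
have HPr z : holomorphic_near Pr z.
  by apply: (holo_prod _ (F := fun j w => w - c j)) => i _; apply: holo_shift.
have hG0 z : off_points z -> holomorphic_near G0 z.
  move=> hz; apply: holo_div => //; last exact: Prn.
  by apply: holo_minus; [exact: H1 | apply: (holo_sum _ (F := term)) => i _; apply: holo_term].
have [|G [GE GH]] := @holo_patch G0.
  move=> z; have [hz|nz] := classic (off_points z).
    by exists G0; split; [exact: hG0 | exact: filter_forall].
  have [i ->] : exists i, z = c i.
    by apply: NNPP => n; apply: nz => i e; apply: n; exists i.
  have [H [HH EH]] := H2 i.
  pose T' w := \big[Cplus/RtoC 0]_(j < k | j != i) term j w.
  pose Pr' w := \big[Cmult/RtoC 1]_(j < k | j != i) (w - c j).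
  (* Coefficient of e_fun c i in psi; N is S minus all the explicit terms,
     after the poles at c i have cancelled. *)
  pose bet := - (1 / 2) * (r i) ^ 2 - v_coef c r i.
  pose N w := - ((r i) ^ 2 / 2) + (w - c i) * H w - bet * e_fun c i w - T' w.
  have cij j : j != i -> c i <> c j by move=> ji /hc e; rewrite e eqxx in ji.
  have HN : holomorphic_near N (c i).
    apply: holo_minus; last by apply: (holo_sum _ (F := term)) => j ji; apply: holo_term; apply: cij.
    apply: holo_minus; last first.
      by apply: holo_mult; [exact: holo_const | apply: holo_entire; apply: entire_e_fun].
    apply: holo_plus; first exact: holo_const.
    by apply: holo_mult => //; apply: holo_shift.
  have T'c : T' (c i) = v_coef c r i.
    rewrite /T' /v_coef; apply: eq_bigr => j ji.
    by rewrite /term (e_fun_other ji); ring.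
  have Nc : N (c i) = 0.
    rewrite /N T'c e_fun_diag /bet /=; field; exact: C2_neq0.
  have [N1 [EN1 _ HN1 _]] := holo_factor HN.
  have HPr' : holomorphic_near Pr' (c i).
    by apply: (holo_prod _ (F := fun j w => w - c j)) => j _; apply: holo_shift.
  have Pr'n w : (forall j, j != i -> w <> c j) -> Pr' w <> 0.
    by move=> hw; apply: cprod_neq0 => j ji; apply: Csub_neq0; apply: hw.
  exists (fun w => N1 w / Pr' w); split.
    by apply: holo_div => //; apply: Pr'n.
  apply: locally_imp2 EH (near_point_off i) => w hw hoff wi.
  have {}hw := hw wi; have {}hoff := hoff wi.
  have wc := Csub_neq0 wi.
  have -> : N1 w = N w / (w - c i) by rewrite (EN1 w) Nc; field.
  have EPr : Pr w = (w - c i) * Pr' w by rewrite /Pr (bigD1 i).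
  have ET : T w = term i w + T' w by rewrite /T (bigD1 i).
  have Pr'w : Pr' w <> 0 by apply: Pr'n => j _.
  rewrite /G0 EPr ET hw /N /term -/bet /=; set e := e_fun c i w; set t := T' w.
  by cfield.
exists G; split=> // z hz.
have -> : psi_fun c r G z = T z + G z * Pr z by [].
have gz : locally z (fun w => w <> z -> G0 w = G0 w) by apply: filter_forall.
rewrite (GH z G0 (hG0 z hz) gz).
by rewrite /G0; field; apply: Prn.
Qed.
End NormalForm.

(** * Realizing a prescribed Schwarzian *)

Lemma derive_shift (a z : C) : is_derive (fun w => w - a) z (RtoC 1).
Proof. by apply: is_derive_eq (derive_minus (derive_id _) (derive_const a z)) _; ring. Qed.

Lemma local_degree_ge2 (f : C -> sphere) (z : C) (d : nat) : (2 <= d)%N ->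
  has_local_degree f z d -> is_derive (fun w => coord (f z) (f w)) z (RtoC 0).
Proof.
case: d => [|[|e]] // _ [_ [h [Hh _ E]]].
have [b Hb] : ex_derive (fun w => (w - z) ^ e) z.
  have [l Hl] := ex_derive_pow e (z - z).
  by exists (1 * l); apply: (@derive_comp (fun v => v ^ e) (fun w => w - z) _ _ _ Hl (derive_shift z z)).
have [a Ha] := holo_ex_derive Hh.
have s1 := derive_shift z z.
have d1 := derive_mult s1 (derive_mult s1 (derive_mult Hb Ha)).
have d2 := derive_plus d1 (derive_const (coord (f z) (f z)) z).
apply: (@derive_ext_loc (fun w => (w - z) * ((w - z) * ((w - z) ^ e * h w)) + coord (f z) (f z))).
  apply: locally_imp E => w E.
  have -> : coord (f z) (f w) = (coord (f z) (f w) - coord (f z) (f z)) + coord (f z) (f z) by ring.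
  by rewrite E /=; ring.
apply: is_derive_eq d2 _; ring.
Qed.

(** Dividing g twice by w - z gives h; comparing the derivatives at z of the
    two expressions of g' yields q z = 2 h z. *)
Lemma double_point_degree (g q : C -> C) (z : C) :
  holomorphic_near g z -> holomorphic_near q z -> q z <> 0 ->
  locally z (fun w => C_derive g w = (w - z) * q w) ->
  exists h, [/\ holomorphic_near h z, h z <> 0 &
    locally z (fun w => g w - g z = (w - z) ^ 2 * h w)].
Proof.
move=> Hg Hq n E; have [p [Ep dp Hp _]] := holo_factor Hg.
have p0 : p z = 0.
  by rewrite -(is_C_derive_unique _ _ _ dp) (locally_singleton _ _ E); ring.
have [h [Eh dh Hh _]] := holo_factor Hp.
have Eg w : g w = g z + (w - z) * ((w - z) * h w) by rewrite (Ep w) (Eh w) p0; ring.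
exists h; split=> //; last by apply: filter_forall => w; rewrite Eg /=; ring.
move=> hz; apply: n.
have Hh' := holo_C_derive Hh.
have [a Ha] := holo_ex_derive Hh'; have [b Hb] := holo_ex_derive Hq.
have [e He] := holo_ex_derive Hh.
have s1 := derive_shift z z.
have d1 := derive_mult s1 Hb.
have d2 := derive_mult s1 (derive_plus (derive_mult (derive_const 2 z) He) (derive_mult s1 Ha)).
have E2 : locally z (fun w => (w - z) * (2 * h w + (w - z) * C_derive h w) = (w - z) * q w).
  apply: locally_imp2 E Hh => w <- hw; symmetry; apply: is_C_derive_unique.
  have t1 := derive_shift z w.
  have d3 := derive_plus (derive_const (g z) w) (derive_mult t1 (derive_mult t1 (derive_C_derive hw))).
  apply: derive_ext_loc (filter_forall _ (fun w => esym (Eg w))) _.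
  by apply: is_derive_eq d3 _; ring.
have := derive_unique (derive_ext_loc E2 d2) d1.
rewrite hz => H; have -> : q z = 1 * q z + (z - z) * b by ring.
by rewrite -H; ring.
Qed.

Lemma crit_poly_derive (k : nat) (c : 'I_k -> C) (z : C) : off_points c z ->
  is_derive (fun w => \big[Cmult/RtoC 1]_(i < k) (w - c i)) z
   (\big[Cmult/RtoC 1]_(i < k) (z - c i) * \big[Cplus/RtoC 0]_(i < k) (1 / (z - c i))).
Proof.
move=> hz.
elim: (index_enum _) => [|i s IH].
  apply: derive_ext_loc (filter_forall _ (fun w => esym (big_nil _ _ _ _))) _.
  by apply: is_derive_eq (derive_const 1 z) _; rewrite !big_nil; ring.
apply: derive_ext_loc (filter_forall _ (fun w => esym (big_cons _ _ _ _ _ _))) _.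
apply: is_derive_eq (derive_mult (derive_shift (c i) z) IH) _.
by rewrite !big_cons /=; field; apply: Csub_neq0.
Qed.

Section Construction.
Variables (k : nat) (c : 'I_k -> C) (r : 'I_k -> C) (G : C -> C).
Hypothesis hc : injective c.
Hypothesis HG : entire G.

Let Pr w := \big[Cmult/RtoC 1]_(i < k) (w - c i).
Let Lam w := \big[Cplus/RtoC 0]_(i < k) (1 / (w - c i)).
Let pc i := \big[Cplus/RtoC 0]_(j < k | j != i) (1 / (c i - c j)).
Let a w := \big[Cplus/RtoC 0]_(i < k) ((r i + pc i) / 2 * e_fun c i w).
Let L w := Lam w - 2 * a w.
Let S0 w := C_derive L w - L w * L w / 2.

Lemma distinct_points i j : j != i -> c i <> c j.
Proof. by move=> ji /hc e; rewrite e eqxx in ji. Qed.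

Lemma crit_poly_holo z : holomorphic_near Pr z.
Proof. by apply: (holo_prod _ (F := fun j w => w - c j)) => i _; apply: holo_shift. Qed.

Lemma crit_poly_neq0 z : off_points c z -> Pr z <> 0.
Proof. by move=> hz; apply: cprod_neq0 => i _; apply: Csub_neq0. Qed.

Lemma simple_pole_holo i z : z <> c i -> holomorphic_near (fun w => 1 / (w - c i)) z.
Proof.
by move=> /Csub_neq0 h; apply: holo_div => //; [apply: holo_const | apply: holo_shift].
Qed.

Lemma interpolant_holo z : holomorphic_near a z.
Proof.
apply: (holo_sum _ (F := fun i w => (r i + pc i) / 2 * e_fun c i w)) => i _.
by apply: holo_mult; [exact: holo_const | apply: holo_entire; apply: entire_e_fun].
Qed.

Lemma interpolant_at i : a (c i) = (r i + pc i) / 2.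
Proof.
rewrite /a (bigD1 i) //= e_fun_diag // big1 => [|j ji]; first by ring.
by rewrite e_fun_other //; ring.
Qed.

Lemma model_dlog_holo z : off_points c z -> holomorphic_near L z.
Proof.
move=> hz; apply: holo_minus.
  by apply: (holo_sum _ (F := fun i w => 1 / (w - c i))) => i _; apply: simple_pole_holo.
by apply: holo_mult; [exact: holo_const | exact: interpolant_holo].
Qed.

(** At c i, the logarithmic derivative of Pr is 1/(w - c i) plus a function
    with value pc i, so L = 1/(w - c i) + m with m (c i) = pc i - 2 a (c i) =
    -r_i. *)
Lemma model_schwarzian_form : exists G1, entire G1 /\ forall z, off_points c z -> S0 z = psi_fun c r G1 z.
Proof.
apply: schwarzian_normal_form => // [z hz|i].
  have HL := model_dlog_holo hz.
  apply: holo_minus; first exact: holo_C_derive.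
  by apply: holo_div; [apply: holo_mult | apply: holo_const | apply: C2_neq0].
pose m w := \big[Cplus/RtoC 0]_(j < k | j != i) (1 / (w - c j)) - 2 * a w.
have Hm : holomorphic_near m (c i).
  apply: holo_minus.
    apply: (holo_sum _ (F := fun i w => 1 / (w - c i))) => j ji.
    by apply: simple_pole_holo; apply: distinct_points.
  by apply: holo_mult; [exact: holo_const | exact: interpolant_holo].
have mc : - m (c i) = r i.
  by rewrite /m interpolant_at -/(pc i); field; apply: C2_neq0.
have [H [HH EH]] := log_normal Hm.
exists H; split=> //.
apply: locally_imp Hm => w hw wi.
have := EH w wi; rewrite mc.
have -> : m (c i) ^ 2 = r i ^ 2 by rewrite -mc /=; ring.
move=> <-.
have EL u : L u = 1 / (u - c i) + m u by rewrite /L /Lam (bigD1 i) //= /m /Cminus Cplus_assoc.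
have wc := Csub_neq0 wi.
have dL : C_derive L w = - / ((w - c i) * (w - c i)) + C_derive m w.
  apply: is_C_derive_unique.
  apply: derive_ext_loc (filter_forall _ (fun u => esym (EL u))) _.
  apply: is_derive_eq (derive_plus (@derive_div (fun _ => RtoC 1) (fun u => u - c i) w _ _ wc (derive_const 1 w) (derive_shift (c i) w)) (derive_C_derive hw)) _.
  by field.
rewrite /S0 dL EL; congr (_ - _ * _ / _); rewrite /Cdiv; ring.
Qed.

(** The system u' = a u + Pr w, w' = - b u - a w has trace 0 and its solutions
    satisfy (u1/u2)' = Pr/u2^2. For f = u1/u2 the logarithmic derivative of f'
    is L - 2 X with X = Pr w2/u2, and X' = X L - Pr b - X^2, so its Schwarzian
    is S0 + 2 Pr b. *)
Theorem schwarzian_realized : exists f : C -> sphere,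
  [/\ meromorphic f, simple_critical_points_at f c & is_schwarzian f (psi_fun c r G)].
Proof.
have [G1 [HG1 ES]] := model_schwarzian_form.
have two0 := C2_neq0.
pose b w := (G w - G1 w) / 2.
have Hb : entire b.
  move=> z; have [x Hx] := HG z; have [y Hy] := HG1 z.
  by eexists; apply: derive_div two0 (derive_minus Hx Hy) (derive_const 2 z).
have Epsi z : off_points c z -> psi_fun c r G z = S0 z + 2 * Pr z * b z.
  move=> hz; rewrite (ES z hz) /psi_fun -/(Pr z) /b; field => //.
have Ha : entire a by move=> z; apply: holo_ex_derive; apply: interpolant_holo.
have HPr : entire Pr by move=> z; apply: holo_ex_derive; apply: crit_poly_holo.
have Hb' : entire (fun z => - b z).
  by move=> z; have [x Hx] := Hb z; eexists; apply: derive_opp Hx.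
have Ha' : entire (fun z => - a z).
  by move=> z; have [x Hx] := Ha z; eexists; apply: derive_opp Hx.
have [u1 [w1 [du1 dw1 u10 w10]]] := entire_linear_system 0 1 Ha HPr Hb' Ha'.
have [u2 [w2 [du2 dw2 u20 w20]]] := entire_linear_system 1 0 Ha HPr Hb' Ha'.
have Hu1 z : holomorphic_near u1 z by apply: holo_entire => w; eexists; apply: du1.
have Hu2 z : holomorphic_near u2 z by apply: holo_entire => w; eexists; apply: du2.
(* The determinant of the two solutions: the trace of the system is 0. *)
have Wr z : w1 z * u2 z - u1 z * w2 z = 1.
  have dW v : is_derive (fun z => w1 z * u2 z - u1 z * w2 z) v (RtoC 0).
    apply: is_derive_eq (derive_minus (derive_mult (dw1 v) (du2 v)) (derive_mult (du1 v) (dw2 v))) _.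
    ring.
  by rewrite (entire_derive0_const dW z) u10 w10 u20 w20; ring.
have u1n z : u2 z = 0 -> u1 z <> 0.
  move=> e1 e2; have := Wr z; rewrite e1 e2 => h.
  by apply: (RtoC_neq0 R1_neq_R0); rewrite -h; ring.
pose f z := if excluded_middle_informative (u2 z = 0) then Infty else Fin (u1 z / u2 z).
have fI z : u2 z = 0 -> f z = Infty by rewrite /f; case: excluded_middle_informative.
have fF z : u2 z <> 0 -> f z = Fin (u1 z / u2 z).
  by rewrite /f; case: excluded_middle_informative.
pose g z w := coord (f z) (f w).
(* The coordinate of f around f z is u1/u2, or u2/u1 at a pole; in both
   cases its derivative is Pr times a nonvanishing function. *)
have loc z : exists2 v : C -> C, holomorphic_near v z /\ v z <> 0 &
   [/\ locally z (fun w => coord_dom (f z) (f w)), holomorphic_near (g z) z &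
       locally z (fun w => C_derive (g z) w = Pr w * v w)].
  have [e|n] := classic (u2 z = 0).
    have n1 := u1n z e; have near1 := holo_neq0 (Hu1 z) n1.
    have Eg w : u1 w <> 0 -> g z w = u2 w / u1 w.
      rewrite /g (fI z e) => h /=; have [e2|h2] := classic (u2 w = 0).
        by rewrite (fI w e2) e2 /=; field.
      by rewrite (fF w h2) /=; field.
    exists (fun w => - 1 / (u1 w * u1 w)).
      split.
        by apply: holo_div; [exact: holo_const | exact: holo_mult | exact: Cmult_neq_0].
      move=> h; have : - 1 / (u1 z * u1 z) * (u1 z * u1 z) = - 1 by field.
      rewrite h Cmult_0_l => h2; apply: (RtoC_neq0 R1_neq_R0).
      have e1 : RtoC 1 = - - 1 by ring.
      by rewrite [LHS]e1 -h2; ring.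
    split.
    - apply: locally_imp near1 => w h; rewrite (fI z e) /=.
      have [e2|h2] := classic (u2 w = 0); first by rewrite (fI w e2).
      rewrite (fF w h2) => /(f_equal coord_fin) /= h3; apply: h.
      have -> : u1 w = u1 w / u2 w * u2 w by field.
      by rewrite h3; ring.
    - apply: (@holo_ext (fun w => u2 w / u1 w)); last exact: holo_div.
      by apply: locally_imp near1 => w h; rewrite Eg.
    - apply: locally_imp2 near1 (locally_locally _ _ near1) => w h hl.
      apply: is_C_derive_unique; apply: (@derive_ext_loc (fun w => u2 w / u1 w)).
        by apply: locally_imp hl => u hu; rewrite Eg.
      apply: is_derive_eq (derive_div h (du2 w) (du1 w)) _.
      have -> : (a w * u2 w + Pr w * w2 w) * u1 w - u2 w * (a w * u1 w + Pr w * w1 w) =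
         - (Pr w * (w1 w * u2 w - u1 w * w2 w)) by ring.
      by rewrite Wr; field.
  have near2 := holo_neq0 (Hu2 z) n.
  have Eg w : u2 w <> 0 -> g z w = u1 w / u2 w by rewrite /g (fF z n) => h /=; rewrite (fF w h).
  exists (fun w => 1 / (u2 w * u2 w)).
    split.
      by apply: holo_div; [exact: holo_const | exact: holo_mult | exact: Cmult_neq_0].
    move=> h; have : 1 / (u2 z * u2 z) * (u2 z * u2 z) = 1 by field.
    by rewrite h Cmult_0_l => h2; apply: (RtoC_neq0 R1_neq_R0); rewrite -h2.
  split.
  - by apply: locally_imp near2 => w h; rewrite (fF z n) (fF w h).
  - apply: (@holo_ext (fun w => u1 w / u2 w)); last exact: holo_div.
    by apply: locally_imp near2 => w h; rewrite Eg.
  - apply: locally_imp2 near2 (locally_locally _ _ near2) => w h hl.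
    apply: is_C_derive_unique; apply: (@derive_ext_loc (fun w => u1 w / u2 w)).
      by apply: locally_imp hl => u hu; rewrite Eg.
    apply: is_derive_eq (derive_div h (du1 w) (du2 w)) _.
    have -> : (a w * u1 w + Pr w * w1 w) * u2 w - u1 w * (a w * u2 w + Pr w * w2 w) =
         Pr w * (w1 w * u2 w - u1 w * w2 w) by ring.
    by rewrite Wr; field.
have deg2 i : has_local_degree f (c i) 2.
  have [v [Hv vn] [_ Hg Eg]] := loc (c i).
  pose Pr' w := \big[Cmult/RtoC 1]_(j < k | j != i) (w - c j).
  have HPr' : holomorphic_near Pr' (c i).
    by apply: (holo_prod _ (F := fun j w => w - c j)) => j _; apply: holo_shift.
  have Pr'n : Pr' (c i) <> 0.
    by apply: cprod_neq0 => j ji; apply: Csub_neq0; apply: distinct_points.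
  split=> //; apply: (@double_point_degree (g (c i)) (fun w => Pr' w * v w)) => //.
  - exact: holo_mult.
  - exact: Cmult_neq_0.
  - by apply: locally_imp Eg => w ->; rewrite /Pr (bigD1 i) //= -/(Pr' w); ring.
have crit z : critical_point f z <-> exists i, z = c i.
  split=> [[d d2 hd]|[i ->]]; last by exists 2%N => //; apply: deg2.
  apply: NNPP => n.
  have hz : off_points c z by move=> i e; apply: n; exists i.
  have [v [Hv vn] [_ Hg Eg]] := loc z.
  have := is_C_derive_unique _ _ _ (local_degree_ge2 d2 hd).
  rewrite -/(g z) (locally_singleton _ _ Eg).
  by apply: Cmult_neq_0 => //; apply: crit_poly_neq0.
exists f; split.
- split=> [z|]; first by have [v _ [h1 h2 _]] := loc z.
  exists 0; rewrite fF u20; first by [].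
  by apply: RtoC_neq0; lra.
- by split.
have Sfin z : off_points c z -> u2 z <> 0 ->
    schwarzian_formula (fun w => coord_fin (f w)) z = psi_fun c r G z.
  move=> hz n; have near2 := holo_neq0 (Hu2 z) n.
  pose X w := Pr w * w2 w / u2 w.
  have dPr w : off_points c w -> is_derive Pr w (Pr w * Lam w) := @crit_poly_derive k c w.
  have dX := derive_div n (derive_mult (dPr z hz) (dw2 z)) (du2 z).
  have HL := model_dlog_holo hz.
  have dL := derive_minus (derive_C_derive (holo_ex_derive HL)) (derive_mult (derive_const 2 z) dX).
  rewrite (@schwarzian_log _ (fun w => Pr w / (u2 w * u2 w)) (fun w => L w - 2 * X w) _ z _ _ dL).
  - by rewrite Epsi // /S0 /X /L; field.
  - apply: locally_imp2 near2 (locally_locally _ _ near2) => w h hl.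
    apply: (@derive_ext_loc (fun w => u1 w / u2 w)).
      by apply: locally_imp hl => u hu; rewrite (fF u hu).
    apply: is_derive_eq (derive_div h (du1 w) (du2 w)) _.
    have -> : (a w * u1 w + Pr w * w1 w) * u2 w - u1 w * (a w * u2 w + Pr w * w2 w) =
         Pr w * (w1 w * u2 w - u1 w * w2 w) by ring.
    by rewrite Wr; field.
  - apply: locally_imp2 near2 (near_off_points hz) => w h hw.
    have uu : u2 w * u2 w <> 0 by apply: Cmult_neq_0.
    apply: is_derive_eq (@derive_div Pr (fun v => u2 v * u2 v) w _ _ uu (dPr w hw) (derive_mult (du2 w) (du2 w))) _.
    by rewrite /L /X; field.
  - have uu : u2 z * u2 z <> 0 by apply: Cmult_neq_0.
    move=> E; apply: (crit_poly_neq0 hz).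
    have -> : Pr z = Pr z / (u2 z * u2 z) * (u2 z * u2 z) by field.
    by rewrite E; ring.
move=> z nc.
have hz : off_points c z by move=> i e; apply: nc; apply/crit; exists i.
rewrite /is_schwarzian_at.
have [e|n] := classic (u2 z = 0); last by rewrite (fF z n); apply: Sfin.
rewrite (fI z e).
have Hpsi : holomorphic_near (fun w => S0 w + 2 * Pr w * b w) z.
  have HL := model_dlog_holo hz.
  apply: holo_plus.
    apply: holo_minus; first exact: holo_C_derive.
    by apply: holo_div => //; [apply: holo_mult | apply: holo_const].
  apply: holo_mult; last exact: holo_entire.
  by apply: holo_mult; [exact: holo_const | exact: crit_poly_holo].
rewrite (Epsi z hz).
apply: (filterlim_ext_loc (fun w => S0 w + 2 * Pr w * b w)); last first.
  by apply: filterlim_filter_le_1 (holo_continuous Hpsi); apply: filter_le_within.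
(* A zero of u2 off the points c i is simple, hence isolated: the formula is
   available at all nearby points, and psi is continuous at z. *)
have [q [Eq dq Hq _]] := holo_factor (Hu2 z).
have qz : q z <> 0.
  rewrite -(is_C_derive_unique _ _ _ dq) (is_C_derive_unique _ _ _ (du2 z)) e.
  have -> : a z * 0 + Pr z * w2 z = Pr z * w2 z by ring.
  apply: Cmult_neq_0; first exact: crit_poly_neq0.
  move=> h; have := Wr z; rewrite e h => h2.
  by apply: (RtoC_neq0 R1_neq_R0); rewrite -h2; ring.
apply: locally_imp2 (near_off_points hz) (holo_neq0 Hq qz) => w hw qw wz.
rewrite Sfin //; first by rewrite Epsi.
rewrite (Eq w) e Cplus_0_l; apply: Cmult_neq_0 => //.
exact: Csub_neq0.
Qed.
End Construction.

(** * The Schwarzian of a given map *)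

Lemma expands_order (d : nat) : forall (f : C -> C) (z : C) (r M : R) (a : nat -> C),
  0 < r -> holomorphic_near f z -> expands (fun u => f (z + u)) r M a ->
  (forall n, (n < d)%N -> a n = 0) ->
  exists h, [/\ holomorphic_near h z, h z = a d & forall w, f w = (w - z) ^ d * h w].
Proof.
elim: d => [|d IH] f z r M a r0 Hf He H0.
  exists f; split=> //; last by move=> w /=; ring.
  by rewrite -(expands_at0 r0 He); congr f; ring.
have [q [Eq dq Hq _]] := holo_factor Hf.
have fz : f z = 0.
  have := expands_at0 r0 He; rewrite (H0 0%N) // => <-; congr f; ring.
have a1 : q z = a 1%N.
  exact: derive_unique dq (derive_untranslate (expands_derive r0 He)).
have He' : expands (fun u => q (z + u)) r (M / r) (fun n => a (S n)).
  apply: (expands_shift r0 He) => [w _|].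
    by rewrite (Eq (z + w)) fz (H0 0%N) //; ring.
  by rewrite -a1; congr q; ring.
have [h [Hh hz Eh]] := IH q z r _ _ r0 Hq He' (fun n nd => H0 (S n) nd).
exists h; split=> // w; rewrite (Eq w) fz (Eh w) /=; ring.
Qed.

(** Either all Taylor coefficients of g - g z vanish, or the first nonzero one
    gives the order. *)
Lemma holo_order (g : C -> C) (z : C) : holomorphic_near g z ->
  locally z (fun w => g w = g z) \/
  exists d h, [/\ (1 <= d)%N, holomorphic_near h z, h z <> 0 &
    forall w, g w - g z = (w - z) ^ d * h w].
Proof.
move=> Hg.
have Hf : holomorphic_near (fun w => g w - g z) z by apply: holo_minus => //; apply: holo_const.
have [r [M [a [r0 He]]]] := holo_expands Hf.
have a0 : a 0%N = 0.
  rewrite -(expands_at0 r0 He); have -> : z + 0 = z by ring.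
  by ring.
have [hall|hex] := classic (forall n, a n = 0).
  left; apply/locally_Cmod; exists r => // w wr.
  have w0 := Cmod_ge_0 (w - z).
  have q01 := Cmod_ratio_lt1 r0 wr.
  have H : Cmod (g w - g z) <= 0.
    apply: (@geometric_squeeze _ (M * (r / (r - Cmod (w - z)))) _ q01) => N.
    have := He.2 (w - z) N wr; rewrite big1 => [|i _]; last by rewrite hall; ring.
    have -> : g (z + (w - z)) - g z - 0 = g w - g z.
      have -> : z + (w - z) = w by ring.
      by ring.
    lra.
  have -> : g w = (g w - g z) + g z by ring.
  by rewrite (Cmod_le_0_eq H); ring.
right.
have [n an] : exists n, a n <> 0.
  by apply: NNPP => h; apply: hex => n; apply: NNPP => h2; apply: h; exists n.
have [d [ad dmin]] : exists d, a d <> 0 /\ forall n, (n < d)%N -> a n = 0.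
  elim/ltn_ind: n an => n IH an.
  have [h|h] := classic (exists2 m, (m < n)%N & a m <> 0).
    by have [m mn am] := h; apply: IH mn am.
  exists n; split=> // m mn; apply: NNPP => h2; apply: h; by exists m.
have [h [Hh hz Eh]] := expands_order r0 Hf He dmin.
exists d, h; split=> //; last by rewrite hz.
by case: d ad {dmin hz Eh} => //; rewrite a0.
Qed.

(** C is connected: the indicator function of P is entire with derivative
    0. *)
Lemma locally_constant_pred (P : C -> Prop) :
  (forall z, locally z (fun w => P w <-> P z)) -> forall z z', P z -> P z'.
Proof.
move=> H.
pose chi z := if excluded_middle_informative (P z) then RtoC 1 else RtoC 0.
have d z : is_derive chi z (RtoC 0).
  apply: derive_ext_loc (derive_const (chi z) z).
  apply: locally_imp (H z) => w; rewrite /chi.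
  case: excluded_middle_informative => h1; case: excluded_middle_informative => h2 h //;
  by case: h => h3 h4; exfalso; auto.
have E z : chi z = chi 0 := entire_derive0_const d z.
move=> z z' hz; apply: NNPP => hz'.
have := E z'; rewrite -(E z) /chi.
do 2 case: excluded_middle_informative => // ?.
by move=> h; apply: (RtoC_neq0 R1_neq_R0).
Qed.

Lemma coord_inj (p q : sphere) : coord_dom p q -> coord p q = coord p p -> q = p.
Proof.
case: p => [a|]; case: q => [b|] //=; first by move=> _ ->.
move=> h e; exfalso; apply: h.
have [->//|b0] := classic (b = 0).
have : / b * b = 1 by field.
by rewrite e Cmult_0_l => h; case: (RtoC_neq0 R1_neq_R0).
Qed.

Section Converse.
Variables (k : nat) (c : 'I_k -> C) (f : C -> sphere).
Hypotheses (hk : (1 <= k)%N) (hc : injective c).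
Hypotheses (Hf : meromorphic f) (Hcrit : simple_critical_points_at f c).

Let g z w := coord (f z) (f w).

Lemma sphere_map_coord_dom z : locally z (fun w => coord_dom (f z) (f w)).
Proof. exact: (Hf.1 z).1. Qed.

Lemma sphere_map_coord_holo z : holomorphic_near (g z) z.
Proof. exact: (Hf.1 z).2. Qed.

Lemma power_derive_neq0 (h : C -> C) (z : C) (d : nat) : (1 <= d)%N ->
  holomorphic_near h z -> h z <> 0 ->
  locally z (fun w => w <> z -> forall l,
    is_derive (fun u => (u - z) ^ d * h u) w l -> l <> RtoC 0).
Proof.
case: d => // d _ Hh hz.
have Hp : holomorphic_near (fun w => RtoC (INR (S d)) * h w + (w - z) * C_derive h w) z.
  apply: holo_plus; first by apply: holo_mult; [exact: holo_const|].
  by apply: holo_mult; [exact: holo_shift | exact: holo_C_derive].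
have pz : RtoC (INR (S d)) * h z + (z - z) * C_derive h z <> 0.
  have -> : RtoC (INR (S d)) * h z + (z - z) * C_derive h z = RtoC (INR (S d)) * h z by ring.
  by apply: Cmult_neq_0 => //; apply: RtoC_neq0; apply: not_0_INR.
apply: locally_imp2 Hh (holo_neq0 Hp pz) => w hw pw wz l Hl.
have wc := Csub_neq0 wz.
have d1 := @derive_comp (fun v => v ^ S d) (fun u => u - z) w _ _ (derive_pow d (w - z)) (derive_shift z w).
have d2 := derive_mult d1 (derive_C_derive hw).
rewrite (derive_unique Hl d2).
have -> : 1 * (RtoC (INR (S d)) * (w - z) ^ d) * h w + (w - z) ^ S d * C_derive h w =
  (w - z) ^ d * (RtoC (INR (S d)) * h w + (w - z) * C_derive h w) by rewrite /=; ring.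
by apply: Cmult_neq_0 => //; apply: Cpow_nz.
Qed.

(** The set of points near which f is constant is open; its complement is open
    too, because near a point of finite order d the derivative of (w-z)^d h(w)
    vanishes only at z. Since C is connected and a point c i has local degree
    2, this set is empty. *)
Lemma sphere_map_not_locally_constant z : ~ locally z (fun w => f w = f z).
Proof.
move=> hz.
have ci : forall i, ~ locally (c i) (fun w => f w = f (c i)).
  move=> i H; have [_ [h [Hh hn E]]] := Hcrit.2 i.
  have H3 := holo_neq0 Hh hn.
  have H4 : locally (c i) (fun w => w <> c i -> False).
    apply: locally_imp2 (filter_and _ _ H E) H3 => w [e1 e2] hw wc.
    move: e2; rewrite e1 => e2.
    have : (w - c i) ^ 2 * h w <> 0.
      by apply: Cmult_neq_0 => //; apply: Cpow_nz; apply: Csub_neq0.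
    by apply; rewrite -e2; ring.
  by have [] := punctured_point H4.
apply: (ci (Ordinal hk)).
apply: (@locally_constant_pred (fun z => locally z (fun w => f w = f z)) _ z) hz.
move=> {}z.
have [H|H] := classic (locally z (fun w => f w = f z)).
  move: (H) (locally_locally _ _ H); apply: locally_imp2 => w e hl; split=> _; first exact: H.
  by apply: locally_imp hl => u hu; rewrite hu e.
have [E|[d [h [d1 Hh hn E]]]] := holo_order (sphere_map_coord_holo z).
  case: H; apply: locally_imp2 E (sphere_map_coord_dom z) => w e1 e2.
  exact: coord_inj.
apply: locally_imp (power_derive_neq0 d1 Hh hn) => w hw.
have [->|wz] := classic (w = z); first by [].
split=> // Hw; exfalso; apply: (hw wz (RtoC 0)) => //.
apply: derive_ext_loc (derive_const (g z w - g z z) w).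
apply: locally_imp Hw => u eu.
by rewrite -(E u) /g eu.
Qed.

Lemma noncritical_derive_neq0 z : off_points c z -> C_derive (g z) z <> 0.
Proof.
move=> hz.
have [E|[d [h [d1 Hh hn E]]]] := holo_order (sphere_map_coord_holo z).
  case: (@sphere_map_not_locally_constant z); apply: locally_imp2 E (sphere_map_coord_dom z) => w e1 e2.
  exact: coord_inj.
have hd : has_local_degree f z d.
  by split=> //; exists h; split=> //; apply: filter_forall.
case: d d1 E hd => [|[|d]] // _ E hd; last first.
  have /Hcrit.1 [i e] : critical_point f z by exists d.+2.
  by case: (hz i).
have [a Ha] := holo_ex_derive Hh.
have d2 := derive_plus (derive_const (g z z) z) (derive_mult (derive_shift z z) Ha).
rewrite (is_C_derive_unique (g z) z (h z)) //.
apply: (@derive_ext_loc (fun w => g z z + (w - z) * h w)); last first.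
  by apply: is_derive_eq d2 _; ring.
apply: filter_forall => w; have -> : g z w = g z z + (g z w - g z z) by ring.
by rewrite (E w) /=; ring.
Qed.

(** Unlike the formula in the finite coordinate, this is meaningful at the
    simple poles of f too, where it is the extension by continuity. *)
Definition sphere_schwarzian (z : C) : C := schwarzian_formula (g z) z.

(** Near a pole z the coordinate around f w is generally the finite one while
    that of f z is 1/f; [schwarzian_inv] compares the two. *)
Lemma sphere_schwarzian_near z :
  locally z (fun w => C_derive (g z) w <> 0 -> sphere_schwarzian w = schwarzian_formula (g z) w).
Proof.
have E1 := sphere_map_coord_dom z; have E2 := sphere_map_coord_holo z.
apply: locally_imp2 (locally_locally _ _ E1) (locally_locally _ _ E2) => w Hd Hg n.
rewrite /sphere_schwarzian.
have e0 := locally_singleton _ _ Hd.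
have Dw := sphere_map_coord_dom w.
rewrite /g in Hg n *.
case ez : (f z) e0 Hd Hg n => [a|] e0 Hd Hg n; case ew : (f w) e0 Dw => [b|] e0 Dw //.
rewrite /= in Hg n e0 *.
have b0 : b <> 0 by move=> h; apply: e0; rewrite h.
have gw : coord_inf (f w) <> 0.
  rewrite ew /= => h; have : / b * b = 1 by field.
  by rewrite h Cmult_0_l => h1; apply: (RtoC_neq0 R1_neq_R0).
have Hinv : holomorphic_near (fun u => / coord_inf (f u)) w.
  apply: (@holo_ext (fun u => 1 / coord_inf (f u))).
    by apply: filter_forall => u; rewrite /Cdiv Cmult_1_l.
  by apply: holo_div => //; apply: holo_const.
have Dinv : C_derive (fun u => / coord_inf (f u)) w <> 0.
  have d1 := derive_inv gw (derive_C_derive (holo_ex_derive Hg)).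
  rewrite (is_C_derive_unique _ _ _ d1) => h; apply: n.
  set x := C_derive _ w in h *; set y := coord_inf (f w) in h gw *.
  have -> : x = - (- x / (y * y)) * (y * y) by field.
  by rewrite h; ring.
rewrite -(schwarzian_inv Hg gw n).
apply: schwarzian_ext => //.
apply: locally_imp2 Hd Dw => u h1 h2.
case: (f u) h1 h2 => [v|] //= h1 _.
have v0 : v <> 0 by move=> h; apply: h1; rewrite h.
by field.
Qed.

Lemma sphere_schwarzian_holo z : off_points c z -> holomorphic_near sphere_schwarzian z.
Proof.
move=> hz; have n := noncritical_derive_neq0 hz; have Hg := sphere_map_coord_holo z.
apply: (@holo_ext (schwarzian_formula (g z))); last exact: holo_schwarzian.
apply: locally_imp2 (sphere_schwarzian_near z) (holo_neq0 (holo_C_derive Hg) n) => w h1 h2.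
by rewrite h1.
Qed.

Lemma sphere_schwarzian_correct z : off_points c z -> is_schwarzian_at f z (sphere_schwarzian z).
Proof.
move=> hz; have n := noncritical_derive_neq0 hz.
have Hc := holo_continuous (sphere_schwarzian_holo hz).
have [q [Eq dq Hq _]] := holo_factor (sphere_map_coord_holo z).
rewrite /is_schwarzian_at; case ez : (f z) => [a|].
  by rewrite /sphere_schwarzian /g ez.
apply: (filterlim_ext_loc sphere_schwarzian); last first.
  by apply: filterlim_filter_le_1 Hc; apply: filter_le_within.
have qz : q z <> 0 by rewrite -(is_C_derive_unique _ _ _ dq).
apply: locally_imp (holo_neq0 Hq qz) => w qw wz.
rewrite /sphere_schwarzian /g.
case ew : (f w) => [b|] //; exfalso.
have := Eq w; rewrite /g ez ew /= => h.
have : (w - z) * q w <> 0 by apply: Cmult_neq_0 => //; apply: Csub_neq0.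
by apply; rewrite [RHS]h; ring.
Qed.

(** From g = g(z) + (w-z)^2 h one gets g' = (w-z) p with p(z) = 2 h(z) <> 0,
    so g''/g' = 1/(w-z) + p'/p. *)
Lemma sphere_schwarzian_at_critical i : exists r H, holomorphic_near H (c i) /\
  locally (c i) (fun w => w <> c i -> sphere_schwarzian w =
    - (3 / 2) * (1 / (w - c i) ^ 2) + r / (w - c i) - r ^ 2 / 2 + (w - c i) * H w).
Proof.
have [_ [h [Hh hn E]]] := Hcrit.2 i.
have Hh' := holo_C_derive Hh.
set z := c i in Hh hn E Hh' *.
have Hg := sphere_map_coord_holo z.
pose p w := 2 * h w + (w - z) * C_derive h w.
have Hp : holomorphic_near p z.
  apply: holo_plus; first by apply: holo_mult => //; apply: holo_const.
  by apply: holo_mult => //; apply: holo_shift.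
have pz : p z <> 0.
  rewrite /p; have -> : 2 * h z + (z - z) * C_derive h z = 2 * h z by ring.
  by apply: Cmult_neq_0 => //; apply: C2_neq0.
pose m := dlog p.
have Hm : holomorphic_near m z := holo_dlog Hp pz.
have [H [HH EH]] := log_normal Hm.
exists (- m z), H; split=> //.
have dg : locally z (fun w => is_derive (g z) w ((w - z) * p w)).
  apply: locally_imp2 (locally_locally _ _ E) Hh => w hE hw.
  have t1 := derive_shift z w.
  have d3 := derive_plus (derive_const (g z z) w) (derive_mult (derive_mult t1 t1) (derive_C_derive hw)).
  apply: (@derive_ext_loc (fun w => g z z + (w - z) * (w - z) * h w)).
    apply: locally_imp hE => u hu.
    have -> : g z u = g z z + (coord (f z) (f u) - coord (f z) (f z)) by rewrite /g; ring.
    by rewrite hu /=; ring.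
  by apply: is_derive_eq d3 _; rewrite /p; ring.
have Hall : locally z (fun w => [/\ is_derive (g z) w ((w - z) * p w), ex_derive p w, p w <> 0 & ex_derive m w]).
  apply: locally_imp2 (filter_and _ _ dg Hp) (filter_and _ _ (holo_neq0 Hp pz) Hm) => w [h1 h2] [h3 h4].
  by split.
apply: locally_imp2 (locally_locally _ _ Hall) (sphere_schwarzian_near z) => w Hw hS wz.
have wc := Csub_neq0 wz.
have [e1 e2 e3 e4] := locally_singleton _ _ Hw.
rewrite hS; last by rewrite (is_C_derive_unique _ _ _ e1); apply: Cmult_neq_0.
have -> : (- m z) ^ 2 = m z ^ 2 by rewrite /=; ring.
rewrite -EH //.
have dL := derive_plus (@derive_inv (fun u => u - z) w _ wc (derive_shift z w)) (derive_C_derive e4).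
rewrite (@schwarzian_log _ (fun w => (w - z) * p w) (fun w => / (w - z) + m w) _ w _ _ dL).
- by congr (_ + _ - _); field.
- by apply: locally_imp Hw => u [].
- apply: locally_imp2 Hw (locally_neq wz) => u [_ h2 h3 _] /Csub_neq0 uz.
  apply: is_derive_eq (derive_mult (derive_shift z u) (derive_C_derive h2)) _.
  by rewrite /m /dlog; field.
- exact: Cmult_neq_0.
Qed.

Theorem schwarzian_has_normal_form : exists (r : 'I_k -> C) (G : C -> C),
  entire G /\ is_schwarzian f (psi_fun c r G).
Proof.
pose r i := proj1_sig (constructive_indefinite_description _ (sphere_schwarzian_at_critical i)).
have rP i := proj2_sig (constructive_indefinite_description _ (sphere_schwarzian_at_critical i)).
have [G [HG EG]] := schwarzian_normal_form (r := r) hc sphere_schwarzian_holo rP.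
exists r, G; split=> // z nc.
have hz : off_points c z by move=> i e; apply: nc; apply/Hcrit.1; exists i.
by rewrite -EG //; apply: sphere_schwarzian_correct.
Qed.
End Converse.

Theorem theorem1p3 (k : nat) (hk : (1 <= k)%N)
    (c : 'I_k -> C) (hc : injective c) :
  (forall (r : 'I_k -> C) (G : C -> C), entire G ->
     exists f : C -> sphere,
       [/\ meromorphic f,
           simple_critical_points_at f c &
           is_schwarzian f (psi_fun c r G)])
  /\
  (forall f : C -> sphere,
     meromorphic f -> simple_critical_points_at f c ->
     exists (r : 'I_k -> C) (G : C -> C),
       entire G /\ is_schwarzian f (psi_fun c r G)).
Proof.
split=> [r G HG|f Hf Hcrit].
  exact: schwarzian_realized.
exact: schwarzian_has_normal_form.
Qed.
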